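(* Let $\mathcal{C}$ be a pseudo-unitary premodular fusion category with $\mathcal{Z}_2(\mathcal{C})\subseteq \mathcal{C}_{\mathrm{pt}}$. (1) For any simple object $Y$ of $\mathcal{C}$ one has $$\frac{\mathrm{FPdim}(\mathcal{C})\,\mathrm{FPdim}(\mathcal{Z}_2(\mathcal{C}))}{\mathrm{FPdim}(Y)^2}\in \mathbb{A}.$$ (2) If the action of $\mathcal{Z}_2(\mathcal{C})$ on the simple objects of $\mathcal{C}$ is free, then for any simple object $Y$ of $\mathcal{C}$ $$\frac{\mathrm{FPdim}(\mathcal{C})}{\mathrm{FPdim}(\mathcal{Z}_2(\mathcal{C}))\,\mathrm{FPdim}(Y)^2}\in \mathbb{A}.$$
   Context: All fusion categories are over $\mathbb{C}$. A premodular category is a braided fusion category equipped with a spherical structure. $\mathrm{FPdim}$ is the Frobenius-Perron dimension; $\mathcal{C}$ is pseudo-unitary if $\mathrm{FPdim}(\mathcal{C})=\dim(\mathcal{C})$. The Müger center $\mathcal{Z}_2(\mathcal{C})=\mathcal{C}'$ is the fusion subcategory generated by all simple objects $Y$ with $c_{Y,X}c_{X,Y}=\mathrm{id}_{X\otimes Y}$ for every object $X$ of $\mathcal{C}$, where $c$ is the braiding. $\mathcal{C}_{\mathrm{pt}}$ is the maximal pointed fusion subcategory of $\mathcal{C}$ (generated by the invertible simple objects). Since $\mathcal{Z}_2(\mathcal{C})\subseteq\mathcal{C}_{\mathrm{pt}}$, the group of isomorphism classes of simple objects of $\mathcal{Z}_2(\mathcal{C})$ acts on the set of isomorphism classes of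 simple objects of $\mathcal{C}$ by tensor product; the action is free if $g\otimes X\not\cong X$ for every simple $X$ of $\mathcal{C}$ and every simple $g\not\cong\mathbf{1}$ of $\mathcal{Z}_2(\mathcal{C})$. $\mathbb{A}$ is the ring of algebraic integers. *)

(* Defs.v *)
From HB Require Import structures.
From mathcomp Require Import all_boot all_order all_algebra.
From mathcomp Require Import boolp classical_sets reals.
From mathcomp Require Import complex.
Set Implicit Arguments.
Unset Strict Implicit.
Unset Printing Implicit Defensive.
Import Order.TTheory GRing.Theory Num.Theory.
Local Open Scope classical_set_scope.
Local Open Scope ring_scope.
Local Open Scope complex_scope.

Declare Scope fcat_scope.
Delimit Scope fcat_scope with fcat.
Local Open Scope fcat_scope.

Record linCategory (K : fieldType) := LinCategory {
  obj :> Type;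
  hom : obj -> obj -> vectType K;
  idm : forall X : obj, hom X X;
  comp : forall {X Y Z : obj}, hom Y Z -> hom X Y -> hom X Z;
  comp_idl : forall (X Y : obj) (f : hom X Y), comp (idm Y) f = f;
  comp_idr : forall (X Y : obj) (f : hom X Y), comp f (idm X) = f;
  compA : forall (W X Y Z : obj) (h : hom Y Z) (g : hom X Y) (f : hom W X),
    comp h (comp g f) = comp (comp h g) f;
  comp_linearr : forall (X Y Z : obj) (g : hom Y Z),
    linear (fun f : hom X Y => comp g f);
  comp_linearl : forall (X Y Z : obj) (f : hom X Y),
    linear (fun g : hom Y Z => comp g f)
}.

Notation "g ∘ f" := (comp g f) (at level 40, left associativity) : fcat_scope.

Section LinCategory.
Variables (K : fieldType) (C : linCategory K).
Implicit Types X Y Z : C.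

Definition is_inverse X Y (f : hom X Y) (g : hom Y X) : Prop :=
  g ∘ f = idm X /\ f ∘ g = idm Y.

Definition is_iso X Y (f : hom X Y) : Prop := exists g, is_inverse f g.

Definition isomorphic X Y : Prop := exists f : hom X Y, is_iso f.

Definition is_mono X Y (f : hom X Y) : Prop :=
  forall Z (g h : hom Z X), f ∘ g = f ∘ h -> g = h.

Definition is_epi X Y (f : hom X Y) : Prop :=
  forall Z (g h : hom Y Z), g ∘ f = h ∘ f -> g = h.

Definition is_zero X : Prop := idm X = 0.

Definition is_kernel W X Y (k : hom W X) (f : hom X Y) : Prop :=
  f ∘ k = 0 /\
  forall Z (h : hom Z X), f ∘ h = 0 -> exists! h' : hom Z W, k ∘ h' = h.

Definition is_cokernel X Y W (q : hom Y W) (f : hom X Y) : Prop :=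
  q ∘ f = 0 /\
  forall Z (h : hom Y Z), h ∘ f = 0 -> exists! h' : hom W Z, h' ∘ q = h.

(* For n = 0 this says that S is a zero object. *)
Definition is_direct_sum n (F : 'I_n -> C) (S : C) : Prop :=
  exists (inc : forall j, hom (F j) S) (prj : forall j, hom S (F j)),
    [/\ forall j, prj j ∘ inc j = idm (F j),
        forall j k, j != k -> prj j ∘ inc k = 0
      & \sum_(j < n) inc j ∘ prj j = idm S].

Record is_abelian : Prop := IsAbelian {
  ab_direct_sum : forall n (F : 'I_n -> C), exists S, is_direct_sum F S;
  ab_kernel : forall X Y (f : hom X Y), exists W (k : hom W X), is_kernel k f;
  ab_cokernel : forall X Y (f : hom X Y),
    exists W (q : hom Y W), is_cokernel q f;
  ab_mono_normal : forall X Y (f : hom X Y),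
    is_mono f -> exists Z (g : hom Y Z), is_kernel f g;
  ab_epi_normal : forall X Y (f : hom X Y),
    is_epi f -> exists Z (g : hom Z X), is_cokernel f g
}.

Definition is_simple X : Prop :=
  ~ is_zero X /\
  forall Y (f : hom Y X), is_mono f -> is_zero Y \/ is_iso f.

Definition is_semisimple : Prop :=
  forall X, exists n (F : 'I_n -> C),
    (forall j, is_simple (F j)) /\ is_direct_sum F X.

End LinCategory.

Record monoidalCategory (K : fieldType) := MonoidalCategory {
  mon_cat :> linCategory K;
  tens : mon_cat -> mon_cat -> mon_cat;
  tensm : forall {X X' Y Y' : mon_cat},
    hom X X' -> hom Y Y' -> hom (tens X Y) (tens X' Y');
  unit_obj : mon_cat;
  assoc : forall X Y Z, hom (tens (tens X Y) Z) (tens X (tens Y Z));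
  associ : forall X Y Z, hom (tens X (tens Y Z)) (tens (tens X Y) Z);
  lunit : forall X, hom (tens unit_obj X) X;
  luniti : forall X, hom X (tens unit_obj X);
  runit : forall X, hom (tens X unit_obj) X;
  runiti : forall X, hom X (tens X unit_obj);
  tensm_id : forall X Y, tensm (idm X) (idm Y) = idm (tens X Y);
  tensm_comp : forall (X X' X'' Y Y' Y'' : mon_cat)
      (f' : hom X' X'') (f : hom X X') (g' : hom Y' Y'') (g : hom Y Y'),
    tensm (f' ∘ f) (g' ∘ g) = tensm f' g' ∘ tensm f g;
  tensm_linearr : forall (X X' Y Y' : mon_cat) (f : hom X X'),
    linear (fun g : hom Y Y' => tensm f g);
  tensm_linearl : forall (X X' Y Y' : mon_cat) (g : hom Y Y'),
    linear (fun f : hom X X' => tensm f g);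
  assoc_inverse : forall X Y Z, is_inverse (assoc X Y Z) (associ X Y Z);
  lunit_inverse : forall X, is_inverse (lunit X) (luniti X);
  runit_inverse : forall X, is_inverse (runit X) (runiti X);
  assoc_natural : forall (X X' Y Y' Z Z' : mon_cat)
      (f : hom X X') (g : hom Y Y') (h : hom Z Z'),
    assoc X' Y' Z' ∘ tensm (tensm f g) h
    = tensm f (tensm g h) ∘ assoc X Y Z;
  lunit_natural : forall (X X' : mon_cat) (f : hom X X'),
    lunit X' ∘ tensm (idm unit_obj) f = f ∘ lunit X;
  runit_natural : forall (X X' : mon_cat) (f : hom X X'),
    runit X' ∘ tensm f (idm unit_obj) = f ∘ runit X;
  pentagon : forall W X Y Z,
    assoc W X (tens Y Z) ∘ assoc (tens W X) Y Z
    = tensm (idm W) (assoc X Y Z) ∘ assoc W (tens X Y) Z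
      ∘ tensm (assoc W X Y) (idm Z);
  triangle : forall X Y,
    tensm (idm X) (lunit Y) ∘ assoc X unit_obj Y = tensm (runit X) (idm Y)
}.

Notation "X ⊗ Y" := (tens X Y) (at level 30, right associativity) : fcat_scope.
Notation "f ⊠ g" := (tensm f g) (at level 30, right associativity) : fcat_scope.
Notation "𝟙" := (unit_obj _) : fcat_scope.

(* D is a left dual of X (the convention in which ev : D ⊗ X -> 1). *)
Definition is_left_dual (K : fieldType) (C : monoidalCategory K) (X D : C)
    (ev : hom (D ⊗ X) 𝟙) (coev : hom 𝟙 (X ⊗ D)) : Prop :=
  runit X ∘ (idm X ⊠ ev) ∘ assoc X D X ∘ (coev ⊠ idm X) ∘ luniti X = idm X /\
  lunit D ∘ (ev ⊠ idm D) ∘ associ D X D ∘ (idm D ⊠ coev) ∘ runiti D = idm D.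

(* Left duals and representatives of the isomorphism classes of simple objects
   are carried as data; both are unique up to isomorphism. *)
Record fusionCategory (K : fieldType) := FusionCategory {
  fus_mon :> monoidalCategory K;
  dual : fus_mon -> fus_mon;
  ev : forall X : fus_mon, hom (dual X ⊗ X) 𝟙;
  coev : forall X : fus_mon, hom 𝟙 (X ⊗ dual X);
  irr : finType;
  irr_obj : irr -> fus_mon;
  fus_abelian : is_abelian fus_mon;
  fus_semisimple : is_semisimple fus_mon;
  fus_unit_simple : is_simple (unit_obj fus_mon);
  fus_left_dual : forall X, is_left_dual (ev X) (coev X);
  fus_right_dual : forall X : fus_mon, exists (D : fus_mon)
    (ev' : hom (X ⊗ D) 𝟙) (coev' : hom 𝟙 (D ⊗ X)), is_left_dual ev' coev';
  irr_simple : forall i, is_simple (irr_obj i);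
  irr_complete : forall X : fus_mon,
    is_simple X -> exists! i, isomorphic X (irr_obj i)
}.

Section Fusion.
Variables (K : fieldType) (C : fusionCategory K).
Implicit Types X Y Z W : C.

(* Transposition Hom(Z ⊗ W, 1) -> Hom(Z, W^* ). *)
Definition curry Z W (h : hom (Z ⊗ W) 𝟙) : hom Z (dual W) :=
  lunit (dual W) ∘ (h ⊠ idm (dual W)) ∘ associ Z W (dual W)
  ∘ (idm Z ⊠ coev W) ∘ runiti Z.

Definition dualm X Y (f : hom X Y) : hom (dual Y) (dual X) :=
  curry (ev Y ∘ (idm (dual Y) ⊠ f)).

(* The canonical isomorphism Y^* ⊗ X^* -> (X ⊗ Y)^*. *)
Definition dual_tens X Y : hom (dual Y ⊗ dual X) (dual (X ⊗ Y)) :=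
  curry (ev Y ∘ (idm (dual Y) ⊠ lunit Y)
    ∘ (idm (dual Y) ⊠ (ev X ⊠ idm Y))
    ∘ (idm (dual Y) ⊠ associ (dual X) X Y)
    ∘ assoc (dual Y) (dual X) (X ⊗ Y)).

Definition left_trace X (f : hom X (dual (dual X))) : hom 𝟙 (𝟙 : C) :=
  ev (dual X) ∘ (f ⊠ idm (dual X)) ∘ coev X.

(* The scalar c such that f = c *: id; End(1) is one-dimensional when K is
   algebraically closed. *)
Definition scalar_of (f : hom 𝟙 (𝟙 : C)) : K :=
  coord [tuple idm (unit_obj C)] ord0 f.

Definition is_invertible X : Prop := is_iso (ev X) /\ is_iso (coev X).

(* Fusion subcategories are full and replete, hence sets of objects. *)
Record is_fusion_subcategory (D : set C) : Prop := IsFusionSubcategory {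
  sub_unit : D 𝟙;
  sub_tens : forall X Y, D X -> D Y -> D (X ⊗ Y);
  sub_dual : forall X, D X -> D (dual X);
  sub_direct_sum : forall n (F : 'I_n -> C) X,
    (forall j, D (F j)) -> is_direct_sum F X -> D X;
  sub_summand : forall X Y (i : hom X Y) (p : hom Y X),
    p ∘ i = idm X -> D Y -> D X
}.

Definition generated_by (S : set C) : set C :=
  [set X | forall D : set C, is_fusion_subcategory D -> S `<=` D -> D X].

Definition pointed_part : set C :=
  generated_by [set X | is_simple X /\ is_invertible X].

End Fusion.

Arguments pointed_part {K} C _.

Record braidedFusionCategory (K : fieldType) := BraidedFusionCategory {
  br_fus :> fusionCategory K;
  braid : forall X Y : br_fus, hom (X ⊗ Y) (Y ⊗ X);
  braid_iso : forall X Y, is_iso (braid X Y);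
  braid_natural : forall (X X' Y Y' : br_fus) (f : hom X X') (g : hom Y Y'),
    braid X' Y' ∘ (f ⊠ g) = (g ⊠ f) ∘ braid X Y;
  hexagon1 : forall X Y Z,
    assoc Y Z X ∘ braid X (Y ⊗ Z) ∘ assoc X Y Z
    = (idm Y ⊠ braid X Z) ∘ assoc Y X Z ∘ (braid X Y ⊠ idm Z);
  hexagon2 : forall X Y Z,
    associ Z X Y ∘ braid (X ⊗ Y) Z ∘ associ X Y Z
    = (braid X Z ⊠ idm Y) ∘ associ X Z Y ∘ (idm X ⊠ braid Y Z)
}.

(* [piv] is a monoidal natural isomorphism from the identity functor to the
   double dual functor; [piv_spherical] says dim X = dim X^*.  *)
Record premodularCategory (K : fieldType) := PremodularCategory {
  prem_br :> braidedFusionCategory K;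
  piv : forall X : prem_br, hom X (dual (dual X));
  piv_iso : forall X, is_iso (piv X);
  piv_natural : forall (X Y : prem_br) (f : hom X Y),
    piv Y ∘ f = dualm (dualm f) ∘ piv X;
  piv_monoidal : forall X Y,
    dualm (dual_tens X Y) ∘ piv (X ⊗ Y)
    = dual_tens (dual Y) (dual X) ∘ (piv X ⊠ piv Y);
  piv_spherical : forall X, left_trace (piv X) = left_trace (piv (dual X))
}.

Section Braided.
Variables (K : fieldType) (C : braidedFusionCategory K).

Definition mueger_center : set C :=
  generated_by [set Y | is_simple Y /\
    forall X : C, braid Y X ∘ braid X Y = idm (X ⊗ Y)].

Definition acts_freely : Prop :=
  forall g X : C, mueger_center g -> is_simple g -> ~ isomorphic g 𝟙 ->
    is_simple X -> ~ isomorphic (g ⊗ X) X.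

End Braided.

Arguments mueger_center {K} C _.

Section CategoricalDim.
Variables (K : fieldType) (C : premodularCategory K).

Definition cat_dim (X : C) : K := scalar_of (left_trace (piv X)).

Definition global_dim : K := \sum_(i : irr C) cat_dim (irr_obj i) ^+ 2.

End CategoricalDim.

Section FPdim.
Variables (R : realType) (C : fusionCategory R[i]).

(* For Z simple, the multiplicity of Z in X ⊗ Y. *)
Definition fusion_coeff (X Y Z : C) : nat := \dim {: hom Z (X ⊗ Y)}.

(* The simple objects, up to isomorphism, of the fusion subcategory D. *)
Definition irr_in (D : set C) : finType := {i : irr C | irr_obj i \in D}.

(* Left multiplication by X on the Grothendieck ring of D, for X in D. *)
Definition fusion_matrix (D : set C) (X : C) : 'M[R]_#|irr_in D| :=
  \matrix_(j, k) (fusion_coeff X (irr_obj (val (enum_val j)))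
                                 (irr_obj (val (enum_val k))))%:R.

(* The Frobenius-Perron eigenvalue: a matrix has finitely many eigenvalues, so
   the supremum is a maximum. *)
Definition FPdim_in (D : set C) (X : C) : R :=
  sup [set r : R | 0 <= r /\ eigenvalue (fusion_matrix D X) r].

Definition FPdim_sub (D : set C) : R :=
  \sum_(i : irr_in D) FPdim_in D (irr_obj (val i)) ^+ 2.

Definition FPdim (X : C) : R := FPdim_in setT X.

Definition FPdim_cat : R := FPdim_sub setT.

End FPdim.

Arguments FPdim_cat {R} C.

Definition pseudo_unitary (R : realType) (C : premodularCategory R[i]) : Prop :=
  (FPdim_cat C)%:C = global_dim C.

Definition algebraic_integer (R : realType) (x : R[i]) : Prop :=
  integralOver (intr : int -> R[i]) x.

(* Main.v *)
Require Import Defs.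
From HB Require Import structures.
From mathcomp Require Import all_boot all_order all_algebra.
From mathcomp Require Import boolp classical_sets reals.
From mathcomp Require Import complex.
From mathcomp Require Import ring lra spectral sesquilinear.
Import Defs.
Set Implicit Arguments.
Unset Strict Implicit.
Unset Printing Implicit Defensive.
Import Order.TTheory GRing.Theory Num.Theory.
Local Open Scope ring_scope.
Local Open Scope fcat_scope.

(** The integrality is that of a Verlinde-type sum.  For simple objects X and
    Z, tracing out X in the double braiding of Z with X gives an endomorphism
    of Z, that is, a scalar chi_Z(X) ([braid_char]).  Each chi_Z is a character
    of the Grothendieck ring ([braid_char_mul]), so its values are eigenvalues
    of nonnegative integer matrices and hence algebraic integers.  Writing d for
    the categorical dimension, d_Z chi_Z(X) = d_X chi_X(Z), both sides being the
    trace of the double braiding ([braid_char_sym]).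

    Distinct characters of the Grothendieck ring are orthogonal.  Applied to
      d_Y^2 sum_X |chi_Y(X)|^2 = sum_X d_X^2 chi_X(Y tensor dual Y),
    symmetry and orthogonality leave dim C times the sum of the
    [Y tensor dual Y : Z] d_Z over the simple Z with chi_Z = d
    ([codegree_sum]).  By a handle slide such a Z is transparent
    ([transparent_dual]), so it lies in the Mueger center and is invertible by
    hypothesis.  It then occurs in Y tensor dual Y, with multiplicity one, exactly
    when Z tensor Y is isomorphic to Y, and in that case d_Z = 1.  Therefore
      sum_X |chi_Y(X)|^2 = |H| dim C / d_Y^2,
    where H is a subgroup of the group G of simple objects of the Mueger
    center, contained in the stabilizer of Y.  As |H| divides |G|, this gives
    the first claim.  For the second, H is trivial, and |chi_Y| is constant on
    the G-orbits since chi_Y(g) has modulus one for g in G; the orbits having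
    |G| elements each, dim C / d_Y^2 is |G| times an algebraic integer.

    The Frobenius-Perron dimension enters through the positive character f of
    the Grothendieck ring.  It is the value of FPdim on simple objects
    ([FPdim_inE]) and bounds the modulus of every character, so pseudo-unitarity
    forces d^2 = f^2 termwise ([dim_sqr]).

    Diagrams are computed in a strict form: a morphism between tensor products
    of X, Y, ... is replaced by the family, natural in V, of the morphisms it
    induces between the nested products X tensor (Y tensor ( ... tensor V)).
    Juxtaposing diagrams then means evaluating families at other objects, which
    removes the associators from the manipulation of diagrams. *)

(** * Symmetric positive matrices *)

Section PerronFrobenius.
Import Num.Def.
Local Open Scope sesquilinear_scope.
Variable R : rcfType.
Local Notation toC := (real_complex R).

(** By the spectral theorem over R[i], with mu the largest eigenvalue; the real
    or the imaginary part of a complex eigenvector is a nonzero real one. *)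
Lemma Rayleigh_max_eigenvector n (A : 'M[R]_n.+1) :
  A^T = A ->
  exists mu (x : 'rV[R]_n.+1), [/\ x != 0, x *m A = mu *: x &
    forall y : 'rV_n.+1, (y *m A *m y^T) 0 0 <= mu * (y *m y^T) 0 0].
Proof.
move=> symA.
pose B : 'M[R[i]]_n.+1 := map_mx toC A.
have realM m p (X : 'M[R]_(m, p)) : map_mx conjC (map_mx toC X) = map_mx toC X.
  by apply/matrixP=> i j; rewrite !mxE conj_Creal // complex_real.
have hermB : B \is hermsymmx.
  apply: realsym_hermsym; last first.
    by apply/mxOverP=> i j; rewrite mxE complex_real.
  apply/is_hermitianmxP; rewrite expr0 scale1r.
  by apply/matrixP=> i j; rewrite !mxE /= -{1}symA mxE.
have /orthomx_spectralP defB := hermitian_normalmx hermB.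
have unitP := spectral_unitarymx B.
have := hermitian_spectral_diag_real hermB.
move: (spectralmx B) (spectral_diag B) defB unitP => P D defB unitP /mxOverP rD.
have [D' defD] : exists D' : 'rV[R]_n.+1, D = map_mx toC D'.
  by exists (map_mx (@complex.Re R) D); apply/rowP=> i; rewrite !mxE RRe_real.
pose k := [arg max_(i > ord0) D' 0 i]%O.
have kP i : D' 0 i <= D' 0 k.
  by rewrite /k; case: arg_maxP => //= j _; apply.
pose mu := D' 0 k; exists mu.
have eigB : row k P *m B = toC mu *: row k P.
  rewrite defB !mulmxA -row_mul mulmxV ?unitarymx_unit // row1 -rowE.
  by rewrite row_diag_mx -scalemxAl -rowE defD mxE.
have Pk0 : row k P != 0.
  have /row_unitarymxP/(_ k k) := unitP; rewrite eqxx dotmxE => h.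
  by apply/eqP=> P0; move: h; rewrite P0 mul0mx mxE => /esym/eqP; rewrite oner_eq0.
have [f [fD fM fP0]] : exists f : R[i] -> R,
    [/\ forall I (r : seq I) F, f (\sum_(i <- r) F i) = \sum_(i <- r) f (F i),
        forall z a, f (z * toC a) = f z * a & map_mx f (row k P) != 0].
  have [P0|] := eqVneq (map_mx (@complex.Re R) (row k P)) 0; last first.
    exists (@complex.Re R); split=> //.
      by move=> I r F; apply: (big_morph (@complex.Re R)) => // [[a b] [c e]].
    by case=> a b c /=; rewrite mulr0 subr0.
  exists (@complex.Im R); split.
  - by move=> I r F; apply: (big_morph (@complex.Im R)) => // [[a b] [c e]].
    by case=> a b c /=; rewrite mulr0 add0r.
  apply: contra Pk0 => /eqP P0'; apply/eqP/rowP=> i; rewrite [RHS]mxE.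
  apply/eqP; rewrite eq_complex /=.
  by move/rowP/(_ i): P0; move/rowP/(_ i): P0'; rewrite !mxE => -> ->; rewrite eqxx.
exists (map_mx f (row k P)); split=> //.
  apply/rowP=> j; move/rowP/(_ j): eigB; rewrite !mxE => /(congr1 f).
  rewrite fD [toC mu * _]mulrC fM mulrC => <-; apply: eq_bigr => i _.
  by rewrite mxE -fM [B i j]mxE.
move=> y; rewrite -lecR.
pose z := map_mx toC y *m P^t*.
have defy : map_mx toC y = z *m P by rewrite /z mulmxKtV.
have norm_y : toC ((y *m y^T) 0 0) = \sum_i `|z 0 i| ^+ 2.
  transitivity ((map_mx toC y *m (map_mx toC y)^t*) 0 0).
    by rewrite -map_trmx realM map_trmx -map_mxM [RHS]mxE.
  rewrite {1}defy -mulmxA.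
  have -> : P *m (map_mx toC y)^t* = z^t*.
    by rewrite /z trmx_mul map_mxM trmxCK.
  by rewrite mxE; apply: eq_bigr => i _; rewrite !mxE normCK.
have form_y : toC ((y *m A *m y^T) 0 0) = \sum_i toC (D' 0 i) * `|z 0 i| ^+ 2.
  transitivity ((map_mx toC y *m B *m (map_mx toC y)^t*) 0 0).
    by rewrite -map_trmx realM map_trmx -!map_mxM [RHS]mxE.
  rewrite {1}defy defB -!mulmxA.
  have -> : P *m (map_mx toC y)^t* = z^t*.
    by rewrite /z trmx_mul map_mxM trmxCK.
  rewrite !mulmxA mulmxK ?unitarymx_unit // mul_mx_diag mxE.
  by apply: eq_bigr => i _; rewrite !mxE normCK defD mxE mulrAC mulrC mulrA.
change (toC ((y *m A *m y^T) 0 0) <= toC (mu * (y *m y^T) 0 0)).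
rewrite rmorphM [X in _ * X]norm_y form_y mulr_sumr; apply: ler_sum => i _.
by apply: ler_wpM2r; rewrite ?exprn_ge0 // lecR kP.
Qed.

(** A vanishing point of a positive semidefinite form is a minimum, so the
    gradient of the form is zero there. *)
Lemma psd_isotropic_null n (B : 'M[R]_n) (y : 'rV_n) :
    B^T = B -> (forall x : 'rV_n, 0 <= (x *m B *m x^T) 0 0) ->
  (y *m B *m y^T) 0 0 = 0 -> y *m B = 0.
Proof.
move=> symB psdB y0; set g := y *m B.
have sq_g : (g *m g^T) 0 0 = \sum_i g 0 i ^+ 2.
  by rewrite mxE; apply: eq_bigr => i _; rewrite [g^T i 0]mxE -expr2.
have gBy : g *m B *m y^T = g *m g^T.
  by rewrite /g trmx_mul symB !mulmxA.
suff: (g *m g^T) 0 0 = 0.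
  rewrite sq_g => /eqP; rewrite psumr_eq0 => [/allP g0|i _]; last exact: sqr_ge0.
  apply/rowP=> i; rewrite [RHS]mxE; apply/eqP.
  by rewrite -sqrf_eq0; apply: g0; rewrite mem_index_enum.
have expand t : 0 <= t * (g *m g^T) 0 0 *+ 2 + t ^+ 2 * (g *m B *m g^T) 0 0.
  have := psdB (y + t *: g).
  rewrite linearD /= linearZ /= !mulmxDl !mulmxDr -!scalemxAl -!scalemxAr.
  rewrite -/g gBy scalerA !mxE => h; apply: le_trans h _.
  move: y0; rewrite -/g !mxE => ->; rewrite add0r -expr2 addrA mulr2n.
  by [].
have b0 := psdB g; have q0 : 0 <= (g *m g^T) 0 0.
  by rewrite sq_g; apply: sumr_ge0 => i _; apply: sqr_ge0.
move: expand b0 q0.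
set q := (g *m g^T) 0 0; set b := (g *m B *m g^T) 0 0 => expand b0 q0.
(* This t makes the quadratic polynomial negative unless q = 0. *)
have := expand (- q / (b + 1)).
have b1 : 0 < b + 1 by rewrite ltr_wpDl.
have -> : - q / (b + 1) * q *+ 2 + (- q / (b + 1)) ^+ 2 * b
          = - (q ^+ 2 * (b + 2)) / (b + 1) ^+ 2.
  by rewrite -mulr_natr; field; rewrite gt_eqF.
rewrite pmulr_lge0 ?invr_gt0 ?exprn_gt0 // oppr_ge0 pmulr_lle0 ?ltr_wpDl //.
by move=> h; apply/eqP; rewrite -sqrf_eq0 eq_le h sqr_ge0.
Qed.

(** Replacing a vector by its entrywise absolute value does not decrease the
    Rayleigh quotient, so top eigenvectors are stable under this operation, and
    a nonnegative one has no zero entry.  Subtracting a multiple so as to create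
    a zero entry then shows that the eigenspace is a line. *)
Lemma Perron_Frobenius_symmetric n (A : 'M[R]_n.+1) :
    A^T = A -> (forall i j, 0 < A i j) ->
  exists mu (v : 'rV[R]_n.+1), [/\ forall i, 0 < v 0 i, v *m A = mu *: v &
    forall w : 'rV_n.+1, w *m A = mu *: w -> exists t, w = t *: v].
Proof.
move=> symA posA; have [mu [x [x0 xA max]]] := Rayleigh_max_eigenvector symA.
pose abs (y : 'rV[R]_n.+1) := map_mx Num.norm y.
have form_sum (y z : 'rV[R]_n.+1) :
    (y *m A *m z^T) 0 0 = \sum_i \sum_j y 0 j * A j i * z 0 i.
  by rewrite mxE; apply: eq_bigr => i _; rewrite mxE [z^T i 0]mxE mulr_suml.
have eig_abs (y : 'rV_n.+1) : y *m A = mu *: y -> abs y *m A = mu *: abs y.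
  move=> yA; apply/eqP; rewrite -subr_eq0 -opprB oppr_eq0; apply/eqP.
  have -> z : mu *: z - z *m A = z *m (mu%:M - A).
    by rewrite mulmxBr mul_mx_scalar.
  have formB z : (z *m (mu%:M - A) *m z^T) 0 0
                 = mu * (z *m z^T) 0 0 - (z *m A *m z^T) 0 0.
    by rewrite mulmxBr mulmxBl mul_mx_scalar -scalemxAl !mxE.
  have psdB (z : 'rV_n.+1) : 0 <= (z *m (mu%:M - A) *m z^T) 0 0.
    by rewrite formB subr_ge0.
  apply: psd_isotropic_null => //; first by rewrite linearB /= tr_scalar_mx symA.
  apply/le_anti; rewrite psdB andbT formB subr_le0.
  have -> : (abs y *m (abs y)^T) 0 0 = (y *m y^T) 0 0.
    by rewrite !mxE; apply: eq_bigr => i _; rewrite !mxE -!expr2 real_normK ?num_real.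
  have -> : mu * (y *m y^T) 0 0 = (y *m A *m y^T) 0 0.
    by rewrite yA -scalemxAl [RHS]mxE.
  rewrite !form_sum; apply: ler_sum => i _; apply: ler_sum => j _.
  by rewrite !mxE (le_trans (ler_norm _)) // !normrM (gtr0_norm (posA _ _)).
have abs_zero (y : 'rV_n.+1) : y *m A = mu *: y -> (exists i, y 0 i = 0) -> y = 0.
  move=> yA [i yi0]; have /rowP/(_ i) := eig_abs y yA; rewrite !mxE yi0 normr0 mulr0.
  move/eqP; rewrite psumr_eq0 => [/allP y0|j _]; last first.
    by rewrite mxE mulr_ge0 ?normr_ge0 // ltW.
  apply/rowP=> j; rewrite [RHS]mxE; apply/eqP.
  have := y0 j; rewrite mem_index_enum mxE => /(_ isT).
  by rewrite mulf_eq0 normr_eq0 => /orP[//|/eqP Aji]; have := posA j i; rewrite Aji ltxx.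
exists mu, (abs x); have xA' := eig_abs x xA.
have xn0 i : x 0 i != 0.
  by apply: contra x0 => /eqP xi0; apply/eqP; apply: abs_zero => //; exists i.
have pos_v i : 0 < abs x 0 i by rewrite mxE normr_gt0.
split=> //.
move=> w wA; exists (w 0 0 / abs x 0 0); apply/eqP; rewrite -subr_eq0; apply/eqP.
apply: abs_zero; last by exists 0; rewrite !mxE divfK ?subrr // normr_eq0.
by rewrite mulmxBl -scalemxAl wA xA' scalerBr !scalerA mulrC.
Qed.
End PerronFrobenius.

(** * Commutative fusion rings *)

(** [fcoef i j k] is the multiplicity of k in i j.  With the other axioms
    [fcoef_star] (Frobenius reciprocity) makes [fstar] the involution of a based
    ring. *)
Record comFusionRing := ComFusionRing {
  basis :> finType;
  fcoef : basis -> basis -> basis -> nat;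
  fone : basis;
  fstar : basis -> basis;
  fcoefC : forall i j k, fcoef i j k = fcoef j i k;
  fcoefA : forall i j k l, (\sum_m fcoef i j m * fcoef m k l
                            = \sum_m fcoef j k m * fcoef i m l)%N;
  fcoef1 : forall j k, fcoef fone j k = (j == k);
  fcoef_star : forall i j k, fcoef i j k = fcoef (fstar i) k j
}.

Section FusionRing.
Variable I : comFusionRing.
Implicit Types i j k l : I.
Local Notation N := (@fcoef I).
Local Notation one := (fone I).
Local Notation "i ^v" := (fstar i) (at level 2, format "i ^v").

Definition is_character (K : nzRingType) (chi : I -> K) : Prop :=
  chi one = 1 /\ forall i j, chi i * chi j = \sum_k (N i j k)%:R * chi k.

Lemma fcoef_one i j : N i j one = (j == i^v).
Proof. by rewrite fcoef_star fcoefC fcoef1 eq_sym. Qed.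

Lemma fstarK : involutive (@fstar I).
Proof.
by move=> i; apply/esym/eqP; have := fcoefC i i^v one; rewrite !fcoef_one eqxx; case: eqP.
Qed.

Lemma fstar1 : one^v = one.
Proof. by have := fcoef_one one one; rewrite fcoef1 eqxx; case: eqP. Qed.

Lemma fcoef_starr i j k : N i j k = N k j^v i.
Proof. by rewrite fcoefC fcoef_star fcoefC. Qed.

Lemma fcoef_stars i j k : N i^v j^v k^v = N i j k.
Proof. by rewrite -fcoef_star fcoef_starr fstarK fcoefC -fcoef_starr fcoefC. Qed.

Lemma exists_fcoef i j : exists k, N i j k != 0%N.
Proof.
have: (0 < \sum_m N i j m * N m i^v j)%N.
  have -> : (\sum_m N i j m * N m i^v j = \sum_m N j i m * N m i^v j)%N.
    by apply: eq_bigr => m _; rewrite fcoefC.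
  rewrite fcoefA (bigD1 one) //= fcoef_one eqxx mul1n [N j _ _]fcoefC fcoef1 eqxx.
  by [].
rewrite lt0n sum_nat_eq0 => /forallPn[m]; rewrite negb_imply /= muln_eq0 negb_or.
by case/andP=> h _; exists m.
Qed.

Lemma sum_star (K : nmodType) (F : I -> K) : \sum_i F i^v = \sum_i F i.
Proof. by rewrite [RHS](reindex_inj (inv_inj fstarK)). Qed.

(** The multiplications by basis elements commute with their sum, which is a
    symmetric positive matrix; its positive eigenline is therefore stable under
    all of them, and the eigenvalues on it form the character. *)
Lemma exists_positive_character (R : rcfType) :
  exists f : I -> R, (forall i, 0 < f i) /\ is_character f.
Proof.
have [n [e [e' [eK e'K]]]] : exists n (e : I -> 'I_n.+1) e', cancel e e' /\ cancel e' e.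
  case E: #|I| => [|n]; first by have := card0_eq E one.
  exists n, (fun i => cast_ord E (enum_rank i)).
  exists (fun a => enum_val (cast_ord (esym E) a)).
  by split=> i; rewrite ?cast_ordK ?enum_rankK // enum_valK cast_ordKV.
have sumE (F : 'I_n.+1 -> R) : \sum_a F a = \sum_(i : I) F (e i).
  by rewrite (reindex e) //; exists e' => ? _; [exact: eK | exact: e'K].
pose M j k := \sum_i (N i j k)%:R : R.
pose A : 'M[R]_n.+1 := \matrix_(a, b) M (e' a) (e' b).
have symA : A^T = A.
  apply/matrixP=> a b; rewrite !mxE /M -sum_star; apply: eq_bigr => i _.
  by rewrite [in RHS]fcoef_star.
have posA a b : 0 < A a b.
  rewrite mxE /M; have [i Ni] := exists_fcoef (e' a)^v (e' b).
  rewrite (bigD1 i) //= ltr_pwDl ?sumr_ge0 //.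
  by rewrite fcoefC fcoef_star ltr0n lt0n.
have [mu [v [v0 vA uniq_v]]] := Perron_Frobenius_symmetric symA posA.
pose u i := v 0 (e i).
have uM k : \sum_j u j * M j k = mu * u k.
  move/rowP/(_ (e k)): vA; rewrite !mxE sumE => <-.
  by apply: eq_bigr => j _; rewrite mxE !eK.
have eig i : exists t, forall k, \sum_j (N i j k)%:R * u j = t * u k.
  pose w : 'rV[R]_n.+1 := \row_b \sum_j (N i j (e' b))%:R * u j.
  have [t wt] : exists t, w = t *: v.
    apply: uniq_v; apply/rowP=> b; rewrite !mxE sumE; set l := e' b.
    transitivity (\sum_j u j * \sum_m \sum_k (N i j k * N k m l)%:R).
      under eq_bigr => k _ do rewrite !mxE eK mulr_suml.
      rewrite exchange_big; apply: eq_bigr => j _ /=.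
      rewrite [X in _ = _ * X]exchange_big mulr_sumr; apply: eq_bigr => k _ /=.
      rewrite /M mulrAC mulrC mulr_sumr mulr_sumr mulr_sumr.
      by apply: eq_bigr => m _; rewrite natrM [N m k l]fcoefC; ring.
    rewrite mulr_sumr.
    transitivity (\sum_j u j * \sum_k M j k * (N i k l)%:R).
      apply: eq_bigr => j _; congr (_ * _).
      under eq_bigr => m _ do rewrite -natr_sum fcoefA natr_sum.
      rewrite exchange_big /=; apply: eq_bigr => k _; rewrite /M mulr_suml.
      by apply: eq_bigr => m _; rewrite natrM fcoefC.
    under eq_bigr => j _ do rewrite mulr_sumr.
    rewrite exchange_big /=; apply: eq_bigr => k _.
    under eq_bigr => j _ do rewrite mulrA.
    by rewrite -mulr_suml uM; ring.
  exists t => k; move/rowP/(_ (e k)): wt; rewrite !mxE /u => <-.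
  by apply: eq_bigr => j _; rewrite eK.
pose f i := u i^v / u one.
have u1 : 0 < u one by exact: v0.
have fE i k : \sum_j (N i j k)%:R * u j = f i * u k.
  have [t tE] := eig i; rewrite tE; congr (_ * _).
  have := tE one; rewrite (bigD1 i^v) //= fcoef_one eqxx mul1r big1 => [|j jn].
    by rewrite addr0 /f => ->; rewrite mulfK // gt_eqF.
  by rewrite fcoef_one (negPf jn) mul0r.
exists f; split=> [i|]; first by rewrite divr_gt0 // v0.
split=> [|i j].
  by rewrite /f fstar1 divff // gt_eqF.
rewrite mulrA -fE mulr_suml -sum_star; apply: eq_bigr => k _.
by rewrite [N i _ _]fcoef_star fcoef_stars /f mulrA.
Qed.

(** * Characters of fusion rings *)

Section ComplexCharacters.
Variable R : realType.
Implicit Types chi psi : I -> R[i].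

(** The vector of values of chi is an eigenvector of multiplication by i, and
    multiplication by the dual of i is the adjoint matrix. *)
Lemma character_conj_star chi i : is_character chi -> chi i^v = (chi i)^*.
Proof.
case=> chi1 chiM; pose S := \sum_j `|chi j| ^+ 2.
have S0 : S != 0.
  rewrite gt_eqF // /S (bigD1 one) //= chi1 normr1 expr1n ltr_pwDl //.
  by apply: sumr_ge0 => j _; rewrite exprn_ge0.
have SE : S = \sum_j (chi j)^* * chi j.
  by apply: eq_bigr => j _; rewrite normCK mulrC.
apply: (can_inj conjCK); rewrite conjCK; apply: (mulIf S0).
have -> : chi i * S = \sum_j \sum_k (N i j k)%:R * ((chi j)^* * chi k).
  rewrite SE mulr_sumr; apply: eq_bigr => j _.
  rewrite mulrCA chiM mulr_sumr; apply: eq_bigr => k _.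
  by rewrite mulrCA.
rewrite exchange_big SE mulr_sumr /=; apply: eq_bigr => k _.
rewrite mulrA -rmorphM chiM rmorph_sum mulr_suml; apply: eq_bigr => j _.
by rewrite rmorphM rmorph_nat -fcoef_star mulrA.
Qed.

(** Multiplying the sum by chi i or by psi i has the same effect, by
    reindexing. *)
Lemma characters_orthogonal (K : idomainType) (chi psi : I -> K) :
    is_character chi -> is_character psi -> (exists i, chi i != psi i) ->
  \sum_i chi i * psi i^v = 0.
Proof.
case=> _ chiM [_ psiM] [i ne]; apply/eqP; set S := \sum_i _.
have : (chi i - psi i) * S == 0; last by rewrite mulf_eq0 subr_eq0 (negPf ne).
rewrite mulrBl subr_eq0; apply/eqP.
transitivity (\sum_j \sum_k (N i j k)%:R * (chi k * psi j^v)).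
  rewrite /S mulr_sumr; apply: eq_bigr => j _.
  by rewrite mulrA chiM mulr_suml; apply: eq_bigr => k _; rewrite mulrA.
rewrite exchange_big /S mulr_sumr; apply: eq_bigr => k _ /=.
rewrite mulrCA psiM mulr_sumr -sum_star; apply: eq_bigr => j _.
rewrite fstarK [RHS]mulrCA; congr (_%:R * _).
by rewrite ![N i _^v _]fcoefC ![N _^v i _]fcoef_star !fstarK fcoefC.
Qed.

Lemma character_eigen_star (K : comNzRingType) (f : I -> K) i k :
  is_character f -> \sum_j (N i j k)%:R * f j = f i^v * f k.
Proof. by case=> _ ->; apply: eq_bigr => j _; rewrite fcoef_star. Qed.

Section Positive.
Variable f : I -> R.
Hypotheses (f_gt0 : forall i, 0 < f i) (f_char : is_character f).

(** Pair the triangle inequality |chi i| |chi j| <= sum_k N i j k |chi k| with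
    the positive eigenvector f. *)
Lemma positive_character_bound_star chi i :
  is_character chi -> `|chi i| <= (f i^v)%:C%C.
Proof.
case=> chi1 chiM; pose S := \sum_j (f j)%:C%C * `|chi j|.
have fC j : 0 < (f j)%:C%C by rewrite ltcR.
have S0 : 0 < S.
  rewrite /S (bigD1 one) //= chi1 normr1 ltr_pwDl ?mulr1 //.
  by apply: sumr_ge0 => j _; rewrite mulr_ge0 // ltW.
rewrite -(ler_pM2r S0) mulr_sumr.
have -> : (f i^v)%:C%C * S
          = \sum_j (f j)%:C%C * \sum_k (N i j k)%:R * `|chi k|.
  under [RHS]eq_bigr => j _ do rewrite mulr_sumr.
  rewrite exchange_big mulr_sumr; apply: eq_bigr => k _ /=.
  rewrite mulrA -rmorphM -character_eigen_star // rmorph_sum mulr_suml.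
  by apply: eq_bigr => j _; rewrite rmorphM rmorph_nat; ring.
apply: ler_sum => j _; rewrite mulrCA ler_pM2l // -normrM chiM.
by apply: le_trans (ler_norm_sum _ _ _) _; apply: ler_sum => k _; rewrite normrM normr_nat.
Qed.

Lemma positive_character_star i : f i^v = f i.
Proof.
have fC_char : is_character (fun i => (f i)%:C%C).
  case: f_char => f1 fM; split=> [|j k]; first by rewrite f1.
  rewrite -rmorphM fM rmorph_sum; apply: eq_bigr => l _.
  by rewrite rmorphM rmorph_nat.
have le_star j : f j <= f j^v.
  rewrite -lecR -[X in X <= _]ger0_norm; last by rewrite lecR ltW.
  exact: (@positive_character_bound_star (fun i => (f i)%:C%C) j fC_char).
by apply/le_anti; rewrite le_star -{2}(fstarK i) le_star.
Qed.

Lemma positive_character_bound chi i : is_character chi -> `|chi i| <= (f i)%:C%C.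
Proof. by rewrite -[f i]positive_character_star; apply: positive_character_bound_star. Qed.

Lemma positive_character_ge1 i : 1 <= f i.
Proof.
have f0 j : 0 <= f j by exact: ltW.
rewrite -[X in _ <= X]ger0_norm // -[1]normr1 -ler_sqr ?nnegrE ?normr_ge0 //.
rewrite normr1 expr1n ger0_norm //; case: (f_char) => f1 fM.
rewrite expr2 -{2}positive_character_star fM (bigD1 one) //= fcoef_one eqxx f1 mulr1.
by rewrite lerDl sumr_ge0 // => j _; rewrite mulr_ge0.
Qed.

End Positive.

(** chi i is an eigenvalue of the integer matrix of multiplication by i. *)
Lemma character_integral chi i : is_character chi -> algebraic_integer (chi i).
Proof.
case=> chi1 chiM.
pose e (a : 'I_#|I|) : I := enum_val a.
pose A : 'M[int]_#|I| := \matrix_(a, b) (N i (e b) (e a))%:R.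
exists (char_poly A); first exact: char_poly_monic.
rewrite map_char_poly -eigenvalue_root_char.
apply/eigenvalueP; exists (\row_a chi (e a)).
  apply/rowP=> b; rewrite !mxE chiM.
  rewrite (reindex e) /=; last first.
    by exists enum_rank => ? _; rewrite /e ?enum_rankK ?enum_valK.
  by apply: eq_bigr => a _; rewrite !mxE rmorph_nat mulrC.
apply/eqP=> /rowP/(_ (enum_rank one))/eqP.
by rewrite !mxE /e enum_rankK chi1 oner_eq0.
Qed.

End ComplexCharacters.

(** * Invertible basis elements and their orbits *)

(** Multiplication by i permutes the basis. *)
Definition shifts i := forall j, exists k, forall l, N i j l = (l == k).

(** If k occurs in i j then j occurs in the product of k with the dual of i, so
    f j <= f k; then f j = sum_k N i j k f k leaves room for a single k. *)
Lemma positive_character_shifts (R : realType) (f : I -> R) i :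
    (forall j, 0 < f j) -> is_character f -> f i = 1 -> shifts i.
Proof.
move=> f0 f_char fi j; have [k Nk] := exists_fcoef i j; exists k.
have Nstar l : N i^v k l = N i l k by rewrite fcoef_star fstarK.
have fk : f k = \sum_l (N i l k)%:R * f l.
  by rewrite character_eigen_star // positive_character_star // fi mul1r.
have fj : f j = \sum_l (N i j l)%:R * f l.
  by case: f_char => _ <-; rewrite fi mul1r.
have N1 : 1 <= (N i j k)%:R :> R by rewrite ler1n lt0n.
have le_jk : f j <= f k.
  rewrite fk (bigD1 j) //= -[X in X <= _]addr0 lerD ?sumr_ge0 //.
    by rewrite ler_peMl // ltW.
  by move=> l _; rewrite mulr_ge0 ?ler0n // ltW.
have rest : ((N i j k)%:R - 1) * f j + \sum_(l | l != k) (N i j l)%:R * f l <= 0.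
  have : f j = (N i j k)%:R * f k + \sum_(l | l != k) (N i j l)%:R * f l.
    by rewrite {1}fj (bigD1 k).
  have : (N i j k)%:R * f j <= (N i j k)%:R * f k by rewrite ler_wpM2l ?ler0n.
  by rewrite mulrBl mul1r; lra.
have sum0 : 0 <= \sum_(l | l != k) (N i j l)%:R * f l.
  by apply: sumr_ge0 => l _; rewrite mulr_ge0 ?ler0n // ltW.
have prod0 : 0 <= ((N i j k)%:R - 1) * f j by rewrite mulr_ge0 ?subr_ge0 // ltW.
have /eqP : ((N i j k)%:R - 1) * f j = 0 by apply/le_anti; rewrite prod0 andbT; lra.
have /eqP : \sum_(l | l != k) (N i j l)%:R * f l = 0.
  by apply/le_anti; rewrite sum0 andbT; lra.
rewrite psumr_eq0 => [/allP others|l _]; last by rewrite mulr_ge0 ?ler0n // ltW.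
rewrite mulf_eq0 [f j == 0]gt_eqF // orbF subr_eq0 pnatr_eq1 => /eqP Nk1 l.
have [->|nl] := eqVneq l k; first by rewrite Nk1.
have := others l; rewrite mem_index_enum nl mulf_eq0 [f l == 0]gt_eqF // orbF pnatr_eq0.
by move=> /(_ isT)/eqP.
Qed.

(** The orbits of a group acting freely all have the cardinal of the group;
    [e] enumerates representatives. *)
Lemma orbit_sum (K : nzRingType) (A S : {set I}) (F : I -> K) :
    one \in A -> (forall a, a \in A -> a^v \in A) ->
    (forall a b c, a \in A -> b \in A -> N a b c != 0%N -> c \in A) ->
    (forall a, a \in A -> shifts a) ->
    (forall a x y, a \in A -> x \in S -> N a x y != 0%N -> y \in S) ->
    (forall a x, a \in A -> x \in S -> N a x x != 0%N -> a = one) ->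
    (forall a x y, a \in A -> x \in S -> N a x y != 0%N -> F y = F x) ->
  exists (J : finType) (e : J -> I),
    \sum_(x in S) F x = #|A|%:R * \sum_j F (e j).
Proof.
move=> A1 AV AM shA SA free FA.
pose act a x := odflt one [pick k | N a x k != 0%N].
have actE a x y : a \in A -> N a x y = (y == act a x).
  move=> /shA/(_ x)[k kP]; rewrite /act; case: pickP => [l /=|/(_ k)].
    by rewrite kP; have [->|] := eqVneq l k.
  by rewrite kP eqxx.
have act_neq0 a x y : a \in A -> (N a x y != 0%N) = (y == act a x).
  by move=> aA; rewrite actE //; case: (y == _).
have actS a x : a \in A -> x \in S -> act a x \in S.
  by move=> aA xS; apply: (SA a x) => //; rewrite act_neq0.
have actV a x : a \in A -> act a^v (act a x) = x.
  by move=> aA; apply/esym/eqP; rewrite -act_neq0 ?AV // fcoef_star fstarK act_neq0.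
have act1 x : act one x = x by apply/esym/eqP; rewrite -act_neq0 // fcoef1 eqxx.
have actAA a b : a \in A -> b \in A -> act a b \in A.
  by move=> aA bA; apply: (AM a b) => //; rewrite act_neq0.
have actA a b x : a \in A -> b \in A -> act a (act b x) = act (act a b) x.
  move=> aA bA; have cA := actAA a b aA bA.
  have := fcoefA a b x (act a (act b x)).
  rewrite (bigD1 (act a b)) //= actE // eqxx mul1n big1 ?addn0; last first.
    by move=> m ne; rewrite actE // (negPf ne) mul0n.
  rewrite (bigD1 (act b x)) //= [N b x _]actE // eqxx mul1n big1 ?addn0; last first.
    by move=> m ne; rewrite actE // (negPf ne) mul0n.
  by rewrite [N a _ _]actE // eqxx actE //; case: eqP.
pose rel x y := [exists a in A, act a x == y].
have relP x y : reflect (exists2 a, a \in A & act a x = y) (rel x y).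
  by apply: (iffP exists_inP) => [[a aA /eqP]|[a aA /eqP]]; exists a.
have equiv : {in S & &, equivalence_rel rel}.
  move=> x y z xS yS zS; split; first by apply/relP; exists one.
  move=> /relP[a aA <-]; apply/relP/relP => [[b bA <-]|[b bA <-]].
    exists (act b a^v); first by rewrite actAA ?AV.
    by rewrite -actA ?AV // actV.
  by exists (act b a); rewrite ?actAA ?actA.
have part := equivalence_partitionP equiv.
set P := equivalence_partition rel S in part.
pose rep (B : {set I}) := odflt one [pick x in B].
exists 'I_#|P|, (fun t => rep (enum_val t)).
rewrite (set_partition_big _ part) /= mulr_sumr.
rewrite [RHS](_ : _ = \sum_(B in P) #|A|%:R * F (rep B)); last first.
  by rewrite [RHS]big_enum_val.
apply: eq_bigr => B BP.
have [/eqP coverP trivP nP0] := and3P part.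
have xB : rep B \in B.
  rewrite /rep; case: pickP => // B0; case/negP: nP0.
  suff <- : B = finset.set0 by [].
  by apply/setP=> y; rewrite B0 inE.
have subBS y : y \in B -> y \in S.
  by move=> yB; rewrite -coverP; apply/finset.bigcupP; exists B.
move: (rep B) xB => x xB; have xS := subBS x xB.
have -> : B = [set act a x | a in A].
  apply/setP=> y; apply/idP/imsetP => [yB|[a aA ->]].
    have : y \in finset.pblock P x by rewrite (def_pblock trivP BP xB).
    rewrite (pblock_equivalence_partition equiv) ?subBS // => /relP[a aA <-].
    by exists a.
  rewrite -(def_pblock trivP BP xB) (pblock_equivalence_partition equiv) ?actS //.
  by apply/relP; exists a.
rewrite big_imset /= => [|a b aA bA eq_ab]; last first.
  have bVA := AV b bA; have : N b^v a one != 0%N.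
    rewrite act_neq0 //; apply/eqP/esym/(free _ x) => //; first exact: actAA.
    by rewrite act_neq0 ?actAA // -actA // eq_ab actV.
  by rewrite fcoef_one fstarK; have [->|] := eqVneq a b.
rewrite -sumr_const mulr_suml; apply: eq_bigr => a aA.
by rewrite mul1r; apply: (FA a) => //; rewrite act_neq0.
Qed.

(** * Codegrees of a symmetric family of characters *)

Section CharacterTable.
Variables (R : realType) (f : I -> R) (d : I -> R[i]) (chi : I -> I -> R[i]).
Hypotheses (f_gt0 : forall i, 0 < f i) (f_char : is_character f).
Hypothesis d_char : is_character d.
Hypothesis chi_char : forall i, is_character (chi i).
Hypothesis chi_sym : forall i j, d j * chi j i = d i * chi i j.
Hypothesis global_dim_f : (\sum_i f i ^+ 2)%:C%C = \sum_i d i ^+ 2.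

(** Pseudo-unitarity turns the inequalities Re (d^2) <= |d|^2 <= f^2 into
    equalities after summation, hence termwise. *)
Lemma dim_sqr i : d i ^+ 2 = (f i ^+ 2)%:C%C.
Proof.
have le_nf j : `|d j ^+ 2| <= (f j ^+ 2)%:C%C.
  rewrite normrX rmorphXn lerXn2r ?nnegrE ?normr_ge0 //.
    by rewrite lecR ltW.
  exact: positive_character_bound.
have le_re j := leif_Re_Creal (d j ^+ 2).
have eq0 : \sum_j ((f j ^+ 2)%:C%C - 'Re (d j ^+ 2)) = 0.
  have re_sum : 'Re (\sum_j d j ^+ 2) = \sum_j (f j ^+ 2)%:C%C.
    rewrite -global_dim_f (Creal_ReP _ _) ?complex_real //.
    by rewrite rmorph_sum.
  by rewrite sumrB -re_sum raddf_sum subrr.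
have /eqP := eq0; rewrite psumr_eq0 => [/allP all0|j _]; last first.
  by rewrite subr_ge0 (le_trans (leif_le (le_re j))).
have := all0 i; rewrite mem_index_enum subr_eq0 => /(_ isT)/eqP fE.
have nE : `|d i ^+ 2| = 'Re (d i ^+ 2).
  by apply/le_anti; rewrite (leif_le (le_re i)) -fE le_nf.
have : 0 <= d i ^+ 2 by rewrite -(eq_leif (le_re i)) nE.
by rewrite fE -nE => /ger0_norm.
Qed.

Lemma dim_neq0 i : d i != 0.
Proof.
by rewrite -sqrf_eq0 dim_sqr -(rmorph0 (real_complex R)) (inj_eq (@complexI R)) sqrf_eq0 gt_eqF.
Qed.

Lemma dim_real i : (d i)^* = d i.
Proof.
have : d i * (d i)^* = d i * d i.
  rewrite -normCK -[RHS]/(d i ^+ 2) -normrX dim_sqr ger0_norm //.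
  by rewrite lecR sqr_ge0.
by move/(mulfI (dim_neq0 i)).
Qed.

Lemma dim_star i : d i^v = d i.
Proof. by rewrite (character_conj_star _ d_char) dim_real. Qed.

Lemma global_dim_neq0 : \sum_i d i ^+ 2 != 0.
Proof.
rewrite -global_dim_f -(rmorph0 (real_complex R)) (inj_eq (@complexI R)).
rewrite psumr_eq0 => [|i _]; last by rewrite sqr_ge0.
apply/allPn; exists one; rewrite ?mem_index_enum // sqrf_eq0 gt_eqF //.
Qed.

(** By symmetry the left hand side is the sum of the d x ^+ 2 chi x (y y^v);
    decompose the product y y^v and use symmetry once more, then orthogonality
    of chi z and d. *)
Lemma codegree_sum y :
  d y ^+ 2 * (\sum_x chi y x * chi y x^v)
  = (\sum_x d x ^+ 2) *
    (\sum_(z | [forall i, chi z i == d i]) (N y y^v z)%:R * d z).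
Proof.
transitivity (\sum_x d x ^+ 2 * (chi x y * chi x y^v)).
  rewrite mulr_sumr; apply: eq_bigr => x _.
  rewrite !(character_conj_star _ (chi_char _)).
  transitivity (d y * chi y x * (d y * chi y x)^*).
    by rewrite rmorphM /= dim_real; ring.
  by rewrite chi_sym rmorphM /= dim_real; ring.
transitivity (\sum_z (N y y^v z)%:R * d z * \sum_x d x * chi z x).
  under eq_bigr => x _ do rewrite (chi_char x).2 mulr_sumr.
  rewrite exchange_big /=; apply: eq_bigr => z _; rewrite mulr_sumr.
  apply: eq_bigr => x _.
  transitivity ((N y y^v z)%:R * d x * (d x * chi x z)); first by ring.
  by rewrite -chi_sym; ring.
rewrite mulr_sumr (bigID (fun z => [forall i, chi z i == d i])) /= addrC big1 ?add0r.
  apply: eq_bigr => z /forallP chiz; rewrite mulrC; congr (_ * _).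
  by apply: eq_bigr => x _; rewrite (eqP (chiz x)).
move=> z /forallPn[i ne]; apply/eqP; rewrite mulf_eq0; apply/orP; right; apply/eqP.
rewrite -[RHS](characters_orthogonal (chi_char z) d_char); last by exists i.
by apply: eq_bigr => x _; rewrite dim_star mulrC.
Qed.

Lemma algebraic_integer_sum (J : Type) (r : seq J) (P : pred J) (F : J -> R[i]) :
  (forall t, algebraic_integer (F t)) -> algebraic_integer (\sum_(t <- r | P t) F t).
Proof.
by move=> intF; apply: big_ind => //; [exact: integral0 | exact: integral_add].
Qed.

Variable G : {set I}.
Hypotheses (G1 : one \in G) (GV : forall a, a \in G -> a^v \in G).
Hypothesis GM : forall a b c, a \in G -> b \in G -> N a b c != 0%N -> c \in G.
Hypothesis f_G : forall a, a \in G -> f a = 1.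
Hypothesis transparent_G : forall z, (forall i, chi z i = d i) -> z \in G.

Let shG a : a \in G -> shifts a.
Proof. by move=> aG; apply: (positive_character_shifts f_gt0 f_char); exact: f_G. Qed.

(** An invertible z fixing y satisfies d z * d y = d y. *)
Lemma stabilizer_sum y :
  let H := [set z | [forall i, chi z i == d i] && (N z y y != 0%N)] in
  \sum_(z | [forall i, chi z i == d i]) (N y y^v z)%:R * d z = #|H|%:R.
Proof.
move=> H; rewrite -sum1_card natr_sum (bigID (fun z => N z y y != 0%N)) /=.
rewrite [X in _ + X]big1 ?addr0 => [|z /andP[_]].
  apply: eq_big => [z|z /andP[/forallP chiz Nz]]; first by rewrite inE.
  have zG : z \in G by apply: transparent_G => i; exact/eqP.
  have [k kP] := shG zG y.
  have ky : k = y by move: Nz; rewrite kP; case: (y =P k).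
  have -> : N y y^v z = 1%N by rewrite [N y _ z]fcoef_starr fstarK kP ky eqxx.
  rewrite mul1r; apply: (mulIf (dim_neq0 y)).
  rewrite d_char.2 (bigD1 y) //= kP ky eqxx !mul1r big1 ?addr0 //.
  by move=> l ne; rewrite kP ky (negPf ne) mul0r.
by rewrite negbK [N y _ z]fcoef_starr fstarK => /eqP ->; rewrite mul0r.
Qed.

(** By symmetry, chi z = d means that every chi x takes the value d z at z, a
    condition stable under products.  So H is a subgroup, and it acts freely on
    G by translation. *)
Lemma card_stabilizer_dvd y :
  let H := [set z | [forall i, chi z i == d i] && (N z y y != 0%N)] in
  exists n, #|G| = (#|H| * n)%N.
Proof.
move=> H.
have HP z : reflect ((forall i, chi z i = d i) /\ N z y y != 0%N) (z \in H).
  by rewrite inE; apply: (iffP andP) => [[/forallP h Nz]|[h Nz]]; split=> //;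
    [move=> i; exact/eqP | apply/forallP=> i; exact/eqP].
have HG z : z \in H -> z \in G by case/HP=> /transparent_G.
have unit_shift z x k : shifts z -> N z x k != 0%N -> forall l, N z x l = (l == k).
  by move=> /(_ x)[k' k'P]; rewrite k'P; case: (k =P k') => // ->.
have transp z : (forall i, chi z i = d i) <-> (forall x, chi x z = d z).
  split=> h x.
    by apply: (mulfI (dim_neq0 x)); rewrite chi_sym h mulrC.
  by apply: (mulfI (dim_neq0 z)); rewrite chi_sym h mulrC.
have H1 : one \in H.
  apply/HP; split; last by rewrite fcoef1 eqxx.
  by apply/transp => x; rewrite (chi_char x).1 d_char.1.
have HV a : a \in H -> a^v \in H.
  case/HP=> /transp ha Na; apply/HP; split; last by rewrite -fcoef_star.
  by apply/transp => x; rewrite (character_conj_star _ (chi_char x)) ha dim_real dim_star.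
have HM a b c : a \in H -> b \in H -> N a b c != 0%N -> c \in H.
  move=> aH bH Nabc; have [ha Na] := HP a aH; have [hb Nb] := HP b bH.
  have Nab := unit_shift a b c (shG (HG a aH)) Nabc.
  have Nby := unit_shift b y y (shG (HG b bH)) Nb.
  have sumE (K : nzRingType) (F : I -> K) z : \sum_k (k == z)%:R * F k = F z.
    rewrite (bigD1 z) //= eqxx mul1r big1 ?addr0 // => k ne.
    by rewrite (negPf ne) mul0r.
  apply/HP; split.
    move/transp in ha; move/transp in hb; apply/transp => x.
    have -> : d c = d a * d b.
      by rewrite d_char.2 -(sumE _ d c); apply: eq_bigr => k _; rewrite Nab.
    rewrite -(ha x) -(hb x) (chi_char x).2 -(sumE _ (chi x) c).
    by apply: eq_bigr => k _; rewrite Nab.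
  have := fcoefA a b y y; rewrite (bigD1 c) //= Nab eqxx mul1n big1 ?addn0; last first.
    by move=> k ne; rewrite Nab (negPf ne) mul0n.
  rewrite (bigD1 y) //= Nby eqxx mul1n big1 ?addn0 => [->//|k ne].
  by rewrite Nby (negPf ne) mul0n.
have free a x : a \in H -> x \in G -> N a x x != 0%N -> a = one.
  move=> _ xG; have [k kP] := shG xG x^v.
  rewrite fcoef_starr kP; have := kP one; rewrite fcoef_one eqxx.
  by case: (one =P k) => // <- _; case: (a =P one).
have [] := @orbit_sum int H G (fun=> 1) H1 HV HM _ _ free _ => //.
- by move=> a /HG/shG.
- by move=> a x z /HG; apply: GM.
move=> J [e]; rewrite !sumr_const => eqG; exists #|J|.
by apply/eqP; rewrite -(eqr_nat int) natrM eqG.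
Qed.

Theorem codegree_integrality y :
  algebraic_integer ((\sum_i f i ^+ 2) * #|G|%:R / f y ^+ 2)%:C%C.
Proof.
have [n cardG] := card_stabilizer_dvd y.
have -> : ((\sum_i f i ^+ 2) * #|G|%:R / f y ^+ 2)%:C%C
          = (\sum_x chi y x * chi y x^v) * n%:R.
  have dy0 : d y ^+ 2 != 0 by rewrite expf_neq0 ?dim_neq0.
  apply: (mulfI dy0); rewrite [RHS]mulrA codegree_sum stabilizer_sum.
  rewrite -global_dim_f -[RHS]mulrA -natrM -cardG dim_sqr.
  rewrite -(rmorph_nat (real_complex R)) -!rmorphM; congr (_%:C%C).
  by rewrite mulrC divfK // expf_neq0 // gt_eqF.
apply: integral_mul; last exact: integral_nat.
by apply: algebraic_integer_sum => x; apply: integral_mul; apply: character_integral.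
Qed.

(** For g in G the product chi y g * chi y g^v is 1, so the summands
    chi y x * chi y x^v are constant on the free orbits of G. *)
Theorem free_codegree_integrality y :
    (forall g x, g \in G -> N g x x != 0%N -> g = one) ->
  algebraic_integer ((\sum_i f i ^+ 2) / (#|G|%:R * f y ^+ 2))%:C%C.
Proof.
move=> free.
have norm_G a : a \in G -> chi y a * chi y a^v = 1.
  move=> aG; rewrite (chi_char y).2 -[RHS](chi_char y).1.
  have [k kP] := shG aG a^v.
  have k1 : k = one by have := kP one; rewrite fcoef_one eqxx; case: (one =P k).
  rewrite (bigD1 one) //= kP k1 eqxx mul1r big1 ?addr0 // => l ne.
  by rewrite kP k1 (negPf ne) mul0r.
have inv a x z : a \in G -> x \in [set: I] -> N a x z != 0%N ->
    chi y z * chi y z^v = chi y x * chi y x^v.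
  move=> aG _ Naxz; have [k kP] := shG aG x.
  have kz : k = z by move: Naxz; rewrite kP; case: (z =P k).
  have zE : chi y z = chi y a * chi y x.
    rewrite (chi_char y).2 (bigD1 z) //= kP kz eqxx mul1r big1 ?addr0 // => l ne.
    by rewrite kP kz (negPf ne) mul0r.
  have := norm_G a aG; rewrite !(character_conj_star _ (chi_char y)) zE rmorphM /=.
  by move=> na; rewrite mulrACA na mul1r.
have [J [e sumE]] := orbit_sum G1 GV GM shG (S := finset.setT) (F := fun x => chi y x * chi y x^v)
   (fun a x z _ _ _ => finset.in_setT z) (fun a x aG _ => free a x aG) inv.
have stab1 : \sum_(z | [forall i, chi z i == d i]) (N y y^v z)%:R * d z = 1.
  rewrite stabilizer_sum; set H := finset _.
  suff -> : H = [set one] by rewrite cards1.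
  apply/setP=> z; rewrite !inE; apply/andP/eqP => [[/forallP h]|->].
    by apply: free; apply: transparent_G => i; exact/eqP.
  split; last by rewrite fcoef1 eqxx.
  apply/forallP=> i; apply/eqP/(mulfI (dim_neq0 one)).
  by rewrite chi_sym (chi_char i).1 d_char.1 mulrC.
have -> : ((\sum_i f i ^+ 2) / (#|G|%:R * f y ^+ 2))%:C%C
          = \sum_t chi y (e t) * chi y (e t)^v.
  have dy0 : d y ^+ 2 != 0 by rewrite expf_neq0 ?dim_neq0.
  have G0 : #|G|%:R != 0 :> R[i].
    by rewrite pnatr_eq0 -lt0n; apply/card_gt0P; exists one.
  have {}sumE : \sum_x chi y x * chi y x^v
                = #|G|%:R * \sum_t chi y (e t) * chi y (e t)^v.
    by rewrite -sumE; apply: eq_bigl => x; rewrite inE.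
  apply: (mulfI dy0); apply: (mulfI G0); rewrite [RHS]mulrCA -sumE codegree_sum stab1 mulr1 -global_dim_f dim_sqr.
  rewrite -(rmorph_nat (real_complex R)) -!rmorphM; congr (_%:C%C).
  rewrite mulrA mulrCA divff ?mulr1 // mulf_neq0 ?expf_neq0 ?gt_eqF //.
  by rewrite ltr0n; apply/card_gt0P; exists one.
by apply: algebraic_integer_sum => t; apply: integral_mul; apply: character_integral.
Qed.
End CharacterTable.

End FusionRing.

(** * Linear and monoidal categories *)

Section LinCategoryTheory.
Variables (K : fieldType) (C : linCategory K).
Implicit Types W X Y Z : C.

Lemma compDr X Y Z (g : hom Y Z) (f f' : hom X Y) : g ∘ (f + f') = g ∘ f + g ∘ f'.
Proof. by have := comp_linearr g 1 f f'; rewrite !scale1r. Qed.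
Lemma compDl X Y Z (g g' : hom Y Z) (f : hom X Y) : (g + g') ∘ f = g ∘ f + g' ∘ f.
Proof. by have := comp_linearl f 1 g g'; rewrite !scale1r. Qed.
Lemma comp0r X Y Z (g : hom Y Z) : g ∘ (0 : hom X Y) = 0.
Proof. by apply: (addrI (g ∘ (0 : hom X Y))); rewrite -compDr !addr0. Qed.
Lemma comp0l X Y Z (f : hom X Y) : (0 : hom Y Z) ∘ f = 0.
Proof. by apply: (addrI ((0 : hom Y Z) ∘ f)); rewrite -compDl !addr0. Qed.
Lemma compZr X Y Z a (g : hom Y Z) (f : hom X Y) : g ∘ (a *: f) = a *: (g ∘ f).
Proof. by have := comp_linearr g a f 0; rewrite /= comp0r !addr0. Qed.
Lemma compZl X Y Z a (g : hom Y Z) (f : hom X Y) : (a *: g) ∘ f = a *: (g ∘ f).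
Proof. by have := comp_linearl f a g 0; rewrite /= comp0l !addr0. Qed.
Lemma compNr X Y Z (g : hom Y Z) (f : hom X Y) : g ∘ (- f) = - (g ∘ f).
Proof. by rewrite -!scaleN1r compZr. Qed.
Lemma compNl X Y Z (g : hom Y Z) (f : hom X Y) : (- g) ∘ f = - (g ∘ f).
Proof. by rewrite -!scaleN1r compZl. Qed.
Lemma comp_sumr X Y Z (g : hom Y Z) I (r : seq I) (P : pred I) (F : I -> hom X Y) :
  g ∘ (\sum_(i <- r | P i) F i) = \sum_(i <- r | P i) g ∘ F i.
Proof. by apply: (big_morph (comp g)) => [f f'|]; rewrite ?compDr ?comp0r. Qed.
Lemma comp_suml X Y Z (f : hom X Y) I (r : seq I) (P : pred I) (F : I -> hom Y Z) :
  (\sum_(i <- r | P i) F i) ∘ f = \sum_(i <- r | P i) F i ∘ f.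
Proof.
by apply: (big_morph (fun g : hom Y Z => g ∘ f)) => [g g'|]; rewrite ?compDl ?comp0l.
Qed.

Lemma iso_epi X Y Z (f : hom X Y) (g h : hom Y Z) : is_iso f -> g ∘ f = h ∘ f -> g = h.
Proof.
by case=> f' [_ ff'] eq_gh; rewrite -(comp_idr g) -(comp_idr h) -ff' !compA eq_gh.
Qed.
Lemma iso_mono X Y Z (f : hom Y Z) (g h : hom X Y) : is_iso f -> f ∘ g = f ∘ h -> g = h.
Proof.
by case=> f' [f'f _] eq_gh; rewrite -(comp_idl g) -(comp_idl h) -f'f -!compA eq_gh.
Qed.
End LinCategoryTheory.

Notation "X ◁ f" := (idm X ⊠ f) (at level 30, right associativity) : fcat_scope.
Notation "f ▷ X" := (f ⊠ idm X) (at level 30, right associativity) : fcat_scope.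

Section MonoidalTheory.
Variables (K : fieldType) (C : monoidalCategory K).
Implicit Types U V W X Y Z : C.

Lemma tensmDr X X' Y Y' (f : hom X X') (g g' : hom Y Y') : f ⊠ (g + g') = f ⊠ g + f ⊠ g'.
Proof. by have := tensm_linearr f 1 g g'; rewrite !scale1r. Qed.
Lemma tensmDl X X' Y Y' (f f' : hom X X') (g : hom Y Y') : (f + f') ⊠ g = f ⊠ g + f' ⊠ g.
Proof. by have := tensm_linearl g 1 f f'; rewrite !scale1r. Qed.
Lemma tensm0r X X' Y Y' (f : hom X X') : f ⊠ (0 : hom Y Y') = 0.
Proof. by apply: (addrI (f ⊠ (0 : hom Y Y'))); rewrite -tensmDr !addr0. Qed.
Lemma tensm0l X X' Y Y' (g : hom Y Y') : (0 : hom X X') ⊠ g = 0.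
Proof. by apply: (addrI ((0 : hom X X') ⊠ g)); rewrite -tensmDl !addr0. Qed.
Lemma tensmZr X X' Y Y' a (f : hom X X') (g : hom Y Y') : f ⊠ (a *: g) = a *: (f ⊠ g).
Proof. by have := tensm_linearr f a g 0; rewrite /= tensm0r !addr0. Qed.
Lemma tensmZl X X' Y Y' a (f : hom X X') (g : hom Y Y') : (a *: f) ⊠ g = a *: (f ⊠ g).
Proof. by have := tensm_linearl g a f 0; rewrite /= tensm0l !addr0. Qed.
Lemma tensm_sumr X X' Y Y' (f : hom X X') I (r : seq I) (P : pred I) (F : I -> hom Y Y') :
  f ⊠ (\sum_(i <- r | P i) F i) = \sum_(i <- r | P i) f ⊠ F i.
Proof. by apply: (big_morph (tensm f)) => [g g'|]; rewrite ?tensmDr ?tensm0r. Qed.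
Lemma tensm_suml X X' Y Y' (g : hom Y Y') I (r : seq I) (P : pred I) (F : I -> hom X X') :
  (\sum_(i <- r | P i) F i) ⊠ g = \sum_(i <- r | P i) F i ⊠ g.
Proof.
by apply: (big_morph (fun f : hom X X' => f ⊠ g)) => [f f'|]; rewrite ?tensmDl ?tensm0l.
Qed.

Lemma lw_comp W X Y Z (g : hom Y Z) (f : hom X Y) : W ◁ (g ∘ f) = (W ◁ g) ∘ (W ◁ f).
Proof. by rewrite -tensm_comp comp_idl. Qed.
Lemma rw_comp W X Y Z (g : hom Y Z) (f : hom X Y) : (g ∘ f) ▷ W = (g ▷ W) ∘ (f ▷ W).
Proof. by rewrite -tensm_comp comp_idl. Qed.
Lemma interchange X X' Y Y' (f : hom X X') (g : hom Y Y') :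
  (f ▷ Y') ∘ (X ◁ g) = (X' ◁ g) ∘ (f ▷ Y).
Proof. by rewrite -!tensm_comp !comp_idl !comp_idr. Qed.

Lemma assocK X Y Z : associ X Y Z ∘ assoc X Y Z = idm _.
Proof. by case: (assoc_inverse X Y Z). Qed.
Lemma associK X Y Z : assoc X Y Z ∘ associ X Y Z = idm _.
Proof. by case: (assoc_inverse X Y Z). Qed.
Lemma lunitiK X : lunit X ∘ luniti X = idm _.
Proof. by case: (lunit_inverse X). Qed.
Lemma runitK X : runiti X ∘ runit X = idm _.
Proof. by case: (runit_inverse X). Qed.
Lemma runitiK X : runit X ∘ runiti X = idm _.
Proof. by case: (runit_inverse X). Qed.

Lemma assoc_iso X Y Z : is_iso (assoc X Y Z).
Proof. by exists (associ X Y Z); exact: assoc_inverse. Qed.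
Lemma lunit_iso X : is_iso (lunit X).
Proof. by exists (luniti X); exact: lunit_inverse. Qed.
Lemma lw_iso W X Y (f : hom X Y) : is_iso f -> is_iso (W ◁ f).
Proof. by case=> g [gf fg]; exists (W ◁ g); split; rewrite -lw_comp ?gf ?fg tensm_id. Qed.
Lemma rw_iso W X Y (f : hom X Y) : is_iso f -> is_iso (f ▷ W).
Proof. by case=> g [gf fg]; exists (g ▷ W); split; rewrite -rw_comp ?gf ?fg tensm_id. Qed.

Lemma assoc_nat1 X X' Y Z (f : hom X X') :
  assoc X' Y Z ∘ ((f ▷ Y) ▷ Z) = (f ▷ (Y ⊗ Z)) ∘ assoc X Y Z.
Proof. by rewrite assoc_natural tensm_id. Qed.
Lemma assoc_nat2 X Y Y' Z (g : hom Y Y') :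
  assoc X Y' Z ∘ ((X ◁ g) ▷ Z) = (X ◁ (g ▷ Z)) ∘ assoc X Y Z.
Proof. exact: assoc_natural. Qed.
Lemma assoc_nat3 X Y Z Z' (h : hom Z Z') :
  assoc X Y Z' ∘ ((X ⊗ Y) ◁ h) = (X ◁ (Y ◁ h)) ∘ assoc X Y Z.
Proof. by rewrite -tensm_id assoc_natural. Qed.

Lemma conj_natural W X Y Z (a : hom X Y) (ai : hom Y X) (b : hom Z W) (bi : hom W Z)
    (f : hom X Z) (g : hom Y W) :
  is_inverse a ai -> is_inverse b bi -> b ∘ f = g ∘ a -> bi ∘ g = f ∘ ai.
Proof.
move=> [aia aai] [bib bbi] e.
by rewrite -(comp_idr (bi ∘ g)) -aai -compA (compA g) -e !compA bib comp_idl.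
Qed.

Lemma associ_nat1 X X' Y Z (f : hom X X') :
  associ X' Y Z ∘ (f ▷ (Y ⊗ Z)) = ((f ▷ Y) ▷ Z) ∘ associ X Y Z.
Proof. exact: (conj_natural (assoc_inverse _ _ _) (assoc_inverse _ _ _) (assoc_nat1 _ _ _)). Qed.
Lemma associ_nat2 X Y Y' Z (g : hom Y Y') :
  associ X Y' Z ∘ (X ◁ (g ▷ Z)) = ((X ◁ g) ▷ Z) ∘ associ X Y Z.
Proof. exact: (conj_natural (assoc_inverse _ _ _) (assoc_inverse _ _ _) (assoc_nat2 _ _ _)). Qed.
Lemma associ_nat3 X Y Z Z' (h : hom Z Z') :
  associ X Y Z' ∘ (X ◁ (Y ◁ h)) = ((X ⊗ Y) ◁ h) ∘ associ X Y Z.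
Proof. exact: (conj_natural (assoc_inverse _ _ _) (assoc_inverse _ _ _) (assoc_nat3 _ _ _)). Qed.
Lemma luniti_natural X X' (f : hom X X') : luniti X' ∘ f = (𝟙 ◁ f) ∘ luniti X.
Proof. exact: (conj_natural (lunit_inverse _) (lunit_inverse _) (lunit_natural _)). Qed.

(** Kelly's argument: tensoring with the unit object is faithful, and after
    tensoring the identity follows from the pentagon and the triangle. *)
Lemma lunit_tens X Y : lunit (X ⊗ Y) ∘ assoc 𝟙 X Y = lunit X ▷ Y.
Proof.
have faithful V W (f g : hom V W) : (𝟙 ◁ f : hom (𝟙 ⊗ V) _) = 𝟙 ◁ g -> f = g.
  by move=> e; apply: (iso_epi (lunit_iso V)); rewrite -!lunit_natural e.
apply: faithful; apply: (iso_epi (assoc_iso 𝟙 (𝟙 ⊗ X) Y)).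
apply: (iso_epi (rw_iso Y (assoc_iso 𝟙 𝟙 X))).
rewrite lw_comp -!compA (compA (𝟙 ◁ assoc _ _ _)) -pentagon (compA (𝟙 ◁ lunit _)).
rewrite triangle -assoc_nat1 -triangle rw_comp.
by rewrite (compA (assoc 𝟙 X Y)) assoc_nat2 -!compA.
Qed.

Lemma luniti_tens X Y : associ 𝟙 X Y ∘ luniti (X ⊗ Y) = luniti X ▷ Y.
Proof.
apply: (iso_mono (rw_iso Y (lunit_iso X))); rewrite -rw_comp lunitiK tensm_id.
by rewrite -lunit_tens -compA (compA (assoc _ _ _)) associK comp_idl lunitiK.
Qed.
End MonoidalTheory.

(** * Strict families of morphisms *)

Section StrictFamilies.
Variables (K : fieldType) (C : monoidalCategory K).
Implicit Types A U V W X Y Z : C.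

(** The definitions below are locked so that rewriting with the associativity
    of composition stops at them. *)
Definition splitf A X Y (f : hom A (X ⊗ Y)) V : hom (A ⊗ V) (X ⊗ (Y ⊗ V)) :=
  locked (assoc X Y V ∘ (f ▷ V)).
Definition mergef A X Y (f : hom (X ⊗ Y) A) V : hom (X ⊗ (Y ⊗ V)) (A ⊗ V) :=
  locked ((f ▷ V) ∘ associ X Y V).
Definition cupf X Y (h : hom 𝟙 (X ⊗ Y)) V : hom V (X ⊗ (Y ⊗ V)) :=
  locked (splitf h V ∘ luniti V).
Definition capf X Y (h : hom (X ⊗ Y) 𝟙) V : hom (X ⊗ (Y ⊗ V)) V :=
  locked (lunit V ∘ mergef h V).

Lemma splitfE A X Y (f : hom A (X ⊗ Y)) V : splitf f V = assoc X Y V ∘ (f ▷ V).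
Proof. by rewrite /splitf -lock. Qed.
Lemma mergefE A X Y (f : hom (X ⊗ Y) A) V : mergef f V = (f ▷ V) ∘ associ X Y V.
Proof. by rewrite /mergef -lock. Qed.
Lemma cupfE X Y (h : hom 𝟙 (X ⊗ Y)) V : cupf h V = splitf h V ∘ luniti V.
Proof. by rewrite /cupf -lock. Qed.
Lemma capfE X Y (h : hom (X ⊗ Y) 𝟙) V : capf h V = lunit V ∘ mergef h V.
Proof. by rewrite /capf -lock. Qed.

Lemma splitf_nat A X Y (f : hom A (X ⊗ Y)) V V' (g : hom V V') :
  splitf f V' ∘ (A ◁ g) = (X ◁ (Y ◁ g)) ∘ splitf f V.
Proof. by rewrite !splitfE -compA interchange !compA assoc_nat3. Qed.

Lemma mergef_nat A X Y (f : hom (X ⊗ Y) A) V V' (g : hom V V') :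
  mergef f V' ∘ (X ◁ (Y ◁ g)) = (A ◁ g) ∘ mergef f V.
Proof. by rewrite !mergefE -compA associ_nat3 !compA interchange. Qed.

Lemma cupf_nat X Y (h : hom 𝟙 (X ⊗ Y)) V V' (g : hom V V') :
  cupf h V' ∘ g = (X ◁ (Y ◁ g)) ∘ cupf h V.
Proof. by rewrite !cupfE -compA luniti_natural compA splitf_nat -compA. Qed.

Lemma capf_nat X Y (h : hom (X ⊗ Y) 𝟙) V V' (g : hom V V') :
  capf h V' ∘ (X ◁ (Y ◁ g)) = g ∘ capf h V.
Proof. by rewrite !capfE -compA mergef_nat compA lunit_natural -compA. Qed.

Lemma pentagon_split X Y V W :
  (X ◁ assoc Y V W) ∘ (assoc X (Y ⊗ V) W ∘ (assoc X Y V ▷ W))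
  = assoc X Y (V ⊗ W) ∘ assoc (X ⊗ Y) V W.
Proof. by rewrite pentagon compA. Qed.

Lemma pentagon_merge X Y V W :
  assoc (X ⊗ Y) V W ∘ (associ X Y V ▷ W)
  = associ X Y (V ⊗ W) ∘ ((X ◁ assoc Y V W) ∘ assoc X (Y ⊗ V) W).
Proof.
apply: (iso_epi (rw_iso W (assoc_iso X Y V))); rewrite -!compA pentagon_split.
by rewrite (compA (associ _ _ _)) assocK comp_idl -rw_comp assocK tensm_id comp_idr.
Qed.

Lemma pentagon_mid X D Y V :
  (X ◁ associ D Y V) ∘ (assoc X D (Y ⊗ V) ∘ assoc (X ⊗ D) Y V)
  = assoc X (D ⊗ Y) V ∘ (assoc X D Y ▷ V).
Proof.
by rewrite -pentagon_split (compA (X ◁ associ _ _ _)) -lw_comp assocK tensm_id comp_idl.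
Qed.

Lemma pentagon_mid' D X Y V :
  associ D X (Y ⊗ V) ∘ ((D ◁ assoc X Y V) ∘ assoc D (X ⊗ Y) V)
  = assoc (D ⊗ X) Y V ∘ (associ D X Y ▷ V).
Proof. by rewrite pentagon_merge. Qed.

(** Naturality in V alone does not make a family come from a morphism;
    compatibility with a further tensor factor W on the right does. *)
Lemma splitf_tens A X Y (f : hom A (X ⊗ Y)) V W :
  (X ◁ assoc Y V W) ∘ (assoc X (Y ⊗ V) W ∘ (splitf f V ▷ W))
  = splitf f (V ⊗ W) ∘ assoc A V W.
Proof.
by rewrite !splitfE rw_comp -!compA -assoc_nat1 !compA -pentagon.
Qed.

Lemma mergef_tens A X Y (f : hom (X ⊗ Y) A) V W :
  assoc A V W ∘ (mergef f V ▷ W)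
  = mergef f (V ⊗ W) ∘ ((X ◁ assoc Y V W) ∘ assoc X (Y ⊗ V) W).
Proof. by rewrite !mergefE rw_comp compA assoc_nat1 -!compA pentagon_merge. Qed.

Lemma cupf_tens X Y (h : hom 𝟙 (X ⊗ Y)) V W :
  (X ◁ assoc Y V W) ∘ (assoc X (Y ⊗ V) W ∘ (cupf h V ▷ W)) = cupf h (V ⊗ W).
Proof.
rewrite !cupfE rw_comp (compA (assoc _ _ _)) compA splitf_tens -compA -luniti_tens.
by rewrite (compA (assoc _ _ _)) associK comp_idl.
Qed.

Lemma capf_tens X Y (h : hom (X ⊗ Y) 𝟙) V W :
  capf h V ▷ W = capf h (V ⊗ W) ∘ ((X ◁ assoc Y V W) ∘ assoc X (Y ⊗ V) W).
Proof. by rewrite !capfE rw_comp -lunit_tens -!compA mergef_tens. Qed.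

Lemma capf_pre1 X X' Y (h : hom (X ⊗ Y) 𝟙) (f : hom X' X) V :
  capf (h ∘ (f ▷ Y)) V = capf h V ∘ (f ▷ (Y ⊗ V)).
Proof. by rewrite !capfE !mergefE rw_comp -!compA associ_nat1. Qed.

Lemma capf_pre2 X Y Y' (h : hom (X ⊗ Y) 𝟙) (f : hom Y' Y) V :
  capf (h ∘ (X ◁ f)) V = capf h V ∘ (X ◁ (f ▷ V)).
Proof. by rewrite !capfE !mergefE rw_comp -!compA associ_nat2. Qed.

Lemma cupf_post2 X Y Y' (c : hom 𝟙 (X ⊗ Y)) (f : hom Y Y') V :
  cupf ((X ◁ f) ∘ c) V = (X ◁ (f ▷ V)) ∘ cupf c V.
Proof. by rewrite !cupfE !splitfE rw_comp !compA assoc_nat2. Qed.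

(** The transpose of a morphism is again a nested evaluation of families.
    The zigzag identities and the formula for [curry] are instances. *)
Lemma transposef Z W D (h : hom (Z ⊗ W) 𝟙) (c : hom 𝟙 (W ⊗ D)) V :
  (lunit D ∘ (h ▷ D) ∘ associ Z W D ∘ (Z ◁ c) ∘ runiti Z) ▷ V
  = capf h (D ⊗ V) ∘ (Z ◁ cupf c V).
Proof.
rewrite !rw_comp -lunit_tens.
have runiti_tri : Z ◁ luniti V = assoc Z 𝟙 V ∘ (runiti Z ▷ V).
  apply: (iso_mono (lw_iso Z (lunit_iso V))); rewrite -lw_comp lunitiK tensm_id.
  by rewrite compA triangle -rw_comp runitiK tensm_id.
rewrite !capfE !cupfE !splitfE !mergefE !lw_comp -!compA; congr (_ ∘ _).
rewrite runiti_tri (compA (Z ◁ (c ▷ V))) -assoc_nat2 -!compA.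
rewrite (compA (assoc 𝟙 D V)) assoc_nat1 -!compA; congr (_ ∘ _).
by rewrite (compA (assoc _ _ _) (associ _ _ _ ▷ V)) -pentagon_mid' -!compA.
Qed.

Section Zigzag.
Variables (X D : C) (e : hom (D ⊗ X) 𝟙) (c : hom 𝟙 (X ⊗ D)).
Hypothesis dual_ec : is_left_dual e c.

Lemma zigzagX V : (X ◁ capf e V) ∘ cupf c (X ⊗ V) = idm (X ⊗ V).
Proof.
case: dual_ec => zz _; rewrite -tensm_id -[in RHS]zz !rw_comp.
have -> : luniti X ▷ V = associ 𝟙 X V ∘ luniti (X ⊗ V) by rewrite luniti_tens.
rewrite -triangle !capfE !cupfE !splitfE !mergefE !lw_comp -!compA; congr (_ ∘ _).
rewrite (compA (assoc X 𝟙 V)) assoc_nat2 -compA; congr (_ ∘ _).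
rewrite (compA (assoc _ _ _) (assoc X D X ▷ V)) -pentagon_mid -!compA.
congr (_ ∘ (_ ∘ _)); rewrite (compA (assoc _ _ _)) assoc_nat1 -compA.
by rewrite (compA (assoc _ _ _)) associK comp_idl.
Qed.

Lemma zigzagD V : capf e (D ⊗ V) ∘ (D ◁ cupf c V) = idm (D ⊗ V).
Proof.
by case: dual_ec => _ zz; rewrite -transposef zz tensm_id.
Qed.
End Zigzag.

End StrictFamilies.

(** * Duality and the pivotal structure *)

Section DualFamilies.
Variables (K : fieldType) (C : fusionCategory K).
Implicit Types U V W X Y Z : C.

Lemma ev_coev X V : (X ◁ capf (ev X) V) ∘ cupf (coev X) (X ⊗ V) = idm (X ⊗ V).
Proof. exact: zigzagX (fus_left_dual X) V. Qed.

Lemma coev_ev X V :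
  capf (ev X) (dual X ⊗ V) ∘ (dual X ◁ cupf (coev X) V) = idm (dual X ⊗ V).
Proof. exact: zigzagD (fus_left_dual X) V. Qed.

Lemma curryf Z W (h : hom (Z ⊗ W) 𝟙) V :
  curry h ▷ V = capf h (dual W ⊗ V) ∘ (Z ◁ cupf (coev W) V).
Proof. exact: transposef. Qed.

Lemma curry_ev Z W (h : hom (Z ⊗ W) 𝟙) V :
  capf (ev W) V ∘ (curry h ▷ (W ⊗ V)) = capf h V.
Proof.
rewrite curryf compA -capf_nat -compA -lw_comp ev_coev tensm_id comp_idr.
by [].
Qed.

Lemma dualm_ev X Y (f : hom X Y) V :
  capf (ev X) V ∘ (dualm f ▷ (X ⊗ V)) = capf (ev Y) V ∘ (dual Y ◁ (f ▷ V)).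
Proof. by rewrite /dualm curry_ev capf_pre2. Qed.

(** The transpose is characterized by [dualm_ev]; the zigzag identities turn
    this into its characterization by coevaluations. *)
Lemma dualm_coev X Y (f : hom X Y) V :
  (f ▷ (dual X ⊗ V)) ∘ cupf (coev X) V = (Y ◁ (dualm f ▷ V)) ∘ cupf (coev Y) V.
Proof.
have -> : dualm f ▷ V = capf (ev Y) (dual X ⊗ V)
    ∘ ((dual Y ◁ (f ▷ (dual X ⊗ V))) ∘ (dual Y ◁ cupf (coev X) V)).
  rewrite compA -dualm_ev -compA interchange compA coev_ev comp_idl.
  by [].
by rewrite -(lw_comp (dual Y)) lw_comp -compA -cupf_nat compA ev_coev comp_idl.
Qed.

(** [dual_tens] transports the evaluation of a tensor product to nested
    evaluations.  With [dual_tens_coev] and [pev_tens] it lets a trace over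
    X tensor Y be taken one factor at a time. *)
Lemma dual_tens_ev X Y V :
  capf (ev (X ⊗ Y)) V ∘ mergef (dual_tens X Y) ((X ⊗ Y) ⊗ V)
  = capf (ev Y) V ∘ ((dual Y ◁ capf (ev X) (Y ⊗ V))
                      ∘ (dual Y ◁ (dual X ◁ assoc X Y V))).
Proof.
rewrite mergefE compA /dual_tens curry_ev capfE mergefE.
set h := _ ∘ assoc (dual Y) (dual X) (X ⊗ Y).
pose u := lunit Y ∘ ((ev X ▷ Y) ∘ associ (dual X) X Y).
have -> : h = ev Y ∘ ((dual Y ◁ u) ∘ assoc (dual Y) (dual X) (X ⊗ Y)).
  by rewrite /h /u !lw_comp -!compA.
have uV : (u ▷ V) ∘ associ (dual X) (X ⊗ Y) V
          = capf (ev X) (Y ⊗ V) ∘ (dual X ◁ assoc X Y V).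
  rewrite /u !rw_comp -lunit_tens capfE mergefE -!compA; congr (_ ∘ _).
  rewrite (compA (assoc _ _ _)) assoc_nat1 -!compA; congr (_ ∘ _).
  rewrite (compA (assoc _ _ _)) pentagon_merge -!compA associK comp_idr.
  by [].
rewrite !rw_comp -!compA -lw_comp -uV capfE mergefE -!compA; congr (_ ∘ (_ ∘ _)).
rewrite lw_comp (compA (associ _ _ _)) associ_nat2 -compA; congr (_ ∘ _).
apply: (iso_epi (assoc_iso _ _ _)); rewrite -!compA.
rewrite assocK comp_idr.
apply: (iso_mono (assoc_iso (dual Y) (dual X ⊗ X ⊗ Y) V)).
apply: (iso_epi (assoc_iso (dual Y ⊗ dual X) (X ⊗ Y) V)).
rewrite -!compA assocK comp_idr pentagon_mid.
by rewrite (compA (assoc _ _ _) (associ _ _ _)) associK comp_idl.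
Qed.

Lemma dual_tens_coev X Y V :
  assoc X Y (dual (X ⊗ Y) ⊗ V) ∘ cupf (coev (X ⊗ Y)) V
  = (X ◁ (Y ◁ mergef (dual_tens X Y) V))
      ∘ ((X ◁ cupf (coev Y) (dual X ⊗ V)) ∘ cupf (coev X) V).
Proof.
set m := assoc X Y _ ∘ _.
pose g := capf (ev X) _ ∘ (dual X ◁ m).
have -> : mergef (dual_tens X Y) V = capf (ev Y) _ ∘ (dual Y ◁ g).
  rewrite /g /m !lw_comp (compA (dual Y ◁ capf _ _)) compA -dual_tens_ev -compA mergef_nat.
  by rewrite compA coev_ev comp_idl.
rewrite compA -lw_comp (lw_comp Y) -(compA (Y ◁ _)) -cupf_nat (compA (Y ◁ _)) ev_coev comp_idl.
by rewrite /g lw_comp -compA -cupf_nat compA ev_coev comp_idl.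
Qed.
End DualFamilies.

Section Pivotal.
Variables (K : fieldType) (C : premodularCategory K).
Implicit Types U V W X Y Z : C.

(** The evaluation on the other side, obtained from the pivotal structure. *)
Definition pev X : hom (X ⊗ dual X) 𝟙 := ev (dual X) ∘ (piv X ▷ dual X).

Lemma pev_capf X V : capf (pev X) V = capf (ev (dual X)) V ∘ (piv X ▷ (dual X ⊗ V)).
Proof. exact: capf_pre1. Qed.

(** This is the naturality of the pivotal structure; cyclicity of traces
    rests on it. *)
Lemma pev_dualm X Y (f : hom X Y) V :
  capf (pev X) V ∘ (X ◁ (dualm f ▷ V)) = capf (pev Y) V ∘ (f ▷ (dual Y ⊗ V)).
Proof.
by rewrite !pev_capf -!compA interchange compA -dualm_ev -compA -!rw_comp piv_natural.
Qed.

(** This is the monoidality of the pivotal structure; multiplicativity of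
    traces rests on it. *)
Lemma pev_tens X Y V :
  capf (pev (X ⊗ Y)) V ∘ ((X ⊗ Y) ◁ mergef (dual_tens X Y) V)
  = capf (pev X) V ∘ ((X ◁ capf (pev Y) (dual X ⊗ V))
                       ∘ assoc X Y (dual Y ⊗ (dual X ⊗ V))).
Proof.
set Q := (dual Y ⊗ dual X) ⊗ V.
have step1 : capf (pev (X ⊗ Y)) V ∘ ((X ⊗ Y) ◁ mergef (dual_tens X Y) V)
    = capf (ev (dual Y ⊗ dual X)) V
      ∘ (((dual_tens (dual Y) (dual X) ∘ (piv X ⊠ piv Y)) ▷ Q)
      ∘ ((X ⊗ Y) ◁ associ (dual Y) (dual X) V)).
  rewrite pev_capf mergefE lw_comp -compA (compA (piv _ ▷ _)) interchange.
  rewrite -(compA (dual _ ◁ _)) compA -dualm_ev -compA (compA (dualm _ ▷ _)) -rw_comp.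
  by rewrite piv_monoidal.
have step2 : capf (ev (dual Y ⊗ dual X)) V ∘ (dual_tens (dual Y) (dual X) ▷ Q)
    = capf (ev (dual X)) V ∘ ((dual (dual X) ◁ capf (ev (dual Y)) (dual X ⊗ V))
      ∘ ((dual (dual X) ◁ (dual (dual Y) ◁ assoc (dual Y) (dual X) V))
      ∘ assoc _ _ Q)).
  have := congr1 (fun t => t ∘ assoc _ _ _) (dual_tens_ev (dual Y) (dual X) V).
  by rewrite mergefE -!compA assocK comp_idr.
rewrite step1 rw_comp -(compA (dual_tens _ _ ▷ _)) [LHS]compA step2 -!compA.
rewrite (compA (assoc _ _ _) ((piv X ⊠ piv Y) ▷ Q)) assoc_natural -!compA assoc_nat3.
rewrite pev_capf -compA; congr (_ ∘ _).
rewrite !compA -!tensm_comp !comp_idl !comp_idr; congr (_ ∘ _).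
congr (_ ⊠ _).
rewrite pev_capf -!compA; congr (_ ∘ _).
by rewrite -tensm_comp comp_idr comp_idl -tensm_comp comp_idl associK.
Qed.
End Pivotal.

(** * Schur's lemma and decompositions into simple objects *)

Section LinearDimension.
Variables (K : fieldType) (V W : vectType K).

Lemma dim_bijection (phi : V -> W) (psi : W -> V) :
  linear phi -> cancel phi psi -> cancel psi phi -> \dim {: V} = \dim {: W}.
Proof.
move=> lin_phi phiK psiK.
pose P : {linear V -> W} := HB.pack phi (GRing.isLinear.Build K V W *:%R phi lin_phi).
have ker0 : lker (linfun P) == 0%VS.
  by apply/lker0P=> u v; rewrite !lfunE /= => /(can_inj phiK).
have <- : limg (linfun P) = fullv.
  apply/vspaceP=> w; rewrite memvf; apply/memv_imgP.
  by exists (psi w); rewrite ?memvf // lfunE /= psiK.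
by rewrite limg_dim_eq // (eqP ker0) capv0.
Qed.
End LinearDimension.

Section Schur.
Import VectorInternalTheory.
Variables (K : closedFieldType) (C : fusionCategory K).
Implicit Types X Y Z : C.

Lemma simple_hom_iso X Y (f : hom X Y) : is_simple X -> is_simple Y -> f != 0 -> is_iso f.
Proof.
move=> [nzX simX] [_ simY] f0.
have [W [k [fk0 univ]]] := ab_kernel (fus_abelian C) f.
have mono_k : is_mono k.
  move=> Z g h kg_kh; have [|u [_ uniq_u]] := univ Z (k ∘ h).
    by rewrite compA fk0 comp0l.
  by rewrite -(uniq_u g kg_kh) (uniq_u h).
have [W0|iso_k] := simX W k mono_k; last first.
  case/eqP: f0; apply: (iso_epi iso_k); by rewrite fk0 comp0l.
have mono_f : is_mono f.
  move=> Z g h fg_fh; have [|u [ku _]] := univ Z (g - h).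
    by rewrite compDr compNr fg_fh subrr.
  apply/eqP; rewrite -subr_eq0 -ku -(comp_idl u) W0 comp0l comp0r.
  by [].
by have [X0|//] := simY X f mono_f; case: nzX.
Qed.

(** Composition with f acts on the finite-dimensional space of endomorphisms
    and has an eigenvector there. *)
Lemma endo_eigenvalue X (f : hom X X) : ~ is_zero X ->
  exists a (g : hom X X), g != 0 /\ f ∘ g = a *: g.
Proof.
move=> nzX; set n := dim (hom X X).
pose r : 'rV[K]_n -> hom X X := @r2v _ (hom X X).
pose v : hom X X -> 'rV[K]_n := @v2r _ (hom X X).
have vD : {morph v : x y / x + y} by move=> x y; rewrite /v linearD.
have vZ c x : v (c *: x) = c *: v x by rewrite /v linearZ.
have rZ c x : r (c *: x) = c *: r x by rewrite /r linearZ.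
have rsum (F : 'I_n -> 'rV[K]_n) : r (\sum_i F i) = \sum_i r (F i).
  by rewrite /r linear_sum.
have vsum (F : 'I_n -> hom X X) : v (\sum_i F i) = \sum_i v (F i).
  by rewrite /v linear_sum.
have rv : cancel v r by exact: v2rK.
have vr : cancel r v by exact: r2vK.
pose A : 'M[K]_n := \matrix_(i < n) v (f ∘ r (delta_mx 0 i)).
have AE (u : 'rV_n) : u *m A = v (f ∘ r u).
  rewrite {2}(row_sum_delta u) rsum comp_sumr vsum mulmx_sum_row.
  by apply: eq_bigr => i _; rewrite rowK rZ compZr vZ.
have n0 : (0 < n)%N.
  rewrite lt0n; apply: contra_notN nzX => /eqP n0.
  apply: (can_inj rv); apply/rowP=> i; exfalso; move: i; rewrite n0; by case.
have [a] : exists a, root (char_poly A) a.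
  by apply/closed_rootP; rewrite size_char_poly; case: (n) n0.
rewrite -eigenvalue_root_char => /eigenvalueP[u uA u0].
exists a, (r u); split.
  by apply: contra u0 => /eqP e; rewrite -(vr u) e /v linear0.
by apply: (can_inj rv); rewrite -AE uA vZ vr.
Qed.

Lemma Schur X (f : hom X X) : is_simple X -> exists a, f = a *: idm X.
Proof.
move=> simX; have [a [g [g0 fg]]] := endo_eigenvalue f simX.1.
exists a; apply/eqP; rewrite -subr_eq0; apply/negPn/negP => h0.
have [h [hK _]] := simple_hom_iso simX simX h0.
case/eqP: g0; rewrite -(comp_idl g) -hK -compA compDl compNl compZl comp_idl fg.
by rewrite subrr comp0r.
Qed.
End Schur.

Section Decomposition.
Variables (K : closedFieldType) (C : fusionCategory K).
Implicit Types (X Y Z : C) (x y z : irr C).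

Lemma irr_idm_neq0 x : idm (irr_obj x) != 0.
Proof. by apply/eqP; case: (irr_simple x). Qed.

Lemma hom_irr_eq0 x y (f : hom (irr_obj x) (irr_obj y)) : x != y -> f = 0.
Proof.
move=> ne; apply/eqP/negPn/negP => f0; case/eqP: ne.
have iso_f := simple_hom_iso (irr_simple x) (irr_simple y) f0.
have [z [_ uniq_z]] := irr_complete (irr_simple x).
rewrite -(uniq_z x); last by exists (idm _), (idm _); split; rewrite comp_idl.
by apply: uniq_z; exists f.
Qed.

Lemma irr_scalar_exists x (f : hom (irr_obj x) (irr_obj x)) : exists a, f = a *: idm _.
Proof. exact: Schur (irr_simple x). Qed.

Definition irr_scalar x (f : hom (irr_obj x) (irr_obj x)) : K :=
  sval (cid (irr_scalar_exists f)).

Lemma irr_scalarE x (f : hom (irr_obj x) (irr_obj x)) : f = irr_scalar f *: idm _.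
Proof. by rewrite /irr_scalar; case: cid. Qed.

Lemma irr_scalar_id x a : irr_scalar (a *: idm (irr_obj x)) = a.
Proof.
apply/eqP; rewrite -subr_eq0; have := irr_scalarE (a *: idm (irr_obj x)).
move/eqP; rewrite eq_sym -subr_eq0 -scalerBl scaler_eq0.
by rewrite (negPf (irr_idm_neq0 x)) orbF.
Qed.

Lemma irr_scalar_linear x : linear (@irr_scalar x : _ -> K^o).
Proof.
move=> a f g; rewrite {1}(irr_scalarE f) {1}(irr_scalarE g).
by rewrite scalerA -scalerDl irr_scalar_id.
Qed.

(** The same index set serves for all simple objects x, with zero morphisms
    at the indices not of type x; this avoids transport along equalities of
    simple objects. *)
Definition decomposes Y (J : finType) (e : irr C -> J -> bool)
    (i : forall x, J -> hom (irr_obj x) Y) (p : forall x, J -> hom Y (irr_obj x)) : Prop :=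
  (forall x a b, p x a ∘ i x b = ((a == b) && e x a)%:R *: idm _) /\
  \sum_x \sum_a i x a ∘ p x a = idm Y.

Lemma decomposition Y : exists n e (i : forall x, 'I_n -> hom (irr_obj x) Y) p,
  decomposes e i p.
Proof.
have [n [F [simF [inc [prj [pi1 pi0 sum1]]]]]] := fus_semisimple (f := C) Y.
have isoP x j : {phi : hom (irr_obj x) (F j) * hom (F j) (irr_obj x) |
    if `[< isomorphic (F j) (irr_obj x) >] then is_inverse phi.1 phi.2 else phi = (0, 0)}.
  apply: cid; case: asboolP => [[f [g fg]]|_]; last by exists (0, 0).
  by exists (g, f); case: fg.
pose e x j := `[< isomorphic (F j) (irr_obj x) >].
exists n, e, (fun x j => inc j ∘ (sval (isoP x j)).1).
exists (fun x j => (sval (isoP x j)).2 ∘ prj j).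
split=> [x a b|].
  rewrite -compA (compA (prj a)); have [eq_ab|ne] := eqVneq a b; last first.
    by rewrite pi0 // comp0l comp0r scale0r.
  subst b; rewrite pi1 comp_idl /= /e.
  case: (isoP x a) => [[f g] /=]; case: asboolP => [_ [gf _]|_ [-> ->]].
    by rewrite scale1r.
  by rewrite comp0r scale0r.
rewrite exchange_big -sum1 /=; apply: eq_bigr => j _.
have [x0 [iso0 uniq0]] := irr_complete (simF j).
rewrite (bigD1 x0) //= big1 => [|x ne].
  rewrite addr0; case: (isoP x0 j) => [[f g] /=].
  case: asboolP => // _ [_ fg].
  by rewrite -compA (compA f) fg comp_idl.
case: (isoP x j) => [[f g] /=]; case: asboolP => [iso _|_ [-> ->]].
  by rewrite (uniq0 _ iso) eqxx in ne.
by rewrite comp0r comp0l.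
Qed.

Section Multiplicity.
Variables (Y : C) (J : finType) (e : irr C -> J -> bool).
Variables (i : forall x, J -> hom (irr_obj x) Y) (p : forall x, J -> hom Y (irr_obj x)).
Hypothesis dec : decomposes e i p.

Lemma decomposes_i x a : i x a = (e x a)%:R *: i x a.
Proof.
rewrite -{1}(comp_idl (i x a)) -dec.2 comp_suml (bigD1 x) //= [X in _ + X]big1 ?addr0.
  rewrite comp_suml (bigD1 a) //= -compA dec.1 eqxx compZr comp_idr big1 ?addr0 //.
  by move=> b ne; rewrite -compA dec.1 (negPf ne) scale0r comp0r.
move=> y ne; rewrite comp_suml big1 // => b _.
by rewrite -compA (hom_irr_eq0 (p y b ∘ i x a)) ?comp0r // eq_sym.
Qed.

Lemma decomposes_p x a : p x a = (e x a)%:R *: p x a.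
Proof.
rewrite -{1}(comp_idr (p x a)) -dec.2 comp_sumr (bigD1 x) //= [X in _ + X]big1 ?addr0.
  rewrite comp_sumr (bigD1 a) //= compA dec.1 eqxx compZl comp_idl big1 ?addr0 //.
  by move=> b ne; rewrite compA dec.1 eq_sym (negPf ne) scale0r comp0l.
move=> y ne; rewrite comp_sumr big1 // => b _.
by rewrite compA (hom_irr_eq0 (p x a ∘ i y b)) ?comp0l.
Qed.

Lemma decomposes_hom_to x (h : hom (irr_obj x) Y) :
  h = \sum_a irr_scalar (p x a ∘ h) *: i x a.
Proof.
rewrite -{1}(comp_idl h) -dec.2 comp_suml (bigD1 x) //= [X in _ + X]big1 ?addr0.
  rewrite comp_suml; apply: eq_bigr => a _.
  by rewrite -compA {1}(irr_scalarE (p x a ∘ h)) compZr comp_idr.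
move=> y ne; rewrite comp_suml big1 // => b _.
by rewrite -compA (hom_irr_eq0 (p y b ∘ h)) ?comp0r // eq_sym.
Qed.

Lemma decomposes_hom_from x (h : hom Y (irr_obj x)) :
  h = \sum_a irr_scalar (h ∘ i x a) *: p x a.
Proof.
rewrite -{1}(comp_idr h) -dec.2 comp_sumr (bigD1 x) //= [X in _ + X]big1 ?addr0.
  rewrite comp_sumr; apply: eq_bigr => a _.
  by rewrite compA {1}(irr_scalarE (h ∘ i x a)) compZl comp_idl.
move=> y ne; rewrite comp_sumr big1 // => b _.
by rewrite compA (hom_irr_eq0 (h ∘ i y b)) ?comp0l.
Qed.

Lemma dim_hom_to x : \dim {: hom (irr_obj x) Y} = #|[pred a | e x a]|.
Proof.
set A := [pred a | e x a].
transitivity (\dim {: 'rV[K]_#|A|}); last first.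
  by rewrite dimvf -[RHS]mul1n; exact: dim_matrix.
apply/esym; apply: (@dim_bijection K _ _
  (fun r : 'rV[K]_#|A| => \sum_t r 0 t *: i x (enum_val t))
  (fun h => \row_t irr_scalar (p x (enum_val t) ∘ h))).
- move=> c r s; rewrite scaler_sumr -big_split; apply: eq_bigr => t _ /=.
  by rewrite !mxE scalerDl scalerA.
- move=> r; apply/rowP=> t; rewrite mxE comp_sumr.
  rewrite (bigD1 t) //= big1 ?addr0 => [|s ne].
    rewrite compZr dec.1 eqxx; have : enum_val t \in A by exact: enum_valP.
    by rewrite inE => ->; rewrite scale1r irr_scalar_id.
  by rewrite compZr dec.1 (inj_eq enum_val_inj) eq_sym (negPf ne) scale0r scaler0.
move=> h; rewrite [RHS]decomposes_hom_to.
rewrite [RHS](bigID (fun a => e x a)) /= [X in _ = _ + X]big1 ?addr0 => [|a ne].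
  rewrite [RHS](eq_bigl (fun a => a \in A)); last by move=> a; rewrite inE.
  by rewrite [RHS]big_enum_val; apply: eq_bigr => t _; rewrite mxE.
by rewrite decomposes_i (negPf ne) scale0r scaler0.
Qed.

(** Semisimplicity: a decomposition pairs the morphisms into Y with those out
    of Y. *)
Lemma dim_hom_from x : \dim {: hom Y (irr_obj x)} = \dim {: hom (irr_obj x) Y}.
Proof.
apply: (@dim_bijection K _ _
  (fun h : hom Y (irr_obj x) => \sum_a irr_scalar (h ∘ i x a) *: i x a)
  (fun h => \sum_a irr_scalar (p x a ∘ h) *: p x a)).
- move=> c f g; rewrite scaler_sumr -big_split; apply: eq_bigr => a _ /=.
  by rewrite compDl compZl irr_scalar_linear scalerDl scalerA.
- move=> h; rewrite [RHS]decomposes_hom_from; apply: eq_bigr => a _.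
  rewrite comp_sumr (bigD1 a) //= big1 ?addr0 => [|b ne].
    by rewrite compZr dec.1 eqxx scalerA irr_scalar_id -scalerA -decomposes_p.
  by rewrite compZr dec.1 eq_sym (negPf ne) scale0r scaler0.
move=> h; rewrite [RHS]decomposes_hom_to; apply: eq_bigr => a _.
rewrite comp_suml (bigD1 a) //= big1 ?addr0 => [|b ne].
  by rewrite compZl dec.1 eqxx scalerA irr_scalar_id -scalerA -decomposes_i.
by rewrite compZl dec.1 (negPf ne) scale0r scaler0.
Qed.
End Multiplicity.

Lemma dim_hom_iso X X' Y Y' : isomorphic X X' -> isomorphic Y Y' ->
  \dim {: hom X Y} = \dim {: hom X' Y'}.
Proof.
move=> [f [f' [f'f ff']]] [g [g' [g'g gg']]].
apply: (@dim_bijection K _ _ (fun h => g ∘ (h ∘ f')) (fun h => g' ∘ (h ∘ f))).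
- by move=> c h h'; rewrite compDl compZl compDr compZr.
- by move=> h; rewrite -compA -compA f'f comp_idr compA g'g comp_idl.
- by move=> h; rewrite -compA -compA ff' comp_idr compA gg' comp_idl.
Qed.

Lemma isomorphic_sym X Y : isomorphic X Y -> isomorphic Y X.
Proof. by case=> f [g [gf fg]]; exists g, f. Qed.

Lemma isomorphic_refl X : isomorphic X X.
Proof. by exists (idm X), (idm X); split; rewrite comp_idl. Qed.

Lemma isomorphic_tens X X' Y Y' :
  isomorphic X X' -> isomorphic Y Y' -> isomorphic (X ⊗ Y) (X' ⊗ Y').
Proof.
move=> [f [f' [f'f ff']]] [g [g' [g'g gg']]]; exists (f ⊠ g), (f' ⊠ g').
by split; rewrite -tensm_comp ?f'f ?g'g ?ff' ?gg' tensm_id.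
Qed.

Lemma dim_hom_irr x y : \dim {: hom (irr_obj x) (irr_obj y)} = (x == y).
Proof.
have [<-|ne] := eqVneq x y; last first.
  apply/eqP; rewrite dimv_eq0 -subv0; apply/subvP=> f _.
  by rewrite (hom_irr_eq0 f ne) mem0v.
transitivity (\dim <[idm (irr_obj x)]>); last by rewrite dim_vline irr_idm_neq0.
congr (\dim _); apply/vspaceP=> f; rewrite memvf; apply/esym.
by rewrite (irr_scalarE f) memvZ // memv_line.
Qed.

(** A constituent of X gives a nonzero idempotent endomorphism, which must be
    the identity. *)
Lemma endo_dim1_irr X : \dim {: hom X X} = 1%N -> exists x, isomorphic X (irr_obj x).
Proof.
move=> dim1.
have X0 : idm X != 0.
  apply/eqP=> X0; suff : \dim {: hom X X} = 0%N by rewrite dim1.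
  apply/eqP; rewrite dimv_eq0 -subv0; apply/subvP=> f _.
  by rewrite -(comp_idl f) X0 comp0l mem0v.
have endo (f : hom X X) : exists a, f = a *: idm X.
  suff /vlineP[a ->] : f \in <[idm X]>%VS by exists a.
  suff -> : <[idm X]>%VS = fullv by rewrite memvf.
  by apply/eqP; rewrite eqEdim subvf dim1 dim_vline X0.
have [n [e [i [p dec]]]] := decomposition X.
have [x [a ia0]] : exists x a, i x a ∘ p x a != 0.
  apply: contrapT => none; case/eqP: X0; rewrite -dec.2.
  apply: big1 => x _; apply: big1 => a _; apply/eqP/negPn/negP => ne.
  by apply: none; exists x, a.
have [c cE] := endo (i x a ∘ p x a).
have c0 : c != 0 by apply: contra ia0 => /eqP c0; rewrite cE c0 scale0r.
have ea : e x a.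
  case E: (e x a) => //; case/eqP: ia0.
  by rewrite (decomposes_i dec) E scale0r comp0l.
exists x, (p x a), (i x a).
have pi : p x a ∘ i x a = idm _ by rewrite dec.1 eqxx ea scale1r.
split=> //.
suff c1 : c = 1 by rewrite cE c1 scale1r.
have : c *: (c *: idm X) = c *: idm X.
  by rewrite -{1}(comp_idl (c *: idm X)) -compZl -cE -compA (compA (p x a)) pi comp_idl.
move/eqP; rewrite scalerA -subr_eq0 -scalerBl scaler_eq0 (negPf X0) orbF.
by rewrite -[X in _ - X]mulr1 -mulrBr mulf_eq0 (negPf c0) subr_eq0 => /eqP.
Qed.
End Decomposition.

(** * Partial traces *)

(** The functor that records the tensor factors to the left of the strands under
    consideration; composition of object maps is strictly associative. *)
Record endofun (K : fieldType) (C : linCategory K) := Endofun {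
  fob :> C -> C;
  fmap : forall {V W}, hom V W -> hom (fob V) (fob W);
  fmap_id : forall V, fmap (idm V) = idm (fob V);
  fmap_comp : forall U V W (g : hom V W) (f : hom U V), fmap (g ∘ f) = fmap g ∘ fmap f;
  fmap_linear : forall V W, linear (@fmap V W)
}.

Section Endofunctors.
Variables (K : fieldType) (C : monoidalCategory K).

Definition idF : endofun C.
Proof. by exists (fun V => V) (fun V W f => f). Defined.

Definition tensF (Z : C) : endofun C.
Proof.
exists (fun V => Z ⊗ V) (fun V W f => Z ◁ f).
- by move=> V; rewrite tensm_id.
- by move=> U V W g f; rewrite lw_comp.
- by move=> V W c f g; rewrite tensmDr tensmZr.
Defined.

Definition compF (F G : endofun C) : endofun C.
Proof.
exists (fun V => F (G V)) (fun V W f => fmap F (fmap G f)).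
- by move=> V; rewrite !fmap_id.
- by move=> U V W g f; rewrite !fmap_comp.
- by move=> V W c f g; rewrite !fmap_linear.
Defined.

Lemma fmap_sum (F : endofun C) V W I (r : seq I) (P : pred I) (f : I -> hom V W) :
  fmap F (\sum_(i <- r | P i) f i) = \sum_(i <- r | P i) fmap F (f i).
Proof.
have fmapD g h : fmap F (g + h : hom V W) = fmap F g + fmap F h.
  by rewrite -[g]scale1r fmap_linear !scale1r.
have fmap0 : fmap F (0 : hom V W) = 0.
  by apply: (addrI (fmap F (0 : hom V W))); rewrite -fmapD !addr0.
exact: (big_morph (@fmap _ _ F V W)).
Qed.

Lemma fmapZ (F : endofun C) V W c (f : hom V W) : fmap F (c *: f) = c *: fmap F f.
Proof.
have := fmap_linear F c f 0; rewrite !addr0 => ->.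
have := fmap_sum F (Nil nat) predT (fun _ => 0 : hom V W).
by rewrite !big_nil => ->; rewrite addr0.
Qed.

Definition natural (F G : endofun C) (f : forall V, hom (F V) (G V)) : Prop :=
  forall V W (g : hom V W), f W ∘ fmap F g = fmap G g ∘ f V.
End Endofunctors.

Section PartialTraces.
Variables (K : fieldType) (C : premodularCategory K).
Implicit Types (A U V W X Y Z : C) (F G : endofun C).

Definition ptr X F G (f : forall V, hom (F (X ⊗ V)) (G (X ⊗ V))) V : hom (F V) (G V) :=
  fmap G (capf (pev X) V) ∘ (f (dual X ⊗ V) ∘ fmap F (cupf (coev X) V)).

Lemma eq_ptr X F G (f f' : forall V, hom (F (X ⊗ V)) (G (X ⊗ V))) :
  (forall V, f V = f' V) -> forall V, ptr f V = ptr f' V.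
Proof. by move=> e V; rewrite /ptr e. Qed.

Lemma ptrZ X F G c (f : forall V, hom (F (X ⊗ V)) (G (X ⊗ V))) V :
  ptr (fun V => c *: f V) V = c *: ptr f V.
Proof. by rewrite /ptr compZl compZr. Qed.

Lemma ptr_sum X F G I (r : seq I) (P : pred I)
    (f : I -> forall V, hom (F (X ⊗ V)) (G (X ⊗ V))) V :
  ptr (fun V => \sum_(i <- r | P i) f i V) V = \sum_(i <- r | P i) ptr (f i) V.
Proof. by rewrite /ptr comp_suml comp_sumr. Qed.

Lemma ptr_natural X F G (f : forall V, hom (F (X ⊗ V)) (G (X ⊗ V))) :
  natural (F := compF F (tensF X)) (G := compF G (tensF X)) f ->
  natural (F := F) (G := G) (ptr f).
Proof.
move=> nat_f V W g; rewrite /ptr -!compA -fmap_comp cupf_nat fmap_comp (compA (f _)).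
by rewrite nat_f /= -!compA (compA (fmap G (capf _ _))) -fmap_comp capf_nat fmap_comp -compA.
Qed.

(** Slide the transpose of f around the loop. *)
Lemma ptr_cyclic X Y F G (g : forall V, hom (F (Y ⊗ V)) (G (X ⊗ V))) (f : hom X Y) V :
  natural (F := compF F (tensF Y)) (G := compF G (tensF X)) g ->
  ptr (fun V => g V ∘ fmap F (f ▷ V)) V = ptr (fun V => fmap G (f ▷ V) ∘ g V) V.
Proof.
move=> nat_g; rewrite /ptr -!compA -fmap_comp dualm_coev fmap_comp.
rewrite (compA (g _)) nat_g -compA /= (compA (fmap G (capf _ _))) -fmap_comp.
by rewrite pev_dualm fmap_comp -compA.
Qed.

Lemma ptr_tens X Y F G (h : forall V, hom (F ((X ⊗ Y) ⊗ V)) (G ((X ⊗ Y) ⊗ V))) V :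
  natural (F := compF F (tensF (X ⊗ Y))) (G := compF G (tensF (X ⊗ Y))) h ->
  ptr h V = ptr (F := F) (G := G) (fun V => ptr (F := compF F (tensF X))
    (G := compF G (tensF X))
    (fun V => fmap G (assoc X Y V) ∘ (h V ∘ fmap F (associ X Y V))) V) V.
Proof.
move=> nat_h; rewrite /ptr /=.
have -> : cupf (coev (X ⊗ Y)) V = associ X Y (dual (X ⊗ Y) ⊗ V)
    ∘ ((X ◁ (Y ◁ mergef (dual_tens X Y) V))
    ∘ ((X ◁ cupf (coev Y) (dual X ⊗ V)) ∘ cupf (coev X) V)).
  by rewrite -dual_tens_coev compA assocK comp_idl.
rewrite (compA (associ _ _ _)) associ_nat3 -compA fmap_comp (compA (h _)).
rewrite (nat_h _ _ (mergef (dual_tens X Y) V)) /= -compA compA -fmap_comp pev_tens.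
by rewrite !fmap_comp -!compA.
Qed.

(** Cyclicity for a vertex at which the strand A splits into X and Y. *)
Lemma ptr_merge A X Y F G (i : hom A (X ⊗ Y))
    (g : forall V, hom (F (X ⊗ (Y ⊗ V))) (G (A ⊗ V))) V :
  natural (F := compF F (compF (tensF X) (tensF Y))) (G := compF G (tensF A)) g ->
  ptr (fun V => g V ∘ fmap F (splitf i V)) V
  = ptr (F := F) (G := G) (fun V => ptr (F := compF F (tensF X)) (G := compF G (tensF X))
      (fun V => fmap G (splitf i V) ∘ g V) V) V.
Proof.
move=> nat_g.
transitivity (ptr (fun V => (g V ∘ fmap F (assoc X Y V)) ∘ fmap F (i ▷ V)) V).
  by apply: eq_ptr => U; rewrite splitfE fmap_comp compA.
rewrite ptr_cyclic; last first.
  move=> U W u; rewrite /= -compA -fmap_comp assoc_nat3 fmap_comp !compA.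
  by rewrite nat_g.
rewrite ptr_tens; last first.
  move=> U W u; rewrite /= -!compA -fmap_comp assoc_nat3 fmap_comp (compA (g _)) nat_g.
  by rewrite /= -!compA compA -fmap_comp interchange fmap_comp -compA.
apply: eq_ptr => U.
apply: (@eq_ptr Y (compF F (tensF X)) (compF G (tensF X))) => W /=.
rewrite -!compA -fmap_comp associK fmap_id comp_idr (compA (fmap G (assoc _ _ _))).
by rewrite -fmap_comp splitfE.
Qed.

Lemma ptr_precomp X F G (f : forall V, hom (F (X ⊗ V)) (G (X ⊗ V)))
    (H : endofun C) (u : forall V, hom (H V) (F V)) V :
  natural u -> ptr (F := H) (fun V => f V ∘ u (X ⊗ V)) V = ptr f V ∘ u V.
Proof. by move=> nat_u; rewrite /ptr -!compA nat_u. Qed.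

Lemma ptr_postcomp X F G (f : forall V, hom (F (X ⊗ V)) (G (X ⊗ V)))
    (H : endofun C) (u : forall V, hom (G V) (H V)) V :
  natural u -> ptr (G := H) (fun V => u (X ⊗ V) ∘ f V) V = u V ∘ ptr f V.
Proof. by move=> nat_u; rewrite /ptr !compA -nat_u. Qed.

Lemma ptr_fmap X F G (H : endofun C) (f : forall V, hom (F (X ⊗ V)) (G (X ⊗ V))) V :
  ptr (F := compF H F) (G := compF H G) (fun V => fmap H (f V)) V = fmap H (ptr f V).
Proof. by rewrite /ptr !fmap_comp. Qed.

(** With [strong_family_scalar] this identifies a partial trace over a simple
    object as a scalar. *)
Lemma ptr_strong X Z (f : forall V, hom (Z ⊗ (X ⊗ V)) (Z ⊗ (X ⊗ V))) :
  natural (F := compF (tensF Z) (tensF X)) (G := compF (tensF Z) (tensF X)) f ->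
  (forall V W, f (V ⊗ W) ∘ ((Z ◁ assoc X V W) ∘ assoc Z (X ⊗ V) W)
     = (Z ◁ assoc X V W) ∘ (assoc Z (X ⊗ V) W ∘ (f V ▷ W))) ->
  forall V W, ptr (F := tensF Z) (G := tensF Z) f (V ⊗ W) ∘ assoc Z V W
     = assoc Z V W ∘ (ptr (F := tensF Z) (G := tensF Z) f V ▷ W).
Proof.
move=> nat_f strong_f V W; rewrite /ptr /= -cupf_tens !lw_comp !rw_comp -!compA.
rewrite -assoc_nat2 (compA (f _)) (nat_f _ _ (assoc (dual X) V W)) /= -compA.
rewrite (compA (Z ◁ assoc X _ _)) (compA (f _)) strong_f -!compA.
rewrite [RHS](compA (assoc Z V W)) assoc_nat2 capf_tens !lw_comp -!compA.
by [].
Qed.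
End PartialTraces.

(** * Scalars attached to simple objects *)

Section Scalars.
Variables (K : closedFieldType) (C : premodularCategory K).
Implicit Types U V W X Y Z : C.

(** Such a family is e tensor V for the endomorphism e of Z read off at the
    unit object, and e is a scalar. *)
Lemma strong_family_scalar Z (e : forall V, hom (Z ⊗ V) (Z ⊗ V)) :
  is_simple Z -> natural (F := tensF Z) (G := tensF Z) e ->
  (forall V W, e (V ⊗ W) ∘ assoc Z V W = assoc Z V W ∘ (e V ▷ W)) ->
  exists c, forall V, e V = c *: idm (Z ⊗ V).
Proof.
move=> simZ nat_e strong_e.
have [c cE] := Schur (runit Z ∘ (e 𝟙 ∘ runiti Z)) simZ.
exists c => V.
have <- : (runit Z ∘ (e 𝟙 ∘ runiti Z)) ▷ V = c *: idm (Z ⊗ V).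
  by rewrite cE tensmZl tensm_id.
apply: (iso_epi (f := runit Z ▷ V)).
  by apply: rw_iso; exists (runiti Z); exact: runit_inverse.
rewrite -rw_comp -!compA runitK comp_idr rw_comp -triangle -compA.
by rewrite -strong_e !compA (nat_e _ _ (lunit V)).
Qed.

Lemma unit_scalar (f : hom 𝟙 (𝟙 : C)) : f = scalar_of f *: idm 𝟙.
Proof.
have f_span : f \in <<[tuple idm (unit_obj C)]>>%VS.
  rewrite span_seq1; have [c ->] := Schur f (fus_unit_simple C).
  by rewrite memvZ // memv_line.
by rewrite {1}(coord_span f_span) big_ord1.
Qed.

Lemma capf_cupf X Y (h : hom (X ⊗ Y) 𝟙) (c : hom 𝟙 (X ⊗ Y)) (V : C) :
  capf h V ∘ cupf c V = scalar_of (h ∘ c) *: idm V.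
Proof.
rewrite capfE cupfE mergefE splitfE -!compA (compA (associ _ _ _)) assocK comp_idl.
rewrite (compA (h ▷ V)) -rw_comp {1}(unit_scalar (h ∘ c)) tensmZl tensm_id.
by rewrite compZl comp_idl compZr lunitiK.
Qed.

Lemma ptr_id X (F : endofun C) V :
  ptr (F := F) (G := F) (fun V => idm (F (X ⊗ V))) V = cat_dim X *: idm (F V).
Proof. by rewrite /ptr comp_idl -fmap_comp capf_cupf fmapZ fmap_id. Qed.

End Scalars.

(** * The double braiding *)

Section BraidFamilies.
Variables (K : fieldType) (C : braidedFusionCategory K).
Implicit Types U V W X Y Z : C.

Definition braidf X Y V : hom (X ⊗ (Y ⊗ V)) (Y ⊗ (X ⊗ V)) :=
  locked (assoc Y X V ∘ ((braid X Y ▷ V) ∘ associ X Y V)).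

Lemma braidfE X Y V : braidf X Y V = assoc Y X V ∘ ((braid X Y ▷ V) ∘ associ X Y V).
Proof. by rewrite /braidf -lock. Qed.

Lemma braidf_nat X Y V W (g : hom V W) :
  braidf X Y W ∘ (X ◁ (Y ◁ g)) = (Y ◁ (X ◁ g)) ∘ braidf X Y V.
Proof.
rewrite !braidfE -!compA associ_nat3 (compA (braid X Y ▷ W)) interchange -compA.
by rewrite !compA assoc_nat3.
Qed.

Lemma braidf_nat1 X X' Y V (f : hom X X') :
  braidf X' Y V ∘ (f ▷ (Y ⊗ V)) = (Y ◁ (f ▷ V)) ∘ braidf X Y V.
Proof.
rewrite !braidfE -!compA associ_nat1 (compA (braid X' Y ▷ V)) -rw_comp braid_natural.
by rewrite rw_comp -compA !compA assoc_nat2.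
Qed.

Lemma braidf_nat2 X Y Y' V (g : hom Y Y') :
  braidf X Y' V ∘ (X ◁ (g ▷ V)) = (g ▷ (X ⊗ V)) ∘ braidf X Y V.
Proof.
rewrite !braidfE -!compA associ_nat2 (compA (braid X Y' ▷ V)) -rw_comp braid_natural.
by rewrite rw_comp -compA !compA assoc_nat1.
Qed.

Lemma braidf_tens X Y V W :
  braidf X Y (V ⊗ W) ∘ ((X ◁ assoc Y V W) ∘ assoc X (Y ⊗ V) W)
  = (Y ◁ assoc X V W) ∘ (assoc Y (X ⊗ V) W ∘ (braidf X Y V ▷ W)).
Proof.
rewrite !braidfE !rw_comp -!compA -pentagon_merge (compA (braid X Y ▷ _)) -assoc_nat1.
rewrite -!compA [in RHS](compA (assoc Y (X ⊗ V) W)) [RHS]compA pentagon_split.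
by rewrite -!compA.
Qed.

Lemma braidf_hexagon1 X Y Z V :
  assoc Y Z (X ⊗ V) ∘ (braidf X (Y ⊗ Z) V ∘ (X ◁ associ Y Z V))
  = (Y ◁ braidf X Z V) ∘ braidf X Y (Z ⊗ V).
Proof.
apply: (iso_epi (assoc_iso X Y (Z ⊗ V))); apply: (iso_epi (assoc_iso (X ⊗ Y) Z V)).
have hex := congr1 (fun f => f ▷ V) (hexagon1 X Y Z); rewrite /= !rw_comp in hex.
rewrite -!compA pentagon_mid !braidfE -!compA !(compA (associ _ _ _)) !assocK !comp_idl.
rewrite (compA (assoc Y Z (X ⊗ V))) -pentagon_split -!compA.
rewrite -!compA in hex; rewrite hex !lw_comp -!compA; congr (_ ∘ _).
rewrite -assoc_nat1 (compA (assoc Y X _)) (compA (Y ◁ associ _ _ _)) pentagon_mid.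
by rewrite -!compA (compA (Y ◁ (_ ▷ _))) -assoc_nat2 -!compA.
Qed.

Lemma braidf_hexagon2 X Y Z V :
  (Z ◁ assoc X Y V) ∘ (braidf (X ⊗ Y) Z V ∘ associ X Y (Z ⊗ V))
  = braidf X Z (Y ⊗ V) ∘ (X ◁ braidf Y Z V).
Proof.
apply: (iso_epi (assoc_iso X Y (Z ⊗ V))); apply: (iso_epi (assoc_iso (X ⊗ Y) Z V)).
have hex : braid (X ⊗ Y) Z = assoc Z X Y ∘ ((braid X Z ▷ Y)
    ∘ (associ X Z Y ∘ ((X ◁ braid Y Z) ∘ assoc X Y Z))).
  apply: (iso_mono (f := associ Z X Y)).
    by exists (assoc Z X Y); case: (assoc_inverse Z X Y).
  rewrite (compA (associ Z X Y) (assoc Z X Y)) assocK comp_idl.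
  apply: (iso_epi (f := associ X Y Z)).
    by exists (assoc X Y Z); case: (assoc_inverse X Y Z).
  by rewrite hexagon2 -!compA associK comp_idr.
have hexV := congr1 (fun f => f ▷ V) hex; rewrite /= !rw_comp in hexV.
rewrite -!compA (compA (associ X Y _)) assocK comp_idl braidfE -!compA.
rewrite assocK comp_idr hexV (compA (assoc Z (X ⊗ Y) V)) compA pentagon_split.
rewrite -!compA (compA (assoc (Z ⊗ X) Y V)) assoc_nat1 braidfE -!compA; congr (_ ∘ (_ ∘ _)).
rewrite (compA (assoc (X ⊗ Z) Y V)) pentagon_merge -!compA; congr (_ ∘ _).
rewrite braidfE !lw_comp -!compA; congr (_ ∘ _).
rewrite (compA (assoc X (Z ⊗ Y) V)) assoc_nat2 -!compA; congr (_ ∘ _).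
by rewrite pentagon_mid.
Qed.

Definition double_braid Z X V : hom (Z ⊗ (X ⊗ V)) (Z ⊗ (X ⊗ V)) :=
  locked (braidf X Z V ∘ braidf Z X V).

Lemma double_braidE Z X V : double_braid Z X V = braidf X Z V ∘ braidf Z X V.
Proof. by rewrite /double_braid -lock. Qed.

Lemma double_braid_nat Z X : natural (F := compF (tensF Z) (tensF X))
  (G := compF (tensF Z) (tensF X)) (double_braid Z X).
Proof.
by move=> V W g; rewrite !double_braidE /= -compA braidf_nat !compA braidf_nat.
Qed.

Lemma double_braid_nat2 Z X X' V (f : hom X X') :
  double_braid Z X' V ∘ (Z ◁ (f ▷ V)) = (Z ◁ (f ▷ V)) ∘ double_braid Z X V.
Proof. by rewrite !double_braidE -compA braidf_nat2 !compA braidf_nat1. Qed.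

Lemma double_braid_tens Z X V W :
  double_braid Z X (V ⊗ W) ∘ ((Z ◁ assoc X V W) ∘ assoc Z (X ⊗ V) W)
  = (Z ◁ assoc X V W) ∘ (assoc Z (X ⊗ V) W ∘ (double_braid Z X V ▷ W)).
Proof.
rewrite !double_braidE -compA braidf_tens rw_comp (compA (X ◁ _)) compA braidf_tens.
by rewrite -!compA.
Qed.

(** The double braiding of Z with X tensor Y, in the form given by the
    hexagons: Z winds around X and Y in succession. *)
Definition double_braid2 Z X Y V : hom (Z ⊗ (X ⊗ (Y ⊗ V))) (Z ⊗ (X ⊗ (Y ⊗ V))) :=
  locked (braidf X Z (Y ⊗ V) ∘ ((X ◁ double_braid Z Y V) ∘ braidf Z X (Y ⊗ V))).

Lemma double_braid2E Z X Y V : double_braid2 Z X Y V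
  = braidf X Z (Y ⊗ V) ∘ ((X ◁ double_braid Z Y V) ∘ braidf Z X (Y ⊗ V)).
Proof. by rewrite /double_braid2 -lock. Qed.

Lemma double_braid_split Z A X Y (i : hom A (X ⊗ Y)) V :
  double_braid2 Z X Y V ∘ (Z ◁ splitf i V) = (Z ◁ splitf i V) ∘ double_braid Z A V.
Proof.
rewrite splitfE !lw_comp -compA -double_braid_nat2 !compA; congr (_ ∘ _).
rewrite double_braid2E !double_braidE lw_comp -!compA.
rewrite [in LHS](compA (X ◁ braidf Z Y V)) -braidf_hexagon1 -!compA -lw_comp assocK.
rewrite tensm_id comp_idr !compA; congr (_ ∘ _).
by rewrite -braidf_hexagon2 -!compA assocK comp_idr.
Qed.

End BraidFamilies.

Section BraidUnit.
Variables (K : fieldType) (C : braidedFusionCategory K).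
Implicit Types V X Y Z : C.

Lemma braidf_iso X Y V : is_iso (braidf X Y V).
Proof.
have [c [cK Kc]] := braid_iso X Y.
exists (assoc X Y V ∘ ((c ▷ V) ∘ associ Y X V)); split; rewrite braidfE -!compA.
  rewrite (compA (associ Y X V)) assocK comp_idl (compA (c ▷ V)) -rw_comp cK.
  by rewrite tensm_id comp_idl associK.
rewrite (compA (associ X Y V)) assocK comp_idl (compA (_ ▷ V)) -rw_comp Kc.
by rewrite tensm_id comp_idl associK.
Qed.

Lemma lw_lunit V : 𝟙 ◁ lunit V = lunit (𝟙 ⊗ V) :> hom (𝟙 ⊗ (𝟙 ⊗ V)) (𝟙 ⊗ V).
Proof. by apply: (iso_mono (lunit_iso V)); rewrite -lunit_natural. Qed.

(** The hexagon with two unit objects shows that the braiding with the unit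
    equals its own square, up to unit constraints. *)
Lemma braidf_unitr Z V : lunit (Z ⊗ V) ∘ braidf Z 𝟙 V = Z ◁ lunit V.
Proof.
have key : lunit (Z ⊗ (𝟙 ⊗ V)) ∘ braidf Z 𝟙 (𝟙 ⊗ V) = Z ◁ lunit (𝟙 ⊗ V).
  apply: (iso_mono (braidf_iso Z 𝟙 V)).
  rewrite compA -lunit_natural -compA -braidf_hexagon1 compA lunit_tens.
  rewrite compA -braidf_nat2 -compA -lw_comp -lunit_tens -compA associK.
  by rewrite comp_idr.
apply: (iso_epi (lw_iso Z (lw_iso 𝟙 (lunit_iso V)))).
rewrite -compA braidf_nat compA lunit_natural -compA key.
by rewrite -lw_lunit.
Qed.

Lemma braidf_unitl Z V : (Z ◁ lunit V) ∘ braidf 𝟙 Z V = lunit (Z ⊗ V).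
Proof.
have key : (Z ◁ lunit (𝟙 ⊗ V)) ∘ braidf 𝟙 Z (𝟙 ⊗ V) = lunit (Z ⊗ (𝟙 ⊗ V)).
  apply: (iso_epi (lw_iso 𝟙 (braidf_iso 𝟙 Z V))).
  rewrite -compA -braidf_hexagon2 lunit_natural compA -lw_comp lunit_tens.
  rewrite compA -braidf_nat1 -compA -lunit_tens -compA associK comp_idr.
  by [].
apply: (iso_epi (lw_iso 𝟙 (lw_iso Z (lunit_iso V)))).
by rewrite -compA braidf_nat lunit_natural -key lw_lunit.
Qed.

Lemma double_braid_unit Z V : double_braid Z 𝟙 V = idm _.
Proof.
apply: (iso_mono (lw_iso Z (lunit_iso V))).
by rewrite double_braidE compA braidf_unitl braidf_unitr comp_idr.
Qed.

Lemma double_braid_iso_unit Z X V : isomorphic X 𝟙 -> double_braid Z X V = idm _.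
Proof.
case=> f iso_f; apply: (iso_mono (lw_iso Z (rw_iso V iso_f))).
by rewrite -double_braid_nat2 double_braid_unit comp_idl comp_idr.
Qed.
End BraidUnit.

(** * The characters defined by the double braiding *)

Section Characters.
Variables (K : closedFieldType) (C : premodularCategory K).
Implicit Types (U V W X Y Z : C) (x y z : irr C).

Definition mult x Y : nat := \dim {: hom (irr_obj x) Y}.

Definition irr_dim x : K := cat_dim (irr_obj x).

Lemma ptr_double_braid_scalar z X : exists c, forall V,
  ptr (F := tensF (irr_obj z)) (G := tensF (irr_obj z)) (double_braid (irr_obj z) X) V
  = c *: idm (irr_obj z ⊗ V).
Proof.
apply: (strong_family_scalar (irr_simple z)).
  exact: (ptr_natural (F := tensF _) (G := tensF _) (double_braid_nat (irr_obj z) X)).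
apply: ptr_strong; first exact: double_braid_nat.
exact: double_braid_tens.
Qed.

Definition braid_char z X : K := sval (cid (ptr_double_braid_scalar z X)).

Lemma braid_charE z X V :
  ptr (F := tensF (irr_obj z)) (G := tensF (irr_obj z)) (double_braid (irr_obj z) X) V
  = braid_char z X *: idm (irr_obj z ⊗ V).
Proof. by rewrite /braid_char; case: cid. Qed.

Lemma scale_idm_inj x (a b : K) : (forall V, a *: idm (irr_obj x ⊗ V) = b *: idm _) -> a = b.
Proof.
move=> /(_ 𝟙) e; apply/eqP; rewrite -subr_eq0.
have : (a - b) *: idm (irr_obj x) == 0.
  have := congr1 (fun f => runit _ ∘ (f ∘ runiti (irr_obj x))) e.
  rewrite /= !compZl !compZr !comp_idl runitiK => /eqP.
  by rewrite -subr_eq0 -scalerBl.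
by rewrite scaler_eq0 (negPf (irr_idm_neq0 x)) orbF.
Qed.

Lemma scale_idm1_inj (a b : K) : a *: idm (𝟙 : C) = b *: idm _ -> a = b.
Proof.
move/eqP; rewrite -subr_eq0 -scalerBl scaler_eq0 subr_eq0 => /orP[/eqP //|/eqP e].
by case: (fus_unit_simple C).
Qed.

Lemma id_decomposition X Y J e i p V : @decomposes K C (X ⊗ Y) J e i p ->
  \sum_x \sum_a splitf (i x a) V ∘ mergef (p x a) V = idm (X ⊗ (Y ⊗ V)).
Proof.
case=> _ sum1.
transitivity (assoc X Y V ∘ ((idm (X ⊗ Y) ▷ V) ∘ associ X Y V)).
  rewrite -sum1 !tensm_suml comp_suml comp_sumr; apply: eq_bigr => x _.
  rewrite !tensm_suml comp_suml comp_sumr; apply: eq_bigr => a _.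
  by rewrite splitfE mergefE rw_comp -!compA.
by rewrite tensm_id comp_idl associK.
Qed.

Lemma mergef_splitf A B X Y (p : hom (X ⊗ Y) B) (i : hom A (X ⊗ Y)) V :
  mergef p V ∘ splitf i V = (p ∘ i) ▷ V.
Proof. by rewrite splitfE mergefE -compA (compA (associ _ _ _)) assocK comp_idl rw_comp. Qed.

(** Insert a decomposition of X tensor Y between the two strands and move its
    projections around the loops; only the simple constituents remain.  Applied
    to identities and to double braidings this gives the multiplicativity of
    dimensions and of [braid_char]. *)
Lemma ptr_fusion F X Y (h2 : forall V, hom (fob F (X ⊗ (Y ⊗ V))) (fob F (X ⊗ (Y ⊗ V))))
    (h : forall k V, hom (fob F (irr_obj k ⊗ V)) (fob F (irr_obj k ⊗ V))) (c : irr C -> K) V :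
  (forall k (i : hom (irr_obj k) (X ⊗ Y)) V,
     h2 V ∘ fmap F (splitf i V) = fmap F (splitf i V) ∘ h k V) ->
  (forall k, natural (F := compF F (tensF (irr_obj k))) (G := compF F (tensF (irr_obj k))) (h k)) ->
  (forall k V, ptr (F := F) (G := F) (h k) V = c k *: idm _) ->
  ptr (F := F) (G := F) (fun V => ptr (F := compF F (tensF X)) (G := compF F (tensF X)) h2 V) V
  = (\sum_k (mult k (X ⊗ Y))%:R * c k) *: idm (fob F V).
Proof.
move=> h2_split nat_h ptr_h; have [n [e [i [p dec]]]] := decomposition (X ⊗ Y).
pose F' := compF F (tensF X).
pose g k a W : hom (F' (Y ⊗ W)) (F' (Y ⊗ W)) :=
  fmap F (splitf (i k a) W) ∘ (h k W ∘ fmap F (mergef (p k a) W)).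
have h2E W : h2 W = \sum_k \sum_a g k a W.
  rewrite -{1}(comp_idr (h2 W)) -(fmap_id F) -(id_decomposition W dec) !fmap_sum comp_sumr.
  apply: eq_bigr => k _; rewrite fmap_sum comp_sumr; apply: eq_bigr => a _.
  by rewrite fmap_comp compA h2_split -!compA.
have ptr_h2 U : ptr (F := F') (G := F') h2 U = \sum_k \sum_a ptr (F := F') (G := F') (g k a) U.
  transitivity (ptr (F := F') (G := F') (fun W => \sum_k \sum_a g k a W) U).
    by apply: eq_ptr.
  by rewrite ptr_sum; apply: eq_bigr => k _; rewrite ptr_sum.
transitivity (\sum_k \sum_a ptr (fun V => (h k V ∘ fmap F (mergef (p k a) V))
                                   ∘ fmap F (splitf (i k a) V)) V).
  transitivity (ptr (F := F) (G := F)
      (fun U => \sum_k \sum_a ptr (F := F') (G := F') (g k a) U) V).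
    by apply: eq_ptr.
  rewrite ptr_sum; apply: eq_bigr => k _; rewrite ptr_sum; apply: eq_bigr => a _.
  rewrite ptr_merge //; move=> U W u; rewrite /= -compA -fmap_comp mergef_nat fmap_comp.
  by rewrite !compA (nat_h k).
rewrite scaler_suml; apply: eq_bigr => k _.
transitivity (\sum_a ((e k a)%:R * c k) *: idm (fob F V)).
  apply: eq_bigr => a _; rewrite -scalerA -ptr_h -ptrZ; apply: eq_ptr => U.
  rewrite -compA -fmap_comp mergef_splitf dec.1 eqxx tensmZl tensm_id fmapZ fmap_id.
  by rewrite compZr comp_idr.
rewrite -scaler_suml -mulr_suml -natr_sum; congr ((_%:R * _) *: _).
rewrite /mult (dim_hom_to dec) -sum1_card [RHS]big_mkcond.
by apply: eq_bigr => a _; rewrite inE; case: (e k a).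
Qed.

Lemma irr_dim_mul x y : irr_dim x * irr_dim y =
  \sum_k (mult k (irr_obj x ⊗ irr_obj y))%:R * irr_dim k.
Proof.
apply: scale_idm1_inj.
rewrite -(ptr_fusion (F := idF C) (h2 := fun V => idm _) (h := fun k V => idm _)).
- transitivity (ptr (F := idF C) (G := idF C)
    (fun V => irr_dim y *: idm (irr_obj x ⊗ V)) 𝟙).
    by rewrite ptrZ (ptr_id (irr_obj x) (idF C) 𝟙) scalerA mulrC.
  apply: (@eq_ptr _ _ (irr_obj x) (idF C) (idF C)) => V /=.
  by rewrite (ptr_id (irr_obj y) (compF (idF C) (tensF (irr_obj x))) V).
- by move=> k i V; rewrite comp_idl comp_idr.
- by move=> k V W g; rewrite /= comp_idl comp_idr.
by move=> k V; rewrite (ptr_id (irr_obj k) (idF C) V).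
Qed.

(** The inner loop Y only encircles Z, so it contributes a scalar. *)
Lemma ptr_double_braid2 Z X Y V c :
  (forall V, ptr (F := tensF Z) (G := tensF Z) (double_braid Z Y) V = c *: idm _) ->
  ptr (F := compF (tensF Z) (tensF X)) (G := compF (tensF Z) (tensF X))
      (double_braid2 Z X Y) V = c *: double_braid Z X V.
Proof.
move=> cE.
have natXZ : natural (F := compF (tensF X) (tensF Z)) (G := compF (tensF Z) (tensF X))
   (braidf X Z) by move=> U W g; exact: braidf_nat.
have natZX : natural (F := compF (tensF Z) (tensF X)) (G := compF (tensF X) (tensF Z))
   (braidf Z X) by move=> U W g; exact: braidf_nat.
transitivity (ptr (F := compF (tensF Z) (tensF X)) (G := compF (tensF Z) (tensF X))
   (fun V => braidf X Z (Y ⊗ V) ∘ ((X ◁ double_braid Z Y V) ∘ braidf Z X (Y ⊗ V))) V).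
  by apply: eq_ptr => U; exact: double_braid2E.
rewrite (ptr_postcomp _ _ natXZ) (ptr_precomp _ _ natZX).
rewrite (ptr_fmap (F := tensF Z) (G := tensF Z) (tensF X) (double_braid Z Y)) cE /=.
by rewrite tensmZr tensm_id compZl comp_idl compZr double_braidE.
Qed.

Lemma braid_char_mul z x y : braid_char z (irr_obj x) * braid_char z (irr_obj y) =
  \sum_k (mult k (irr_obj x ⊗ irr_obj y))%:R * braid_char z (irr_obj k).
Proof.
apply: (scale_idm_inj (x := z)) => V.
rewrite -(ptr_fusion (F := tensF (irr_obj z)) (h2 := double_braid2 _ _ _)
   (h := fun k => double_braid (irr_obj z) (irr_obj k))).
- rewrite mulrC -scalerA -braid_charE -(ptrZ (F := tensF _) (G := tensF _)).
  apply: (@eq_ptr _ _ (irr_obj x) (tensF (irr_obj z)) (tensF (irr_obj z))) => U.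
  by rewrite (ptr_double_braid2 _ _ (braid_charE z (irr_obj y))).
- by move=> k i U; exact: double_braid_split.
- by move=> k; exact: double_braid_nat.
by move=> k U; rewrite braid_charE.
Qed.

(** Both sides are the trace of the double braiding of x and z, by
    cyclicity. *)
Lemma braid_char_sym x z :
  irr_dim x * braid_char x (irr_obj z) = irr_dim z * braid_char z (irr_obj x).
Proof.
have side x' z' : (irr_dim x' * braid_char x' (irr_obj z')) *: idm (𝟙 : C)
   = ptr (F := idF C) (G := idF C)
       (fun V => (braid (irr_obj z') (irr_obj x') ∘ braid (irr_obj x') (irr_obj z')) ▷ V) 𝟙.
  rewrite ptr_tens; last by move=> U W g; rewrite /= interchange.
  rewrite mulrC -scalerA -(ptr_id (irr_obj x') (idF C) 𝟙).
  rewrite -(ptrZ (F := idF C) (G := idF C)).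
  apply: (@eq_ptr _ _ (irr_obj x') (idF C) (idF C)) => V /=.
  rewrite -braid_charE.
  apply: (@eq_ptr _ _ (irr_obj z') (tensF (irr_obj x')) (tensF (irr_obj x'))) => W.
  rewrite double_braidE !braidfE rw_comp -!compA.
  by rewrite (compA (associ _ _ _)) assocK comp_idl.
apply: scale_idm1_inj; rewrite !side.
transitivity (ptr (F := idF C) (G := idF C) (fun V => (braid (irr_obj z) (irr_obj x) ▷ V)
   ∘ fmap (idF C) (braid (irr_obj x) (irr_obj z) ▷ V)) 𝟙).
  apply: (@eq_ptr _ _ (irr_obj x ⊗ irr_obj z) (idF C) (idF C)) => V.
  by rewrite rw_comp.
rewrite ptr_cyclic; last by move=> U W g; rewrite /= interchange.
apply: (@eq_ptr _ _ (irr_obj z ⊗ irr_obj x) (idF C) (idF C)) => V.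
by rewrite rw_comp.
Qed.

Lemma braid_char_unit z X : isomorphic X 𝟙 -> braid_char z X = cat_dim X.
Proof.
move=> iso1; apply: (scale_idm_inj (x := z)) => V.
rewrite -braid_charE -(ptr_id X (tensF (irr_obj z)) V); apply: (@eq_ptr _ _ X (tensF (irr_obj z)) (tensF (irr_obj z))) => U.
exact: double_braid_iso_unit.
Qed.

End Characters.

(** * The handle slide *)

Section Slide.
Variables (K : closedFieldType) (C : premodularCategory K).
Implicit Types (V X Y Z : C) (x y z k l u : irr C).

Record decomp Y := Decomp {
  decomp_size : nat;
  decomp_mem : irr C -> 'I_decomp_size -> bool;
  decomp_inj : forall x, 'I_decomp_size -> hom (irr_obj x) Y;
  decomp_prj : forall x, 'I_decomp_size -> hom Y (irr_obj x);
  decompP : decomposes decomp_mem decomp_inj decomp_prj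
}.

Arguments decomp_mem {Y} d x a.
Arguments decomp_inj {Y} d x a.
Arguments decomp_prj {Y} d x a.

Definition decomp_of Y : decomp Y.
Proof.
by have /cid[n /cid[e /cid[i /cid[p P]]]] := decomposition Y; exact: (Decomp P).
Qed.

Lemma ptr_iso X Y F (f : hom X Y)
    (hX : forall V, hom (fob F (X ⊗ V)) (fob F (X ⊗ V)))
    (hY : forall V, hom (fob F (Y ⊗ V)) (fob F (Y ⊗ V))) V :
  is_iso f -> natural (F := compF F (tensF Y)) (G := compF F (tensF Y)) hY ->
  (forall V, hY V ∘ fmap F (f ▷ V) = fmap F (f ▷ V) ∘ hX V) ->
  ptr (F := F) (G := F) hX V = ptr (F := F) (G := F) hY V.
Proof.
move=> [f' [f'f ff']] nat_hY e.
transitivity (ptr (F := F) (G := F)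
    (fun V => (fmap F (f' ▷ V) ∘ hY V) ∘ fmap F (f ▷ V)) V).
  apply: eq_ptr => U; rewrite -compA e compA -fmap_comp -rw_comp f'f tensm_id.
  by rewrite fmap_id comp_idl.
rewrite ptr_cyclic; last first.
  move=> U W g; rewrite /= -compA nat_hY /= !compA -!fmap_comp.
  by rewrite interchange.
apply: eq_ptr => U.
by rewrite compA -fmap_comp -rw_comp ff' tensm_id fmap_id comp_idl.
Qed.

Lemma cat_dim_iso X Y : isomorphic X Y -> cat_dim X = cat_dim Y.
Proof.
case=> f iso_f; apply: (scale_idm1_inj (C := C)).
rewrite -(ptr_id X (idF C) 𝟙) -(ptr_id Y (idF C) 𝟙).
apply: (@ptr_iso X Y (idF C) f (fun V => idm (X ⊗ V)) (fun V => idm (Y ⊗ V)) 𝟙 iso_f).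
  by move=> V W g; rewrite comp_idl comp_idr.
by move=> V; rewrite comp_idl comp_idr.
Qed.

Lemma braid_char_iso z X Y : isomorphic X Y -> braid_char z X = braid_char z Y.
Proof.
case=> f iso_f; apply: (scale_idm_inj (x := z)) => V.
rewrite -!braid_charE; apply: (@ptr_iso X Y (tensF (irr_obj z)) f
  (double_braid _ X) (double_braid _ Y) V iso_f); first exact: double_braid_nat.
by move=> U; exact: double_braid_nat2.
Qed.

Variable u : irr C.
Local Notation U := (irr_obj u).
Local Notation W := (dual (irr_obj u)).

Lemma piv_inv_exists X : exists f, is_inverse (piv X) f.
Proof. exact: piv_iso. Qed.
Definition piv_inv X : hom (dual (dual X)) X := sval (cid (piv_inv_exists X)).
Lemma piv_invP X : is_inverse (piv X) (piv_inv X).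
Proof. by rewrite /piv_inv; case: cid. Qed.

(** The partner of [pev X]: together they exhibit dual X as a dual of X on the
    other side. *)
Definition coev' X : hom 𝟙 (dual X ⊗ X) := (dual X ◁ piv_inv X) ∘ coev (dual X).

Lemma pev_coev' X V : (dual X ◁ capf (pev X) V) ∘ cupf (coev' X) (dual X ⊗ V) = idm _.
Proof.
have [pK Kp] := piv_invP X.
rewrite /coev' cupf_post2 pev_capf compA -!lw_comp -compA -rw_comp Kp tensm_id.
by rewrite comp_idr ev_coev.
Qed.

(** [lower] and [raise] are the adjunctions moving the factor U to the other
    side, so that decompositions of U tensor k give decompositions of W tensor x. *)
Definition lower k x (p : hom (U ⊗ irr_obj k) (irr_obj x)) : hom (irr_obj k) (W ⊗ irr_obj x) :=
  (W ◁ p) ∘ cupf (coev' U) (irr_obj k).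
Definition raise k x (i : hom (irr_obj x) (U ⊗ irr_obj k)) : hom (W ⊗ irr_obj x) (irr_obj k) :=
  capf (ev U) (irr_obj k) ∘ (W ◁ i).

Lemma lower_surj k x (g : hom (irr_obj k) (W ⊗ irr_obj x)) : exists p, g = lower p.
Proof.
exists (capf (pev U) (irr_obj x) ∘ (U ◁ g)).
by rewrite /lower lw_comp -compA -cupf_nat compA pev_coev' comp_idl.
Qed.

Lemma raise_surj k x (h : hom (W ⊗ irr_obj x) (irr_obj k)) : exists i, h = raise i.
Proof.
exists ((U ◁ h) ∘ cupf (coev U) (irr_obj x)).
by rewrite /raise lw_comp compA capf_nat -compA coev_ev comp_idr.
Qed.

Lemma lower_sum k x I (r : seq I) (P : pred I) (c : I -> K) (p : I -> _) :
  lower (\sum_(a <- r | P a) c a *: p a : hom (U ⊗ irr_obj k) (irr_obj x))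
  = \sum_(a <- r | P a) c a *: lower (p a).
Proof.
rewrite /lower tensm_sumr comp_suml; apply: eq_bigr => a _.
by rewrite tensmZr compZl.
Qed.

Lemma lowerZ k x c (p : hom (U ⊗ irr_obj k) (irr_obj x)) : lower (c *: p) = c *: lower p.
Proof. by rewrite /lower tensmZr compZl. Qed.

Lemma splitf_lower k x (p : hom (U ⊗ irr_obj k) (irr_obj x)) V :
  splitf (lower p) V = (W ◁ mergef p V) ∘ cupf (coev' U) (irr_obj k ⊗ V).
Proof.
rewrite splitfE /lower rw_comp -cupf_tens mergefE lw_comp !compA -(compA (W ◁ (p ▷ V))).
by rewrite -lw_comp assocK tensm_id comp_idr assoc_nat2.
Qed.

Lemma mergef_raise k x (i : hom (irr_obj x) (U ⊗ irr_obj k)) V :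
  mergef (raise i) V = capf (ev U) (irr_obj k ⊗ V) ∘ (W ◁ splitf i V).
Proof.
rewrite mergefE /raise rw_comp capf_tens splitfE lw_comp -!compA; congr (_ ∘ (_ ∘ _)).
by rewrite compA assoc_nat2 -compA associK comp_idr.
Qed.

(** The dimension of U for the trace on the left.  Its quotient by
    [irr_dim u] normalizes the pairs of families formed by [lower] and [raise]. *)
Definition ldim : K := scalar_of (ev U ∘ coev' U).

(** Trace the composite over k: the loop k closes up first to a scalar on U,
    which is compared with the full trace on U tensor k, that is, on x. *)
Lemma raise_lower k x (i : hom (irr_obj x) (U ⊗ irr_obj k))
    (p : hom (U ⊗ irr_obj k) (irr_obj x)) eps s :
  p ∘ i = eps *: idm _ -> raise i ∘ lower p = s *: idm _ ->
  s * irr_dim k * irr_dim u = eps * irr_dim x * ldim.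
Proof.
move=> pi ri_lp.
pose g V : hom (U ⊗ (irr_obj k ⊗ V)) (U ⊗ (irr_obj k ⊗ V)) := splitf i V ∘ mergef p V.
have nat_g : natural (F := compF (tensF U) (tensF (irr_obj k)))
    (G := compF (tensF U) (tensF (irr_obj k))) g.
  by move=> V V' h; rewrite /g /= -compA mergef_nat !compA splitf_nat.
have [t tE] : exists t, forall V, ptr (F := tensF U) (G := tensF U) g V = t *: idm _.
  apply: (strong_family_scalar (irr_simple u)).
    exact: (ptr_natural (F := tensF _) (G := tensF _) nat_g).
  apply: (ptr_strong nat_g) => V V'.
  rewrite /g rw_comp -compA -mergef_tens compA -splitf_tens -!compA.
  by [].
have t_eq : t * irr_dim u = eps * irr_dim x.
  apply: (scale_idm1_inj (C := C)).
  transitivity (ptr (F := idF C) (G := idF C)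
     (fun V => ptr (F := tensF U) (G := tensF U) g V) 𝟙).
    rewrite -scalerA -(ptr_id U (idF C) 𝟙) -(ptrZ (F := idF C) (G := idF C)).
    by apply: (@eq_ptr _ _ U (idF C) (idF C)) => V; rewrite tE.
  rewrite -(ptr_merge (F := idF C) (G := idF C) (g := mergef p) i 𝟙) /=; last first.
    by move=> V V' h; exact: mergef_nat.
  rewrite -scalerA -(ptr_id (irr_obj x) (idF C) 𝟙) -(ptrZ (F := idF C) (G := idF C)).
  apply: (@eq_ptr _ _ (irr_obj x) (idF C) (idF C)) => V.
  by rewrite mergef_splitf pi tensmZl tensm_id.
have s_eq : s * irr_dim k = t * ldim.
  apply: (scale_idm1_inj (C := C)).
  transitivity (ptr (F := idF C) (G := idF C) (fun V => (raise i ∘ lower p) ▷ V) 𝟙).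
    rewrite -scalerA -(ptr_id (irr_obj k) (idF C) 𝟙) -(ptrZ (F := idF C) (G := idF C)).
    apply: (@eq_ptr _ _ (irr_obj k) (idF C) (idF C)) => V.
    by rewrite ri_lp tensmZl tensm_id.
  pose F := compF (tensF W) (tensF U).
  have nat_cup : natural (F := idF C) (G := F) (cupf (coev' U)).
    by move=> V V' h; exact: cupf_nat.
  have nat_cap : natural (F := F) (G := idF C) (capf (ev U)).
    by move=> V V' h; exact: capf_nat.
  transitivity (ptr (F := idF C) (G := idF C) (fun V => capf (ev U) (irr_obj k ⊗ V)
     ∘ ((W ◁ g V) ∘ cupf (coev' U) (irr_obj k ⊗ V))) 𝟙).
    apply: (@eq_ptr _ _ (irr_obj k) (idF C) (idF C)) => V.
    by rewrite -mergef_splitf splitf_lower mergef_raise -!compA (compA (W ◁ _)) -lw_comp.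
  rewrite (ptr_postcomp _ _ nat_cap) (ptr_precomp _ _ nat_cup).
  rewrite (ptr_fmap (F := tensF U) (G := tensF U) (tensF W) g) tE /= tensmZr tensm_id.
  by rewrite compZl comp_idl compZr capf_cupf scalerA.
by rewrite s_eq mulrAC t_eq.
Qed.

Hypothesis irr_dim_neq0 : forall x, irr_dim (C := C) x != 0.

Lemma raise_lower_scalar k x (i : hom (irr_obj x) (U ⊗ irr_obj k))
    (p : hom (U ⊗ irr_obj k) (irr_obj x)) eps :
  p ∘ i = eps *: idm _ ->
  raise i ∘ lower p = (eps * irr_dim x * ldim / (irr_dim k * irr_dim u)) *: idm _.
Proof.
move=> pi; rewrite {1}(irr_scalarE (raise i ∘ lower p)); congr (_ *: _).
rewrite -(raise_lower pi (irr_scalarE _)) -(mulrA (irr_scalar _)) mulfK //.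
by rewrite mulf_neq0 ?irr_dim_neq0.
Qed.

(** Every morphism between k and W tensor x is of the form [lower] or [raise].
    Were the scalar zero, all composites k -> W tensor U -> k would vanish and
    W tensor U would be a zero object, contradicting the zigzag identity. *)
Lemma ldim_neq0 : ldim != 0.
Proof.
apply/eqP=> ldim0.
have [n [e [i [p dec]]]] := decomposition (W ⊗ U).
have id0 : idm (W ⊗ U) = 0.
  rewrite -dec.2; apply: big1 => k _; apply: big1 => a _.
  have [p' ip'] := lower_surj (x := u) (i k a); have [i' pi'] := raise_surj (x := u) (p k a).
  have := raise_lower_scalar (irr_scalarE (p' ∘ i')).
  rewrite ldim0 mulr0 mul0r scale0r -ip' -pi' dec.1 eqxx => /eqP.
  rewrite scaler_eq0 (negPf (irr_idm_neq0 k)) orbF => /eqP e0.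
  by rewrite (decomposes_i dec) e0 scale0r comp0l.
have ev0 : ev U = 0 by rewrite -(comp_idr (ev U)) id0 comp0r.
have := coev_ev U 𝟙; rewrite ev0 capfE mergefE tensm0l comp0l comp0r comp0l => /esym W0.
have := ev_coev U 𝟙; rewrite ev0 capfE mergefE tensm0l comp0l comp0r tensm0r comp0l.
move=> U0; have := irr_idm_neq0 u; rewrite -(runitiK U) -(comp_idl (runiti U)).
by rewrite -U0 comp0l comp0r eqxx.
Qed.

Let D k := decomp_of (U ⊗ irr_obj k).

(** By [raise_lower] the transposed families are dual to each other up to
    scalars, and by [lower_surj] they span; so the sum fixes every morphism from
    a simple object. *)
Lemma transposed_decomposition x :
  \sum_k \sum_a (irr_dim u * irr_dim k / (ldim * irr_dim x))
      *: (lower (decomp_prj (D k) x a) ∘ raise (decomp_inj (D k) x a)) = idm (W ⊗ irr_obj x).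
Proof.
set E := \sum_k _.
have Elower k b : E ∘ lower (decomp_prj (D k) x b) = lower (decomp_prj (D k) x b).
  rewrite /E comp_suml (bigD1 k) //= [X in _ + X]big1 ?addr0 => [|l ne].
    rewrite comp_suml (bigD1 b) //= [X in _ + X]big1 ?addr0 => [|a ne].
      rewrite compZl -compA (raise_lower_scalar ((decompP (D k)).1 x b b)) eqxx.
      rewrite compZr comp_idr scalerA [in RHS](decomposes_p (decompP (D k))) lowerZ /=.
      congr (_ *: _); field.
      by rewrite !irr_dim_neq0 ldim_neq0.
    rewrite compZl -compA (raise_lower_scalar ((decompP (D k)).1 x b a)) eq_sym.
    by rewrite (negPf ne) !mul0r scale0r comp0r scaler0.
  rewrite comp_suml big1 // => a _.
  by rewrite compZl -compA (hom_irr_eq0 (_ ∘ lower _)) ?comp0r ?scaler0 // eq_sym.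
have Eg k (g : hom (irr_obj k) (W ⊗ irr_obj x)) : E ∘ g = g.
  have [p ->] := lower_surj g.
  rewrite (decomposes_hom_from (decompP (D k)) p) lower_sum comp_sumr.
  by apply: eq_bigr => a _; rewrite compZr Elower.
have [n [e [i [p dec]]]] := decomposition (W ⊗ irr_obj x).
rewrite -(comp_idr E) -dec.2 comp_sumr; apply: eq_bigr => k _.
by rewrite comp_sumr; apply: eq_bigr => a _; rewrite compA Eg.
Qed.

(** The product of a loop x around z with the double braiding of z and W is a
    loop x around z that also encloses W ([ptr_double_braid2]).  Weighted by
    dimensions and summed over x, the pair W tensor x may be decomposed by
    [transposed_decomposition]; moving the pieces around the loop x turns it into
    loops k and U, where U only meets W and straightens it by a zigzag. *)
Lemma handle_slide z V :
  (\sum_x irr_dim x * braid_char z (irr_obj x)) *: double_braid (irr_obj z) W V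
  = (irr_dim u / ldim * \sum_x irr_dim x * braid_char z (irr_obj x))
      *: idm (irr_obj z ⊗ (W ⊗ V)).
Proof.
pose Z := irr_obj z; pose F := compF (tensF Z) (tensF W).
pose M k V : hom (F (U ⊗ (irr_obj k ⊗ V))) (F (U ⊗ (irr_obj k ⊗ V))) :=
  (Z ◁ cupf (coev' U) (irr_obj k ⊗ V))
    ∘ (double_braid Z (irr_obj k) V ∘ (Z ◁ capf (ev U) (irr_obj k ⊗ V))).
pose P x k a V : hom (F (irr_obj x ⊗ V)) (F (irr_obj x ⊗ V)) :=
  fmap F (mergef (decomp_prj (D k) x a) V) ∘ (M k V ∘ fmap F (splitf (decomp_inj (D k) x a) V)).
have D2E x V' : double_braid2 Z W (irr_obj x) V' = \sum_k \sum_a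
    (irr_dim u * irr_dim k / (ldim * irr_dim x)) *: P x k a V'.
  have idE : idm (W ⊗ (irr_obj x ⊗ V')) = \sum_k \sum_a
      (irr_dim u * irr_dim k / (ldim * irr_dim x)) *:
      (splitf (lower (decomp_prj (D k) x a)) V' ∘ mergef (raise (decomp_inj (D k) x a)) V').
    transitivity (assoc W (irr_obj x) V' ∘ ((idm (W ⊗ irr_obj x) ▷ V') ∘ associ _ _ V')).
      by rewrite tensm_id comp_idl associK.
    rewrite -transposed_decomposition !tensm_suml comp_suml comp_sumr.
    apply: eq_bigr => k _; rewrite tensm_suml comp_suml comp_sumr.
    apply: eq_bigr => a _; rewrite tensmZl compZl compZr splitfE mergefE rw_comp.
    by rewrite -!compA.
  rewrite -{1}(comp_idr (double_braid2 _ _ _ _)) -tensm_id idE tensm_sumr comp_sumr.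
  apply: eq_bigr => k _; rewrite tensm_sumr comp_sumr; apply: eq_bigr => a _.
  rewrite tensmZr compZr lw_comp compA double_braid_split splitf_lower mergef_raise.
  by rewrite !lw_comp /P /M /= -!compA.
have natM k : natural (F := compF F (compF (tensF U) (tensF (irr_obj k))))
    (G := compF F (compF (tensF U) (tensF (irr_obj k)))) (M k).
  move=> V1 V2 g; rewrite /M /= -!compA -lw_comp capf_nat lw_comp.
  rewrite (compA (double_braid _ _ _)) (double_braid_nat Z (irr_obj k)) /= -!compA.
  by rewrite compA -lw_comp cupf_nat lw_comp -compA.
have ptrM k V' : ptr (F := F) (G := F) (fun V => ptr (F := compF F (tensF U))
      (G := compF F (tensF U)) (M k) V) V'
    = braid_char z (irr_obj k) *: idm _.
  have nat_cup : natural (F := tensF Z) (G := compF F (tensF U)) (fun V => Z ◁ cupf (coev' U) V).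
    by move=> V1 V2 g; rewrite /= -!lw_comp cupf_nat.
  have nat_cap : natural (F := compF F (tensF U)) (G := tensF Z) (fun V => Z ◁ capf (ev U) V).
    by move=> V1 V2 g; rewrite /= -!lw_comp capf_nat.
  pose h V1 : hom (W ⊗ (U ⊗ V1)) (W ⊗ (U ⊗ V1)) := cupf (coev' U) V1 ∘ capf (ev U) V1.
  transitivity (ptr (F := F) (G := F)
      (fun V => braid_char z (irr_obj k) *: (Z ◁ h V)) V').
    apply: (@eq_ptr _ _ U F F) => V1.
    rewrite (ptr_postcomp _ _ nat_cup) (ptr_precomp _ _ nat_cap) braid_charE.
    by rewrite compZl comp_idl compZr /h lw_comp.
  rewrite (ptrZ (F := F) (G := F)) (ptr_fmap (F := tensF W) (G := tensF W) (tensF Z) h).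
  have -> : ptr (F := tensF W) (G := tensF W) h V' = idm (W ⊗ V').
    by rewrite /ptr /h /= -compA (compA (W ◁ _)) pev_coev' comp_idl coev_ev.
  by rewrite fmap_id.
have ptrP x k V' : \sum_a ptr (F := F) (G := F) (P x k a) V'
    = \sum_a ptr (F := F) (G := F) (fun V => ptr (F := compF F (tensF U))
      (G := compF F (tensF U)) (fun V =>
        fmap F (splitf (decomp_inj (D k) x a) V ∘ mergef (decomp_prj (D k) x a) V) ∘ M k V) V) V'.
  apply: eq_bigr => a _.
  transitivity (ptr (F := F) (G := F) (fun V =>
     (fmap F (mergef (decomp_prj (D k) x a) V) ∘ M k V)
       ∘ fmap F (splitf (decomp_inj (D k) x a) V)) V').
    by apply: (@eq_ptr _ _ (irr_obj x) F F) => V1; rewrite /P compA.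
  rewrite ptr_merge; last first.
    move=> V1 V2 g; rewrite -compA natM /= !compA -!lw_comp.
    by rewrite mergef_nat.
  apply: (@eq_ptr _ _ U F F) => V1.
  apply: (@eq_ptr _ _ (irr_obj k) (compF F (tensF U)) (compF F (tensF U))) => V2.
  by rewrite compA fmap_comp.
have ptrP_sum k V' : \sum_x \sum_a ptr (F := F) (G := F) (P x k a) V'
    = braid_char z (irr_obj k) *: idm _.
  rewrite (eq_bigr _ (fun x _ => ptrP x k V')) -ptrM.
  pose F' := compF F (tensF U).
  pose G x a V1 : hom (F' (irr_obj k ⊗ V1)) (F' (irr_obj k ⊗ V1)) :=
    fmap F (splitf (decomp_inj (D k) x a) V1 ∘ mergef (decomp_prj (D k) x a) V1) ∘ M k V1.
  have sumM V1 : M k V1 = \sum_x \sum_a G x a V1.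
    rewrite -(comp_idl (M k V1)) -(fmap_id F) -(id_decomposition V1 (decompP (D k))).
    rewrite fmap_sum comp_suml; apply: eq_bigr => x _.
    by rewrite fmap_sum comp_suml.
  have ptr_sumM V1 : ptr (F := F') (G := F') (M k) V1
      = \sum_x \sum_a ptr (F := F') (G := F') (G x a) V1.
    transitivity (ptr (F := F') (G := F') (fun V2 => \sum_x \sum_a G x a V2) V1).
      by apply: eq_ptr => V2; exact: sumM.
    by rewrite ptr_sum; apply: eq_bigr => x _; rewrite ptr_sum.
  transitivity (ptr (F := F) (G := F)
      (fun V1 => \sum_x \sum_a ptr (F := F') (G := F') (G x a) V1) V'); last first.
    by apply: (@eq_ptr _ _ U F F) => V1; rewrite ptr_sumM.
  by rewrite ptr_sum; apply: eq_bigr => x _; rewrite ptr_sum.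
have ptrD2 x : ptr (F := F) (G := F) (double_braid2 Z W (irr_obj x)) V
    = \sum_k \sum_a (irr_dim u * irr_dim k / (ldim * irr_dim x))
        *: ptr (F := F) (G := F) (P x k a) V.
  transitivity (ptr (F := F) (G := F) (fun V1 => \sum_k \sum_a
      (irr_dim u * irr_dim k / (ldim * irr_dim x)) *: P x k a V1) V).
    by apply: (@eq_ptr _ _ (irr_obj x) F F) => V1; exact: D2E.
  rewrite ptr_sum; apply: eq_bigr => k _; rewrite ptr_sum; apply: eq_bigr => a _.
  by rewrite ptrZ.
transitivity (\sum_x \sum_k (irr_dim u * irr_dim k / ldim)
    *: \sum_a ptr (F := F) (G := F) (P x k a) V).
  rewrite scaler_suml; apply: eq_bigr => x _.
  rewrite -scalerA -(ptr_double_braid2 _ _ (braid_charE z (irr_obj x))) ptrD2.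
  rewrite scaler_sumr; apply: eq_bigr => k _; rewrite !scaler_sumr.
  apply: eq_bigr => a _; rewrite scalerA; congr (_ *: _); field.
  by rewrite irr_dim_neq0 ldim_neq0.
rewrite exchange_big mulr_sumr scaler_suml; apply: eq_bigr => k _ /=.
rewrite -scaler_sumr ptrP_sum scalerA; congr (_ *: _); field.
exact: ldim_neq0.
Qed.

(** The handle slide makes the double braiding a scalar, and the trace over W
    shows that this scalar is one. *)
Lemma transparent_dual z V :
  (forall x, braid_char z (irr_obj x) = irr_dim x) -> \sum_x irr_dim (C := C) x ^+ 2 != 0 ->
  (exists w, isomorphic W (irr_obj w)) ->
  double_braid (irr_obj z) W V = idm _.
Proof.
move=> zE sum0 [w isoW].
have slide V' : double_braid (irr_obj z) W V' = (irr_dim u / ldim) *: idm _.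
  apply: (@scalerI _ _ _ sum0); rewrite scalerA mulrC.
  have -> : \sum_x irr_dim (C := C) x ^+ 2 = \sum_x irr_dim x * braid_char z (irr_obj x).
    by apply: eq_bigr => x _; rewrite zE.
  exact: handle_slide.
have dimW : cat_dim W != 0 by rewrite (cat_dim_iso isoW) irr_dim_neq0.
suff r1 : irr_dim u / ldim = 1 by rewrite slide r1 scale1r.
apply: (mulIf dimW); rewrite mul1r.
apply: (scale_idm_inj (x := z)) => V'.
have dimWE : cat_dim W = braid_char z W.
  by rewrite (braid_char_iso z isoW) zE; exact: cat_dim_iso.
rewrite [in RHS]dimWE -braid_charE.
rewrite -scalerA -(ptr_id W (tensF (irr_obj z)) V').
rewrite -(ptrZ (F := tensF (irr_obj z)) (G := tensF (irr_obj z))).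
by apply: (@eq_ptr _ _ W (tensF (irr_obj z)) (tensF (irr_obj z))) => V1; rewrite slide.
Qed.
End Slide.

(** * The Grothendieck ring *)

Arguments decomp_mem {K C Y} d x a.
Arguments decomp_inj {K C Y} d x a.
Arguments decomp_prj {K C Y} d x a.

Section GrothendieckRing.
Variables (K : closedFieldType) (C : premodularCategory K).
Implicit Types (V X Y Z : C) (x y z i j k l m : irr C).

Lemma mult_iso k Y Y' : isomorphic Y Y' -> mult k Y = mult k Y'.
Proof. by move=> isoY; apply: dim_hom_iso => //; exact: isomorphic_refl. Qed.

Lemma mult_dim k Y (d : decomp Y) : mult k Y = (\sum_a decomp_mem d k a)%N.
Proof.
rewrite /mult (dim_hom_to (decompP d)) -sum1_card big_mkcond.
by apply: eq_bigr => a _; rewrite inE; case: (decomp_mem _ _ _).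
Qed.

Lemma isomorphic_braid X Y : isomorphic (X ⊗ Y) (Y ⊗ X).
Proof. by exists (braid X Y); exact: braid_iso. Qed.

Lemma isomorphic_trans X Y Z : isomorphic X Y -> isomorphic Y Z -> isomorphic X Z.
Proof.
move=> [f [f' [f'f ff']]] [g [g' [g'g gg']]]; exists (g ∘ f), (f' ∘ g').
by split; rewrite -compA ?(compA g') ?(compA f) ?g'g ?ff' comp_idl.
Qed.

(** Composing a decomposition of Y with decompositions of the products m
    tensor X gives one of Y tensor X, indexed by a sigma type. *)
Lemma mult_tensl k Y X : mult k (Y ⊗ X) = (\sum_m mult m Y * mult k (irr_obj m ⊗ X))%N.
Proof.
pose d := decomp_of Y; pose D m := decomp_of (irr_obj m ⊗ X).
pose J := {m : irr C & ('I_(decomp_size d) * 'I_(decomp_size (D m)))%type}.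
pose e x (s : J) := decomp_mem d (tag s) (tagged s).1 && decomp_mem (D (tag s)) x (tagged s).2.
pose inj x (s : J) : hom (irr_obj x) (Y ⊗ X) :=
  (decomp_inj d (tag s) (tagged s).1 ▷ X) ∘ decomp_inj (D (tag s)) x (tagged s).2.
pose prj x (s : J) : hom (Y ⊗ X) (irr_obj x) :=
  decomp_prj (D (tag s)) x (tagged s).2 ∘ (decomp_prj d (tag s) (tagged s).1 ▷ X).
have dec : decomposes e inj prj.
  split=> [x [m [a b]] [m' [a' b']]|].
    rewrite /inj /prj /e /= -compA (compA (_ ▷ X)) -rw_comp.
    have [eq_m|ne] := eqVneq m m'; last first.
      rewrite (hom_irr_eq0 (decomp_prj d m a ∘ _)) 1?eq_sym // tensm0l comp0l comp0r.
      rewrite (_ : (existT _ _ _ == _) = false) ?scale0r //.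
      by apply/eqP=> eq_s; case/eqP: ne; case: (congr1 (fun s : J => tag s) eq_s).
    subst m'; rewrite (decompP d).1 tensmZl tensm_id compZl comp_idl compZr.
    rewrite (decompP (D m)).1 scalerA -natrM mulnb; congr (_%:R *: _).
    rewrite -[existT _ _ _ == _]/(Tagged _ (a, b) == Tagged _ (a', b')) eq_Tagged /=.
    by rewrite xpair_eqE; case: (a == a'); case: (b == b'); rewrite /= ?andbF.
  rewrite exchange_big /=.
  pose G m (ab : 'I_(decomp_size d) * 'I_(decomp_size (D m))) : hom (Y ⊗ X) (Y ⊗ X) :=
     \sum_x ((decomp_inj d m ab.1 ▷ X) ∘ decomp_inj (D m) x ab.2)
              ∘ (decomp_prj (D m) x ab.2 ∘ (decomp_prj d m ab.1 ▷ X)).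
  transitivity (\sum_m \sum_ab G m ab).
    by rewrite [RHS]sig_big_dep /=; apply: eq_bigr.
  rewrite -[RHS]tensm_id -(decompP d).2 tensm_suml; apply: eq_bigr => m _.
  rewrite tensm_suml; transitivity (\sum_a \sum_b G m (a, b)).
    by rewrite [RHS]pair_bigA; apply: eq_bigr => -[a b] _.
  apply: eq_bigr => a _; rewrite exchange_big /= rw_comp.
  rewrite -[X in _ = X ∘ _]comp_idr -(decompP (D m)).2 comp_sumr comp_suml.
  apply: eq_bigr => x _; rewrite comp_sumr comp_suml; apply: eq_bigr => b _.
  by rewrite -!compA.
rewrite {1}/mult (dim_hom_to dec) -sum1_card big_mkcond /=.
rewrite (eq_bigr (fun s : J => (decomp_mem d (tag s) (tagged s).1
   * decomp_mem (D (tag s)) k (tagged s).2)%N)); last first.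
  by move=> s _; rewrite inE /e; case: (decomp_mem _ _ _); case: (decomp_mem _ _ _).
transitivity (\sum_m \sum_(ab : 'I_(decomp_size d) * 'I_(decomp_size (D m)))
  (decomp_mem d m ab.1 * decomp_mem (D m) k ab.2))%N.
  by rewrite [RHS]sig_big_dep /=; apply: eq_bigr.
apply: eq_bigr => m _; rewrite (mult_dim m d) (mult_dim k (D m)).
transitivity (\sum_a \sum_b decomp_mem d m a * decomp_mem (D m) k b)%N.
  by rewrite [RHS]pair_bigA; apply: eq_bigr => -[a b] _.
by rewrite big_distrl; apply: eq_bigr => a _; rewrite big_distrr.
Qed.

Lemma mult_tensr k Y X : mult k (X ⊗ Y) = (\sum_m mult m Y * mult k (X ⊗ irr_obj m))%N.
Proof.
rewrite (mult_iso k (isomorphic_braid X Y)) mult_tensl; apply: eq_bigr => m _.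
by rewrite (mult_iso k (isomorphic_braid _ X)).
Qed.

Lemma dim_hom_adjoint X Y Z : \dim {: hom Z (X ⊗ Y)} = \dim {: hom (dual X ⊗ Z) Y}.
Proof.
apply: (@dim_bijection K _ _
  (fun f : hom Z (X ⊗ Y) => capf (ev X) Y ∘ (dual X ◁ f))
  (fun g => (X ◁ g) ∘ cupf (coev X) Z)).
- by move=> c f g; rewrite tensmDr tensmZr compDr compZr.
- by move=> f; rewrite lw_comp -compA -cupf_nat compA ev_coev comp_idl.
- by move=> g; rewrite lw_comp compA capf_nat -compA coev_ev comp_idr.
Qed.

Lemma isomorphic_runit X : isomorphic (X ⊗ 𝟙) X.
Proof. by exists (runit X), (runiti X); exact: runit_inverse. Qed.

Lemma isomorphic_lunit X : isomorphic (𝟙 ⊗ X) X.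
Proof. by exists (lunit X), (luniti X); exact: lunit_inverse. Qed.

(** Both spaces are identified with the morphisms from the unit to X tensor
    dual X, using the braiding and the pivotal structure. *)
Lemma dim_endo_dual X : \dim {: hom (dual X) (dual X)} = \dim {: hom X X}.
Proof.
have bidual : isomorphic (dual (dual X)) X.
  by apply: isomorphic_sym; exists (piv X); exact: piv_iso.
transitivity (\dim {: hom 𝟙 (X ⊗ dual X)}).
  rewrite dim_hom_adjoint; apply: dim_hom_iso; last exact: isomorphic_refl.
  by apply: isomorphic_sym; exact: isomorphic_runit.
transitivity (\dim {: hom 𝟙 (dual X ⊗ X)}).
  by apply: dim_hom_iso; [exact: isomorphic_refl | exact: isomorphic_braid].
rewrite dim_hom_adjoint; apply: dim_hom_iso; last exact: isomorphic_refl.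
exact: isomorphic_trans (isomorphic_runit _) bidual.
Qed.

Lemma dual_irr_exists i : exists j, isomorphic (dual (irr_obj i)) (irr_obj j).
Proof. by apply: endo_dim1_irr; rewrite dim_endo_dual dim_hom_irr eqxx. Qed.

Definition irr_dual i : irr C := sval (cid (dual_irr_exists i)).

Lemma irr_dualP i : isomorphic (dual (irr_obj i)) (irr_obj (irr_dual i)).
Proof. by rewrite /irr_dual; case: cid. Qed.

Lemma unit_irr_exists : exists i : irr C, isomorphic 𝟙 (irr_obj i).
Proof. by have [i [iso1 _]] := irr_complete (fus_unit_simple C); exists i. Qed.

Definition irr_one : irr C := sval (cid unit_irr_exists).

Lemma irr_oneP : isomorphic (irr_obj irr_one) 𝟙.
Proof. by apply: isomorphic_sym; rewrite /irr_one; case: cid. Qed.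

Lemma mult_irr k j : mult k (irr_obj j) = (j == k).
Proof. by rewrite /mult dim_hom_irr eq_sym. Qed.

Lemma mult_assoc i j k l :
  (\sum_m mult m (irr_obj i ⊗ irr_obj j) * mult l (irr_obj m ⊗ irr_obj k)
   = \sum_m mult m (irr_obj j ⊗ irr_obj k) * mult l (irr_obj i ⊗ irr_obj m))%N.
Proof.
rewrite -mult_tensl -mult_tensr; apply: mult_iso.
by exists (assoc (irr_obj i) (irr_obj j) (irr_obj k)); exact: assoc_iso.
Qed.

Lemma mult_one j k : mult k (irr_obj irr_one ⊗ irr_obj j) = (j == k).
Proof.
rewrite -mult_irr; apply: mult_iso; apply: isomorphic_trans (isomorphic_lunit _).
by apply: isomorphic_tens; [exact: irr_oneP | exact: isomorphic_refl].
Qed.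

(** Frobenius reciprocity. *)
Lemma mult_dual i j k :
  mult k (irr_obj i ⊗ irr_obj j) = mult j (irr_obj (irr_dual i) ⊗ irr_obj k).
Proof.
rewrite /mult dim_hom_adjoint.
rewrite (dim_hom_iso (isomorphic_tens (irr_dualP i) (isomorphic_refl _)) (isomorphic_refl _)).
by have [n [e [inj [prj dec]]]] := decomposition (irr_obj (irr_dual i) ⊗ irr_obj k);
  rewrite (dim_hom_from dec).
Qed.

Definition fusion_ring : comFusionRing :=
  @ComFusionRing (irr C) (fun i j k => mult k (irr_obj i ⊗ irr_obj j)) irr_one irr_dual
    (fun i j k => mult_iso k (isomorphic_braid _ _)) mult_assoc mult_one mult_dual.

(** By multiplicativity the dimension of the unit fixes every other dimension,
    so it is one as soon as some dimension is nonzero. *)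
Lemma cat_dim_character : (exists i, irr_dim (C := C) i != 0) ->
  is_character (I := fusion_ring) (@irr_dim K C).
Proof.
case=> i di; split=> [|x y]; last exact: irr_dim_mul.
apply: (mulIf di); rewrite mul1r irr_dim_mul (bigD1 i) //= mult_one eqxx mul1r.
by rewrite big1 ?addr0 // => k ne; rewrite mult_one eq_sym (negPf ne) mul0r.
Qed.

Lemma braid_char_character z : (exists i, irr_dim (C := C) i != 0) ->
  is_character (I := fusion_ring) (fun x => braid_char z (irr_obj x)).
Proof.
move=> /cat_dim_character[d1 _]; split=> [|x y]; last exact: braid_char_mul.
by rewrite /= (braid_char_unit z irr_oneP) -d1.
Qed.
End GrothendieckRing.

(** * Frobenius-Perron dimensions and fusion subcategories *)

Local Open Scope classical_set_scope.
Local Open Scope complex_scope.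

Section PerronEigenvalue.
Variable R : realType.

(** A positive left eigenvector makes mu an eigenvalue; pairing with the
    positive right eigenvector bounds every other one. *)
Lemma sup_eigenvalue_positive n (A : 'M[R]_n) (w : 'I_n -> R) mu :
  (0 < n)%N -> 0 <= mu -> (forall i j, 0 <= A i j) -> (forall i, 0 < w i) ->
  (forall j, \sum_k A j k * w k = mu * w j) ->
  (forall k, \sum_j A j k * w j = mu * w k) ->
  sup [set r : R | 0 <= r /\ eigenvalue A r] = mu.
Proof.
move=> n0 mu0 A0 w0 eig_col eig_row; set E := [set r | _].
have E_mu : E mu.
  split=> //; apply/eigenvalueP; exists (\row_j w j).
    by apply/rowP=> k; rewrite !mxE -eig_row; apply: eq_bigr => j _; rewrite mxE mulrC.
  apply/eqP=> /rowP/(_ (Ordinal n0)); rewrite !mxE => /eqP.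
  by rewrite gt_eqF.
have ub_mu : ubound E mu.
  move=> r [r0 /eigenvalueP[v vA v0]].
  pose S := \sum_k `|v 0 k| * w k.
  have [k vk] : exists k, v 0 k != 0.
    by apply/rV0Pn.
  have S0 : 0 < S.
    rewrite /S (bigD1 k) //= ltr_pwDl ?mulr_gt0 ?normr_gt0 //.
    by apply: sumr_ge0 => j _; rewrite mulr_ge0 // ltW.
  rewrite -(ler_pM2r S0) /S !mulr_sumr.
  apply: (@le_trans _ _ (\sum_k (\sum_j `|v 0 j| * A j k) * w k)).
    apply: ler_sum => l _; rewrite mulrA; apply: ler_wpM2r; first exact: ltW.
    have -> : r * `|v 0 l| = `|\sum_j v 0 j * A j l|.
      by move/rowP/(_ l): vA; rewrite !mxE => ->; rewrite normrM ger0_norm.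
    apply: (le_trans (ler_norm_sum _ _ _)).
    by apply: ler_sum => j _; rewrite normrM (ger0_norm (A0 _ _)).
  under eq_bigr => l _ do rewrite mulr_suml.
  rewrite exchange_big /=; apply: ler_sum => j _.
  rewrite mulrCA -eig_col mulr_sumr; apply: ler_sum => l _.
  by rewrite mulrA.
apply/le_anti; rewrite ge_sup //=; last by exists mu.
by apply: ub_le_sup => //; exists mu.
Qed.
End PerronEigenvalue.

Section Subcategories.
Variables (R : realType) (C : premodularCategory R[i]).
Implicit Types (X Y Z : C) (x y z i j k l m : irr C) (D : set C).

Lemma generated_by_subcategory (S : set C) : is_fusion_subcategory (generated_by S).
Proof.
split.
- by move=> D subD _; exact: sub_unit.
- by move=> X Y gX gY D subD SD; apply: sub_tens => //; [exact: gX | exact: gY].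
- by move=> X gX D subD SD; apply: sub_dual => //; exact: gX.
- move=> n F X gF sumF D subD SD; apply: (sub_direct_sum subD _ sumF) => j.
  exact: gF.
- move=> X Y i p pi gY D subD SD; apply: (sub_summand subD pi); exact: gY.
Qed.

Lemma generated_by_sub (S : set C) : S `<=` generated_by S.
Proof. by move=> X SX D _; apply. Qed.

Lemma setT_subcategory : is_fusion_subcategory (setT : set C).
Proof. by split. Qed.

Lemma subcategory_iso D X Y : is_fusion_subcategory D -> isomorphic X Y -> D X -> D Y.
Proof. by move=> subD [f [g [_ fg]]]; exact: (sub_summand subD fg). Qed.

Lemma mult_neq0 k X (h : hom (irr_obj k) X) : h != 0 -> mult k X != 0%N.
Proof.
move=> h0; rewrite /mult dimv_eq0; apply: contra h0 => /eqP full0.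
by rewrite -memv0 -full0 memvf.
Qed.

Lemma mult_neq0_hom k X : mult k X != 0%N -> exists h : hom (irr_obj k) X, h != 0.
Proof.
rewrite /mult dimv_eq0 => full0.
by exists (vpick {: hom (irr_obj k) X}); rewrite vpick0.
Qed.

Lemma mult_summand k X : mult k X != 0%N ->
  exists (h : hom (irr_obj k) X) (p : hom X (irr_obj k)), p ∘ h = idm _.
Proof.
rewrite (mult_dim k (decomp_of X)) sum_nat_eq0 => /forallPn[a].
rewrite implybE /=; case E: (decomp_mem _ _ _) => // _.
exists (decomp_inj (decomp_of X) k a), (decomp_prj (decomp_of X) k a).
by rewrite (decompP (decomp_of X)).1 eqxx E scale1r.
Qed.

Lemma mult_irr_iso x X : (forall k, mult k X = (k == x)) -> isomorphic X (irr_obj x).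
Proof.
move=> multX; pose d := decomp_of X.
have off k a : k != x -> decomp_mem d k a = false.
  move=> ne; have := multX k; rewrite (mult_dim k d) (negPf ne) => /eqP.
  by rewrite sum_nat_eq0 => /forallP/(_ a); rewrite implybE /=; case: (decomp_mem _ _ _).
have [a xa] : exists a, decomp_mem d x a.
  apply: contrapT => none; have := multX x; rewrite (mult_dim x d) eqxx big1 // => a _.
  by apply/eqP; rewrite eqb0; apply/negP => xa; apply: none; exists a.
have uniq_a b : b != a -> decomp_mem d x b = false.
  move=> ne; have := multX x; rewrite (mult_dim x d) eqxx (bigD1 a) //= xa => -[] /eqP.
  by rewrite sum_nat_eq0 => /forallP/(_ b); rewrite ne /=; case: (decomp_mem _ _ _).
exists (decomp_prj d x a), (decomp_inj d x a); split; last first.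
  by rewrite (decompP d).1 eqxx xa scale1r.
rewrite -(decompP d).2 (bigD1 x) //= (bigD1 a) //= !big1 ?addr0 //.
  move=> k ne; apply: big1 => b _.
  by rewrite (decomposes_i (decompP d)) off // scale0r comp0l.
by move=> b ne; rewrite (decomposes_i (decompP d)) uniq_a // scale0r comp0l.
Qed.

Lemma subcategory_tens_irr D x y k : is_fusion_subcategory D ->
  D (irr_obj x) -> D (irr_obj y) -> mult k (irr_obj x ⊗ irr_obj y) != 0%N -> D (irr_obj k).
Proof.
move=> subD Dx Dy /mult_summand[h [p ph]].
by apply: (sub_summand subD ph); exact: sub_tens.
Qed.

Lemma subcategory_dual_irr D x : is_fusion_subcategory D ->
  D (irr_obj x) -> D (irr_obj (irr_dual x)).
Proof.
move=> subD Dx; apply: (subcategory_iso subD (irr_dualP x)); exact: sub_dual.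
Qed.

Lemma subcategory_one_irr D : is_fusion_subcategory D -> D (irr_obj (irr_one C)).
Proof.
move=> subD; apply: (subcategory_iso subD (isomorphic_sym (irr_oneP C))).
exact: sub_unit.
Qed.

(** A form of reciprocity for an arbitrary object X, by the adjunction and
    the pivotal structure. *)
Lemma mult_dual_obj k X : mult k (dual X) = mult (irr_one C) (X ⊗ irr_obj k).
Proof.
have bidual : isomorphic (dual (dual X)) X.
  by apply: isomorphic_sym; exists (piv X); exact: piv_iso.
have -> : mult k (dual X) = mult k (dual X ⊗ irr_obj (irr_one C)).
  apply: mult_iso; apply: isomorphic_sym; apply: isomorphic_trans (isomorphic_runit _).
  by apply: isomorphic_tens; [exact: isomorphic_refl | exact: irr_oneP].
rewrite {1}/mult dim_hom_adjoint.
rewrite (dim_hom_iso (isomorphic_tens bidual (isomorphic_refl _)) (isomorphic_refl _)).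
by rewrite (dim_hom_from (decompP (decomp_of (X ⊗ irr_obj k)))).
Qed.

Variable f : fusion_ring C -> R.
Hypotheses (f_gt0 : forall x, 0 < f x) (f_char : is_character f).

(** The restriction of f to the simple objects of D is a left and right positive
    eigenvector of the fusion matrix, since D is closed under constituents of
    products. *)
Lemma FPdim_inE D Y y : is_fusion_subcategory D -> isomorphic Y (irr_obj y) ->
  D (irr_obj y) -> FPdim_in D Y = f y.
Proof.
move=> subD isoY Dy.
pose g (a : 'I_#|irr_in D|) : irr C := val (enum_val a : irr_in D).
have gD a : D (irr_obj (g a)).
  by apply/set_mem; exact: (valP (enum_val a : irr_in D)).
have sumD (F : irr C -> R) : (forall k, F k != 0 -> D (irr_obj k)) ->
    \sum_a F (g a) = \sum_k F k.
  move=> F0.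
  transitivity (\sum_(t : irr_in D) F (val t)).
    by rewrite (reindex _ (onW_bij _ (@enum_val_bij (irr_in D)))).
  rewrite -(big_sub [pred k | irr_obj k \in D] F) big_mkcond /=.
  apply: eq_bigr => k _; case: ifP => // /negbT Dk; apply/esym/eqP.
  by apply: contraNT Dk => /F0 Dk; exact/mem_set.
have coefE j k : fusion_coeff Y (irr_obj j) (irr_obj k)
    = fcoef (y : fusion_ring C) j k :> nat.
  apply: dim_hom_iso; first exact: isomorphic_refl.
  by apply: isomorphic_tens => //; exact: isomorphic_refl.
have f_star x : f (fstar (x : fusion_ring C)) = f x by exact: positive_character_star.
apply: (@sup_eigenvalue_positive _ _ _ (fun a => f (g a))) => //.
- have : (0 < #|irr_in D|)%N.
    by apply/card_gt0P; exists (exist _ y (mem_set Dy)).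
  by [].
- by apply: ltW.
- by move=> a b; rewrite mxE.
- move=> a; rewrite f_char.2.
  under eq_bigr => b _ do rewrite mxE coefE.
  rewrite (sumD (fun k => (fcoef (y : fusion_ring C) (g a) k)%:R * f k)) // => k ne.
  apply: (subcategory_tens_irr subD Dy (gD a)).
  by apply: contra ne => /eqP ne; rewrite /= ne mul0r.
move=> b; rewrite -{1}f_star.
under eq_bigr => a _ do rewrite mxE coefE.
rewrite (sumD (fun j => (fcoef (y : fusion_ring C) j (g b))%:R * f j)); last first.
  move=> k ne; apply: (subcategory_tens_irr subD (subcategory_dual_irr subD Dy) (gD b)).
  have -> : mult k (irr_obj (irr_dual y) ⊗ irr_obj (g b)) = fcoef (y : fusion_ring C) k (g b).
    by rewrite fcoef_star.
  by apply: contra ne => /eqP ne; change ((fcoef (y : fusion_ring C) k (g b))%:R * f k == 0); rewrite ne mul0r.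
by rewrite -(character_eigen_star (y : fusion_ring C) (g b) f_char).
Qed.

Lemma FPdim_subE D : is_fusion_subcategory D ->
  FPdim_sub D = \sum_(k | irr_obj k \in D) f k ^+ 2.
Proof.
move=> subD; rewrite /FPdim_sub (big_sub [pred k | irr_obj k \in D] (fun k => f k ^+ 2)) /=.
apply: eq_bigr => t _; rewrite (FPdim_inE (y := val t)) //; first exact: isomorphic_refl.
by apply/set_mem; exact: (valP t).
Qed.

(** The objects all of whose simple constituents k have f k = 1 form a fusion
    subcategory, because f >= 1; it contains the invertible simple objects, for
    which f x ^+ 2 = 1. *)
Lemma pointed_part_dim1 k : pointed_part C (irr_obj k) -> f k = 1.
Proof.
pose D : set C := [set X | forall k, mult k X != 0%N -> f k = 1].
have f1 := f_char.1; have f0 j : 0 <= f j by exact: ltW.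
have ge1 j : 1 <= f j by exact: (positive_character_ge1 (I := fusion_ring C) f_gt0 f_char j).
have D_tens X Y : D X -> D Y -> D (X ⊗ Y).
  move=> DX DY l; rewrite mult_tensl sum_nat_eq0 => /forallPn[m].
  rewrite implybE /= muln_eq0 negb_or => /andP[/DX fm].
  rewrite mult_tensr sum_nat_eq0 => /forallPn[j].
  rewrite implybE /= muln_eq0 negb_or => /andP[/DY fj Nl].
  apply/le_anti; rewrite ge1 andbT.
  have -> : 1 = f m * f j by rewrite fm fj mulr1.
  rewrite f_char.2 (bigD1 (l : fusion_ring C)) //=.
  apply: (@le_trans _ _ ((mult l (irr_obj m ⊗ irr_obj j))%:R * f l)).
    by rewrite ler_peMl // ler1n lt0n.
  by rewrite lerDl sumr_ge0 // => p _; rewrite mulr_ge0.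
suff subD : is_fusion_subcategory D.
  move=> /(_ D subD) Dk; apply: Dk; last by rewrite mult_irr eqxx.
  move=> X [simX [_ iso_coev]] l.
  have [x [isoX _]] := irr_complete simX.
  rewrite (mult_iso l isoX) mult_irr; case: (x =P l) => // <- _.
  have prod1 : f x * f (irr_dual x) = 1.
    rewrite f_char.2 (bigD1 (irr_one C : fusion_ring C)) //=.
    have multE p : mult p (irr_obj x ⊗ irr_obj (irr_dual x)) = (irr_one C == p).
      rewrite -mult_irr -(mult_iso p (isomorphic_sym (irr_oneP C))).
      have -> : mult p 𝟙 = mult p (X ⊗ dual X) by apply: mult_iso; exists (coev X).
      have multX q r : mult q (X ⊗ irr_obj r) = fcoef (x : fusion_ring C) r q.
        by apply: mult_iso; apply: isomorphic_tens => //; exact: isomorphic_refl.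
      rewrite [RHS]mult_tensr (bigD1 (irr_dual x)) //= mult_dual_obj !multX fcoef_one eqxx.
      rewrite mul1n big1 ?addn0 // => q ne.
      by rewrite mult_dual_obj multX fcoef_one (negPf ne).
    rewrite multE eqxx mul1r f1 big1 ?addr0 // => p ne.
    by rewrite multE eq_sym (negPf ne) mul0r.
  have := positive_character_star (I := fusion_ring C) f_gt0 f_char x; rewrite /= => fx.
  move: prod1; rewrite fx -expr2 => /eqP; rewrite sqrf_eq1 => /orP[/eqP //|/eqP e].
  by have := f_gt0 x; rewrite e ltr0N1.
split.
- move=> l; rewrite -(mult_iso l (irr_oneP C)) mult_irr.
  by case: (irr_one C =P l) => // <- _; exact: f1.
- exact: D_tens.
- move=> X DX l; rewrite mult_dual_obj mult_tensl sum_nat_eq0 => /forallPn[m].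
  rewrite implybE /= muln_eq0 negb_or => /andP[/DX fm].
  rewrite -[mult _ _]/(fcoef (m : fusion_ring C) l (fone (fusion_ring C))) fcoef_one.
  case: (l =P fstar (m : fusion_ring C)) => // -> _.
  by rewrite (positive_character_star (I := fusion_ring C) f_gt0 f_char).
- move=> n F X DF [inc [prj [_ _ sum1]]] l /mult_neq0_hom[h h0].
  have [t pj0] : exists t, prj t ∘ h != 0.
    apply: contrapT => none; case/eqP: h0; rewrite -(comp_idl h) -sum1 comp_suml.
    apply: big1 => t _; rewrite -compA; apply/eqP/negPn/negP => ne.
    by apply: none; exists t; apply: contra ne => /eqP ->; rewrite comp0r.
  exact: (DF t l (mult_neq0 pj0)).
move=> X Y i p pi DY l /mult_neq0_hom[h h0]; apply: (DY l).
apply: (@mult_neq0 l Y (i ∘ h)); apply: contra h0 => /eqP ih0.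
by rewrite -(comp_idl h) -pi -compA ih0 comp0r.
Qed.

Lemma irr_one_unique x : isomorphic (irr_obj x) 𝟙 -> x = irr_one C.
Proof.
move=> iso1; have := mult_irr x (irr_one C); rewrite (mult_iso x (irr_oneP C)).
rewrite -(mult_iso x iso1) mult_irr eqxx.
by case: (irr_one C =P x).
Qed.

Lemma transparent_all (Z : C) :
  (forall x, braid (irr_obj x) Z ∘ braid Z (irr_obj x) = idm _) ->
  forall X, braid X Z ∘ braid Z X = idm (Z ⊗ X).
Proof.
move=> irrZ X; have dec := decompP (decomp_of X).
rewrite -[LHS]comp_idr -[in LHS]tensm_id -dec.2 -[RHS]tensm_id -[in RHS]dec.2.
rewrite !tensm_sumr comp_sumr; apply: eq_bigr => x _.
rewrite !tensm_sumr comp_sumr; apply: eq_bigr => a _.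
rewrite lw_comp -compA (compA (braid Z X)) braid_natural !compA braid_natural.
by rewrite -(compA (Z ◁ _)) irrZ comp_idr.
Qed.

Lemma double_braid_trivial (Z X : C) :
  double_braid Z X 𝟙 = idm _ -> braid X Z ∘ braid Z X = idm (Z ⊗ X).
Proof.
move=> trivial1; have e : (braid X Z ∘ braid Z X) ▷ 𝟙 = idm ((Z ⊗ X) ⊗ 𝟙).
  apply: (iso_mono (assoc_iso Z X 𝟙)); apply: (iso_epi (f := associ Z X 𝟙)).
    by exists (assoc Z X 𝟙); case: (assoc_inverse Z X 𝟙).
  rewrite comp_idr associK -trivial1 double_braidE !braidfE rw_comp -!compA.
  by rewrite (compA (associ X Z 𝟙)) assocK comp_idl.
apply: (iso_epi (f := runit (Z ⊗ X))).
  by exists (runiti (Z ⊗ X)); exact: runit_inverse.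
by rewrite -runit_natural e comp_idr comp_idl.
Qed.

Lemma transparent_center z :
  (forall X, braid X (irr_obj z) ∘ braid (irr_obj z) X = idm (irr_obj z ⊗ X)) ->
  mueger_center C (irr_obj z).
Proof.
move=> transp; apply: generated_by_sub; split; first exact: irr_simple.
move=> X; apply: (iso_epi (braid_iso (irr_obj z) X)).
by rewrite -compA transp comp_idl comp_idr.
Qed.
End Subcategories.

Theorem theorem1p3 (R : realType) (C : premodularCategory R[i])
    (pseudo_unitary_C : pseudo_unitary C)
    (center_pointed : mueger_center C `<=` pointed_part C) :
  (forall Y : C, is_simple Y ->
     algebraic_integer
       (FPdim_cat C * FPdim_sub (mueger_center C) / FPdim Y ^+ 2)%:C) /\
  (acts_freely C ->
   forall Y : C, is_simple Y ->
     algebraic_integer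
       (FPdim_cat C / (FPdim_sub (mueger_center C) * FPdim Y ^+ 2))%:C).
Proof.
have [f [f_gt0 f_char]] := exists_positive_character (fusion_ring C) R.
have centerS : is_fusion_subcategory (mueger_center C).
  exact: generated_by_subcategory.
have FPdimE (Y : C) y : isomorphic Y (irr_obj y) -> FPdim Y = f y.
  by move=> isoY; apply: (FPdim_inE f_gt0 f_char (setT_subcategory C) isoY).
have FPdim_catE : FPdim_cat C = \sum_k f k ^+ 2.
  rewrite /FPdim_cat (FPdim_subE f_gt0 f_char (setT_subcategory C)).
  by apply: eq_bigl => k; apply/mem_set.
have global_dim_f : (\sum_k f k ^+ 2)%:C = \sum_k @irr_dim _ C k ^+ 2.
  by rewrite -FPdim_catE; exact: pseudo_unitary_C.
have dim_neq0_ex : exists k, @irr_dim _ C k != 0.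
  apply: contrapT => none.
  have : (\sum_k f k ^+ 2)%:C = 0.
    rewrite global_dim_f; apply: big1 => k _; apply/eqP; rewrite sqrf_eq0.
    by apply/negPn/negP => ne; apply: none; exists k.
  move/complexI/eqP; rewrite psumr_eq0 => [/allP all0|k _]; last exact: sqr_ge0.
  have := all0 (irr_one C); rewrite mem_index_enum /= sqrf_eq0 => /(_ isT).
  by rewrite gt_eqF.
have d_char := cat_dim_character dim_neq0_ex.
pose chi z x := braid_char z (irr_obj x : C).
have chi_char z : is_character (I := fusion_ring C) (chi z).
  exact: braid_char_character.
have chi_sym (i j : fusion_ring C) : irr_dim j * chi j i = irr_dim i * chi i j.
  exact: braid_char_sym.
pose G : {set fusion_ring C} := finset (fun k => (irr_obj (k : irr C) : C) \in mueger_center C).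
have GP (k : irr C) : reflect (mueger_center C (irr_obj k)) ((k : fusion_ring C) \in G).
  by apply: (iffP idP); rewrite finset.inE => /[dup] h; [move/set_mem | move/mem_set].
have d_neq0 := dim_neq0 f_gt0 f_char d_char global_dim_f.
have f_G (k : fusion_ring C) : k \in G -> f k = 1.
  by move=> /GP/center_pointed; exact: pointed_part_dim1.
have transparent_G (z : fusion_ring C) : (forall i, chi z i = irr_dim i) -> z \in G.
  move=> zE; apply/GP; apply: transparent_center; apply: transparent_all => x.
  (* The handle slide treats duals of simple objects, and x is the dual of u. *)
  pose u : irr C := irr_dual x.
  have ux : irr_dual u = x := fstarK (x : fusion_ring C).
  have isoW : isomorphic (dual (irr_obj u)) (irr_obj x).
    by have := irr_dualP u; rewrite ux.
  have sum0 : \sum_k @irr_dim _ C k ^+ 2 != 0 := global_dim_neq0 f_gt0 global_dim_f.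
  have W_id : double_braid (irr_obj (z : irr C)) (dual (irr_obj u)) 𝟙 = idm _.
    by apply: transparent_dual => //; exists x.
  have [phi iso_phi] := isoW.
  apply: (iso_epi (lw_iso (irr_obj (z : irr C)) iso_phi)).
  rewrite -compA braid_natural compA braid_natural -compA (double_braid_trivial W_id).
  by rewrite comp_idl comp_idr.
have G1 : fone (fusion_ring C) \in G by apply/GP; exact: subcategory_one_irr.
have GV (a : fusion_ring C) : a \in G -> fstar a \in G.
  by move=> /GP Ga; apply/GP; exact: (subcategory_dual_irr centerS Ga).
have GM (a b c : fusion_ring C) : a \in G -> b \in G -> fcoef a b c != 0%N -> c \in G.
  by move=> /GP Ga /GP Gb Nabc; apply/GP; exact: (subcategory_tens_irr centerS Ga Gb Nabc).
have FPdim_center : FPdim_sub (mueger_center C) = #|G|%:R.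
  rewrite (FPdim_subE f_gt0 f_char centerS) -sum1_card natr_sum.
  apply: eq_big => [k|k Gk]; first by apply/idP/GP => [/set_mem|/mem_set].
  by rewrite f_G ?expr1n //; apply/GP/set_mem.
split=> [Y simY|free Y simY]; have [y [isoY _]] := irr_complete simY;
    rewrite FPdim_catE FPdim_center (FPdimE Y y isoY).
  exact: (codegree_integrality f_gt0 f_char d_char chi_char chi_sym global_dim_f
            GM f_G transparent_G).
apply: (free_codegree_integrality f_gt0 f_char d_char chi_char chi_sym global_dim_f
          G1 GV GM f_G transparent_G).
move=> g x gG Ngxx; apply/eqP/negPn/negP => g1.
have shifts_g := positive_character_shifts f_gt0 f_char (f_G g gG).
have [k kP] := shifts_g x.
have kx : k = x by move: Ngxx; rewrite kP; case: (x =P k).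
apply: (free (irr_obj (g : irr C)) (irr_obj (x : irr C))).
- exact/GP.
- exact: irr_simple.
- by move=> iso1; case/eqP: g1; exact: irr_one_unique.
- exact: irr_simple.
by apply: mult_irr_iso => l; have := kP l; rewrite kx.
Qed.
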